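(* Let $(X,\omega)$ be a boundaryless smooth effective symplectic orbifold, not necessarily compact and not necessarily a global quotient, and let $\hbar>0$. Let $L\to X$ be a Hermitian orbifold line bundle with a unitary orbifold connection $\nabla$ of curvature $F_\nabla$. For $f\in C^\infty_{\mathrm{orb}}(X)$ define the operator on orbifold sections of $L$ $$Q(f)=-i\hbar\,\nabla_{X_f}+f,$$ where $f$ acts by pointwise multiplication. Then $$[Q(f),Q(g)]=i\hbar\,Q(\{f,g\})\qquad\text{for all } f,g\in C^\infty_{\mathrm{orb}}(X)$$ if and only if $$F_\nabla=-\frac{i}{\hbar}\,\omega.$$
   Context: Orbifold: a paracompact Hausdorff space $|X|$ with an atlas of uniformizing charts $(V,G,\pi)$, where $V$ is a connected open subset of Euclidean space, $G$ is a finite group acting smoothly and effectively on $V$, and $\pi:V\to|X|$ is $G$-invariant and induces a homeomorphism from $V/G$ onto an open set; every point in the overlap of two charts lies in a smaller chart embedding into both, where an embedding is a smooth open embedding $V'\to V$ equivariant for an injective homomorphism $G'\to G$ and compatible with the projections. Orbifold functions ($C^\infty_{\mathrm{orb}}(X)$), forms and vector fields are families of $G$-invariant smooth functions, forms, vector fields on the charts, compatible under chart embeddings. A symplectic orbifold carries a closed nondegenerate orbifold 2-form $\omega$. A Hermitian orbifold line bundle is a family of $G$-equivariant Hermitian complex line bundles $L_V\to V$ glued by equivariant unitary isomorphisms over chart embeddings satisfying the cocycle condition; its (orbifold) sections are compatible families of smooth $G$-invariant sections of the $L_V$. An orbifold connection is a compatible family of $G$-equivariant connections; it is unitary if it preserves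 the Hermitian metric. Curvature: $F_\nabla(Y,Z)=[\nabla_Y,\nabla_Z]-\nabla_{[Y,Z]}$. Sign conventions: the Hamiltonian vector field $X_f$ is defined by $\iota_{X_f}\omega=-df$, and the Poisson bracket is $\{f,g\}=\omega(X_g,X_f)$. *)

(* Defs.v *)
From HB Require Import structures.
From mathcomp Require Import all_boot all_order all_algebra fingroup.
From mathcomp Require Import all_classical all_reals all_analysis.
From mathcomp Require Import complex.

Set Implicit Arguments.
Unset Strict Implicit.
Unset Printing Implicit Defensive.

Import Order.TTheory GRing.Theory Num.Theory.
Import numFieldNormedType.Exports.
Local Open Scope classical_set_scope.
Local Open Scope ring_scope.

(* Throughout, maps on an open set A of R^n are total functions on 'rV_n whose
   values outside A are irrelevant, and a tangent vector at a point of A is a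
   row vector, so that the differential of l at x sends u to 'D_u l x. *)

(* All iterated partial derivatives exist and are continuous at every point of
   A; meant for A open. *)
Definition smooth (R : realType) (n : nat) (W : normedModType R)
    (A : set 'rV[R]_n) (f : 'rV[R]_n -> W) : Prop :=
  forall s : seq 'I_n,
    let h := foldr (fun i g => 'D_(delta_mx 0 i) g) f s in
    forall x, A x ->
      {for x, continuous h} /\ forall i, derivable h x (delta_mx 0 i).

Definition csmooth (R : realType) (n : nat) (A : set 'rV[R]_n)
    (f : 'rV[R]_n -> R[i]) : Prop :=
  smooth A (fun x => complex.Re (f x)) /\ smooth A (fun x => complex.Im (f x)).

Definition cderive (R : realType) (n : nat) (u : 'rV[R]_n)
    (f : 'rV[R]_n -> R[i]) (x : 'rV[R]_n) : R[i] :=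
  (('D_u (fun y => complex.Re (f y)) x) +i* ('D_u (fun y => complex.Im (f y)) x))%C.

Definition lie_bracket (R : realType) (n : nat) (Y Z : 'rV[R]_n -> 'rV[R]_n)
    (x : 'rV[R]_n) : 'rV[R]_n :=
  'D_(Y x) Z x - 'D_(Z x) Y x.

(* Exterior derivative of the 2-form w at x, evaluated on u, v, t: the terms
   with Lie brackets vanish, u, v and t being extended to constant fields. *)
Definition ext_deriv (R : realType) (n : nat)
    (w : 'rV[R]_n -> 'rV[R]_n -> 'rV[R]_n -> R) (x u v t : 'rV[R]_n) : R :=
  'D_u (fun y => w y v t) x - 'D_v (fun y => w y u t) x
    + 'D_t (fun y => w y u v) x.

Definition paracompact_space (X : topologicalType) : Prop :=
  forall U : set (set X),
    (forall A, U A -> open A) -> (forall x, exists2 A, U A & A x) ->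
  exists W : set (set X),
    [/\ forall B, W B -> open B,
        forall x, exists2 B, W B & B x,
        forall B, W B -> exists2 A, U A & B `<=` A
      & forall x : X, exists2 N, nbhs x N &
          finite_set [set B | W B /\ B `&` N !=set0] ].

(* [proj_fiber] to [proj_homeo] say that the projection is G-invariant and that
   the induced map from V/G, with the quotient topology, is a homeomorphism
   onto the open set [proj @` dom]. *)
Record uniformizing_chart (R : realType) (X : topologicalType) := UChart {
  dim : nat;
  dom : set 'rV[R]_dim;
  grp : finGroupType;
  act : grp -> 'rV[R]_dim -> 'rV[R]_dim;
  proj : 'rV[R]_dim -> X;
  dom_open : open dom;
  dom_connected : connected dom;
  act_dom : forall g x, dom x -> dom (act g x);
  act1 : forall x, dom x -> act 1%g x = x;
  actM : forall g h x, dom x -> act (g * h)%g x = act g (act h x);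
  act_smooth : forall g, smooth dom (act g);
  act_effective : forall g, (forall x, dom x -> act g x = x) -> g = 1%g;
  proj_fiber : forall x y, dom x -> dom y ->
    (proj x = proj y <-> exists g, y = act g x);
  proj_open : open (proj @` dom);
  proj_homeo : forall W, W `<=` proj @` dom ->
    (open W <-> open (dom `&` proj @^-1` W))
}.

Arguments dom {R X} u.
Arguments proj {R X} u.

Definition equivariant (R : realType) (X : topologicalType)
    (c d : uniformizing_chart R X) (l : 'rV[R]_(dim c) -> 'rV[R]_(dim d))
    (th : grp c -> grp d) : Prop :=
  [/\ injective th,
      forall g h, th (g * h)%g = (th g * th h)%g
    & forall g x, dom c x -> l (act g x) = act (th g) (l x) ].

Definition smooth_open_embedding (R : realType) (n m : nat)
    (A : set 'rV[R]_n) (l : 'rV[R]_n -> 'rV[R]_m) : Prop :=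
  [/\ smooth A l, open (l @` A)
    & exists2 k : 'rV[R]_m -> 'rV[R]_n,
        smooth (l @` A) k & forall x, A x -> k (l x) = x].

Definition chart_embedding (R : realType) (X : topologicalType)
    (c d : uniformizing_chart R X) (l : 'rV[R]_(dim c) -> 'rV[R]_(dim d))
    : Prop :=
  [/\ smooth_open_embedding (dom c) l,
      forall x, dom c x -> dom d (l x),
      exists th : grp c -> grp d, equivariant l th
    & forall x, dom c x -> proj d (l x) = proj c x].

Record orbifold (R : realType) := Orbifold {
  space : topologicalType;
  space_hausdorff : hausdorff_space space;
  space_paracompact : paracompact_space space;
  atlas : Type;
  chart : atlas -> uniformizing_chart R space;
  chart_cover : forall p, exists i, exists2 x, dom (chart i) x & proj (chart i) x = p;
  chart_overlap : forall i j p,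
    (proj (chart i) @` dom (chart i)) p -> (proj (chart j) @` dom (chart j)) p ->
    exists k, (proj (chart k) @` dom (chart k)) p /\
      (exists l, @chart_embedding _ _ (chart k) (chart i) l) /\
      (exists m, @chart_embedding _ _ (chart k) (chart j) m)
}.

Notation Dom O i := (dom (@chart _ O i)).
Notation Emb O i j := (@chart_embedding _ _ (@chart _ O i) (@chart _ O j)).

Definition orbi_function (R : realType) (O : orbifold R)
    (f : forall i : atlas O, 'rV[R]_(dim (chart i)) -> R) : Prop :=
  [/\ forall i, smooth (Dom O i) (f i),
      forall i g x, Dom O i x -> f i (act g x) = f i x
    & forall i j l, Emb O i j l -> forall x, Dom O i x -> f j (l x) = f i x].

Definition orbi_2form (R : realType) (O : orbifold R)
    (w : forall i : atlas O, 'rV[R]_(dim (chart i)) ->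
           'rV[R]_(dim (chart i)) -> 'rV[R]_(dim (chart i)) -> R) : Prop :=
  [/\ forall i x, Dom O i x -> forall (a : R) u v t,
        w i x (a *: u + v) t = a * w i x u t + w i x v t,
      forall i x, Dom O i x -> forall u v, w i x u v = - w i x v u,
      forall i u v, smooth (Dom O i) (fun x => w i x u v),
      forall i (g : grp (chart i)) x, Dom O i x -> forall u v,
        w i (act g x) ('D_u (act g) x) ('D_v (act g) x) = w i x u v
    & forall i j l, Emb O i j l -> forall x, Dom O i x -> forall u v,
        w j (l x) ('D_u l x) ('D_v l x) = w i x u v].

Record symplectic_form (R : realType) (O : orbifold R) := SymplecticForm {
  omega :> forall i : atlas O, 'rV[R]_(dim (chart i)) ->
    'rV[R]_(dim (chart i)) -> 'rV[R]_(dim (chart i)) -> R;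
  omega_2form : orbi_2form omega;
  omega_closed : forall i x, Dom O i x ->
    forall u v t, ext_deriv (@omega i) x u v t = 0;
  omega_nondegenerate : forall i x, Dom O i x ->
    forall u, (forall v, @omega i x u v = 0) -> u = 0
}.

(* By nondegeneracy the set below is a singleton when x is in the chart. *)
Definition hamiltonian_vf (R : realType) (O : orbifold R)
    (w : symplectic_form O) (f : forall i : atlas O, 'rV[R]_(dim (chart i)) -> R)
    (i : atlas O) (x : 'rV[R]_(dim (chart i))) : 'rV[R]_(dim (chart i)) :=
  xget 0 [set u | forall v, w i x u v = - 'D_v (f i) x].

Definition poisson (R : realType) (O : orbifold R) (w : symplectic_form O)
    (f g : forall i : atlas O, 'rV[R]_(dim (chart i)) -> R)
    (i : atlas O) (x : 'rV[R]_(dim (chart i))) : R :=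
  w i x (hamiltonian_vf w g x) (hamiltonian_vf w f x).

(* The smooth structure is given by local frames with smooth transition
   functions. Fibres over points outside A are irrelevant. *)
Record hermitian_line (R : realType) (n : nat) (A : set 'rV[R]_n) := HLine {
  fib : 'rV[R]_n -> lmodType R[i];
  herm : forall x, fib x -> fib x -> R[i];
  triv : Type;
  tdom : triv -> set 'rV[R]_n;
  frame : triv -> forall x, fib x;
  herm_linear : forall x, A x -> forall (a : R[i]) (u v t : fib x),
    herm (a *: u + v) t = a * herm u t + herm v t;
  herm_sym : forall x, A x -> forall u v : fib x, herm u v = conjc (herm v u);
  herm_pos : forall x, A x -> forall u : fib x, u != 0 -> 0 < herm u u;
  tdom_open : forall t, open (tdom t);
  tdom_sub : forall t, tdom t `<=` A;
  tdom_cover : forall x, A x -> exists t, tdom t x;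
  frame_basis : forall t x, tdom t x ->
    frame t x != 0 /\ forall v : fib x, exists a : R[i], v = a *: frame t x;
  frame_smooth : forall t t', exists2 c,
    csmooth (tdom t `&` tdom t') c &
    forall x, tdom t x -> tdom t' x -> frame t' x = c x *: frame t x;
  herm_smooth : forall t, csmooth (tdom t) (fun x => herm (frame t x) (frame t x))
}.

Definition smooth_section (R : realType) (n : nat) (A : set 'rV[R]_n)
    (E : hermitian_line A) (s : forall x, fib E x) : Prop :=
  forall t : triv E, exists2 c,
    csmooth (tdom t) c & forall x, tdom t x -> s x = c x *: frame t x.

(* P is a unitary isomorphism E -> l^*F. Bundle maps take both base points as
   arguments, and P x y is meaningful only for x in A and y = l x. *)
Definition unitary_iso (R : realType) (n m : nat) (A : set 'rV[R]_n)
    (B : set 'rV[R]_m) (E : hermitian_line A) (F : hermitian_line B)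
    (l : 'rV[R]_n -> 'rV[R]_m) (P : forall x y, fib E x -> fib F y) : Prop :=
  [/\ forall x, A x -> forall (a : R[i]) (u v : fib E x),
        P x (l x) (a *: u + v) = a *: P x (l x) u + P x (l x) v,
      forall x, A x -> bijective (P x (l x)),
      forall x, A x -> forall u v : fib E x,
        herm (P x (l x) u) (P x (l x) v) = herm u v
    & forall (t : triv E) (t' : triv F), exists2 c,
        csmooth (tdom t `&` l @^-1` tdom t') c &
        forall x, tdom t x -> tdom t' (l x) ->
          P x (l x) (frame t x) = c x *: frame t' (l x)].

(* Over A, the values of [nab Y s] depend only on Y and s over A: apply
   [nab_vf_linear] or [nab_leibniz] to a scalar function vanishing on A and
   equal to 1 outside A. *)
Record connection (R : realType) (n : nat) (A : set 'rV[R]_n)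
    (E : hermitian_line A) := Connection {
  nab :> ('rV[R]_n -> 'rV[R]_n) -> (forall x, fib E x) -> forall x, fib E x;
  nab_smooth : forall Y s, smooth A Y -> smooth_section s ->
    smooth_section (nab Y s);
  nab_vf_linear : forall (f : 'rV[R]_n -> R) Y Z s,
    smooth A f -> smooth A Y -> smooth A Z -> smooth_section s ->
    forall x, A x ->
      nab (fun y => f y *: Y y + Z y) s x = (f x)%:C%C *: nab Y s x + nab Z s x;
  nab_add : forall Y s t,
    smooth A Y -> smooth_section s -> smooth_section t ->
    forall x, A x -> nab Y (fun y => s y + t y) x = nab Y s x + nab Y t x;
  nab_leibniz : forall (f : 'rV[R]_n -> R[i]) Y s,
    csmooth A f -> smooth A Y -> smooth_section s ->
    forall x, A x ->
      nab Y (fun y => f y *: s y) x = cderive (Y x) f x *: s x + f x *: nab Y s x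
}.

Definition unitary_connection (R : realType) (n : nat) (A : set 'rV[R]_n)
    (E : hermitian_line A) (D : connection E) : Prop :=
  forall Y s t, smooth A Y -> smooth_section s -> smooth_section t ->
  forall x, A x ->
    cderive (Y x) (fun y => herm (s y) (t y)) x =
      herm (D Y s x) (t x) + herm (s x) (D Y t x).

Definition curvature (R : realType) (n : nat) (A : set 'rV[R]_n)
    (E : hermitian_line A) (D : connection E) (Y Z : 'rV[R]_n -> 'rV[R]_n)
    (s : forall x, fib E x) (x : 'rV[R]_n) : fib E x :=
  D Y (D Z s) x - D Z (D Y s) x - D (lie_bracket Y Z) s x.

(* The bundle isomorphism P over the open embedding l carries the connection D
   to D': whenever Y is the pull-back of Y' along l and s that of s' along P,
   D Y s is the pull-back of D' Y' s'. *)
Definition conn_related (R : realType) (n m : nat) (A : set 'rV[R]_n)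
    (B : set 'rV[R]_m) (E : hermitian_line A) (F : hermitian_line B)
    (l : 'rV[R]_n -> 'rV[R]_m) (P : forall x y, fib E x -> fib F y)
    (D : connection E) (D' : connection F) : Prop :=
  forall Y s Y' s', smooth A Y -> smooth_section s ->
    smooth B Y' -> smooth_section s' ->
    (forall x, A x -> Y' (l x) = 'D_(Y x) l x) ->
    (forall x, A x -> s' (l x) = P x (l x) (s x)) ->
  forall x, A x -> D' Y' s' (l x) = P x (l x) (D Y s x).

(* Every chart automorphism x |-> act g x is itself a chart embedding;
   [glue_act] says that the isomorphism attached to it is the action of g. In
   [glue_cocycle] the embedding p is any total function equal to m \o l on the
   chart, so that [glue] does not depend on values outside it. *)
Record orbi_line (R : realType) (O : orbifold R) := OrbiLine {
  lb : forall i : atlas O, hermitian_line (Dom O i);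
  gact : forall i, grp (chart i) -> forall x y, fib (lb i) x -> fib (lb i) y;
  glue : forall i j,
    ('rV[R]_(dim (@chart R O i)) -> 'rV[R]_(dim (@chart R O j))) ->
    forall x y, fib (lb i) x -> fib (lb j) y;
  gact_iso : forall i g, unitary_iso (act g) (@gact i g);
  gact1 : forall i x, Dom O i x -> forall v, @gact i 1%g x x v = v;
  gactM : forall i g h x, Dom O i x -> forall v,
    let y := act h x in let z := act g y in
    @gact i (g * h)%g x z v = gact g z (gact h y v);
  glue_iso : forall i j l, Emb O i j l -> unitary_iso l (@glue i j l);
  glue_equivariant : forall i j l th, Emb O i j l -> equivariant l th ->
    forall g x, Dom O i x -> forall v,
    let y := act g x in let z := act (th g) (l x) in
    glue l z (gact g y v) = gact (th g) z (@glue i j l x (l x) v);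
  glue_cocycle : forall i j k l m p, Emb O i j l -> Emb O j k m ->
    (forall x, Dom O i x -> p x = m (l x)) ->
    forall x, Dom O i x -> forall v,
    @glue i k p x (m (l x)) v = @glue j k m (l x) (m (l x)) (@glue i j l x (l x) v);
  glue_act : forall i g x, Dom O i x -> forall v,
    @glue i i (act g) x (act g x) v = @gact i g x (act g x) v
}.

Definition orbi_section (R : realType) (O : orbifold R) (L : orbi_line O)
    (s : forall (i : atlas O) x, fib (lb L i) x) : Prop :=
  [/\ forall i, smooth_section (s i),
      forall i g x, Dom O i x -> s i (act g x) = gact g (act g x) (s i x)
    & forall i j l, Emb O i j l -> forall x, Dom O i x ->
        s j (l x) = glue l (l x) (s i x)].

Record orbi_connection (R : realType) (O : orbifold R) (L : orbi_line O) :=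
  OrbiConnection {
  conn :> forall i, connection (lb L i);
  conn_equivariant : forall i g,
    conn_related (act g) (@gact R O L i g) (conn i) (conn i);
  conn_compatible : forall i j l, Emb O i j l ->
    conn_related l (@glue R O L i j l) (conn i) (conn j)
}.

Definition prequantum (R : realType) (O : orbifold R) (w : symplectic_form O)
    (L : orbi_line O) (D : orbi_connection L) (hbar : R)
    (f : forall i : atlas O, 'rV[R]_(dim (chart i)) -> R)
    (s : forall (i : atlas O) x, fib (lb L i) x)
    (i : atlas O) (x : 'rV[R]_(dim (chart i))) : fib (lb L i) x :=
  (- ('i%C * hbar%:C%C)) *: D i (@hamiltonian_vf R O w f i) (s i) x
    + (f i x)%:C%C *: s i x.

(* Main.v *)
(* On a chart, the Leibniz rule, [X_f, X_g] = -X_{f,g} (which uses d w = 0) and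
   k = i hbar give
     [Q f, Q g] s - k Q{f,g} s = k^2 (F(X_f, X_g) + (i / hbar) w(X_f, X_g)) s,
   so the curvature condition implies the commutation relation. Conversely,
   both sides of the curvature condition are tensorial, so at a given point it
   is enough to realize arbitrary values of X_f, X_g and a non-zero value of s
   by global f, g and s. This is possible at a point with trivial isotropy: it
   has a neighbourhood U disjoint from its translates, and functions and
   sections with compact support in U extend to the orbifold, being transported
   along chart embeddings and zero elsewhere. The transport of sections is well
   defined because two embeddings of a chart that induce the same map to |X|
   differ by a group element. Points with trivial isotropy are dense, because
   the action is effective and an element that fixes a point with identity
   differential acts trivially; the curvature condition extends to all points
   by continuity. *)

From HB Require Import structures.
Require Import Defs.
From mathcomp Require Import all_boot all_order all_algebra fingroup.
From mathcomp Require Import all_classical all_reals all_analysis.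
From mathcomp Require Import complex.
From mathcomp Require Import ring lra.
Set Implicit Arguments.
Unset Strict Implicit.
Unset Printing Implicit Defensive.
Import Order.TTheory GRing.Theory Num.Theory.
Import numFieldNormedType.Exports.
Local Open Scope classical_set_scope.
Local Open Scope ring_scope.

(** * Smooth maps *)

(** Isotropy is the obstacle in the converse. At a point fixed by a group element other than 1, the
    differentials of invariant functions are invariant under it and an invariant section may be
    forced to vanish, so global data cannot realize arbitrary values there; this is why the argument
    passes through free points. Rigidity of a group element with identity 1-jet is obtained without
    an invariant metric, from the local injectivity of the sum of its powers. A finite form of
    Baire's theorem, applied to the finitely many group elements, then gives both the density of
    free points and the uniqueness of embeddings up to the group. The Hausdorff property makes the
    projection of a compact support closed, so that extension by zero is smooth. An overlap is
    witnessed only by a third chart that embeds into both, so vectors are compared through such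
    common charts, and the cocycle condition makes two comparisons agree. A connection is an
    operator on total fields and sections, so its locality and the tensoriality of its curvature are
    established before any evaluation at a point. *)

Lemma rV_norm_le (R : realType) (n : nat) (v : 'rV[R]_n) (e : R) :
  0 <= e -> (forall j, `|v 0 j| <= e) -> `|v| <= e.
Proof.
move=> e0 ve; rewrite /Num.Def.normr/= mx_normrE (bigmax_le _ e0)//= => -[i j] _ /=.
by rewrite ord1.
Qed.

Lemma rV_norm_coord (R : realType) (n : nat) (v : 'rV[R]_n) j : `|v 0 j| <= `|v|.
Proof.
rewrite [leRHS]/Num.Def.normr/= mx_normrE.
exact: (le_bigmax _ (fun i : 'I_1 * 'I_n => `|v i.1 i.2|) (0, j)).
Qed.

Lemma open_near (T : topologicalType) (A : set T) (x : T) (P : T -> Prop) :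
  open A -> A x -> (forall y, A y -> P y) -> \forall y \near x, P y.
Proof. by move=> oA Ax AP; apply: filterS (open_nbhs_nbhs (conj oA Ax)). Qed.

Lemma eq_near_continuous (T U : topologicalType) (f g : T -> U) (x : T) :
  (\forall y \near x, f y = g y) -> {for x, continuous f} -> {for x, continuous g}.
Proof.
move=> fg fc; rewrite /prop_for /continuous_at -(nbhs_singleton fg).
exact: cvg_trans (near_eq_cvg fg) fc.
Qed.

Lemma is_derive_line (R : realType) (V : normedModType R) (W : normedModType R) (f : V -> W) (p v : V) (t : R) :
  derivable f (p + t *: v) v ->
  is_derive t 1 (fun s : R => f (p + s *: v)) ('D_v f (p + t *: v)).
Proof.
have E : (fun h : R => h^-1 *: (((fun s : R => f (p + s *: v)) \o shift t) (h *: 1) -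
     f (p + t *: v))) = (fun h => h^-1 *: ((f \o shift (p + t *: v)) (h *: v) - f (p + t *: v))).
  apply/funext => h /=; congr (_ *: (f _ - _)).
  by rewrite [h *: 1]mulr1 scalerDl addrCA.
by move=> df; split; rewrite /derivable /derive /= E.
Qed.

(** The parameter is bounded in absolute value so that one statement serves both signs of [t]; for
    negative [t] the mean value theorem is used on the segment from [t] to 0. The price is that the
    intermediate parameter may have either sign. *)
Lemma mvt_line (R : realType) (V : normedModType R) (f : V -> R) (p v : V) (t : R) :
  (forall s, `|s| <= `|t| -> derivable f (p + s *: v) v) ->
  exists2 s, `|s| <= `|t| & f (p + t *: v) - f p = 'D_v f (p + s *: v) * t.
Proof.
move=> df.
have key (a b : R) : a <= b -> (forall s, a <= s <= b -> `|s| <= `|t|) ->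
   exists2 s, `|s| <= `|t| & f (p + b *: v) - f (p + a *: v) = 'D_v f (p + s *: v) * (b - a).
  move=> ab abt.
  have dl s : a <= s <= b -> is_derive s 1 (fun s => f (p + s *: v)) ('D_v f (p + s *: v)).
    by move=> sab; apply: is_derive_line; apply/df/abt.
  have [||s sab E] := @MVT_segment R (fun s => f (p + s *: v)) (fun s => 'D_v f (p + s *: v)) a b ab.
  - by move=> s /subset_itv_oo_cc; exact: dl.
  - by apply: derivable_within_continuous => s /dl [].
  by exists s => //; apply: abt.
have [t0|t0] := leP 0 t.
- have [|s st E] := key 0 t t0; first by move=> s /andP[? ?]; rewrite !ger0_norm.
  by exists s => //; move: E; rewrite scale0r addr0 subr0.
- have [|s st E] := key t 0 (ltW t0).
    by move=> s /andP[? ?]; rewrite !ler0_norm ?lerN2// ltW.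
  exists s => //; move: E; rewrite scale0r addr0 sub0r mulrN => /eqP.
  by rewrite -eqr_oppLR opprB => /eqP.
Qed.

Lemma continuous_bigsum (K : numFieldType) (T : topologicalType) (I : Type) (r : seq I) (f : I -> T -> K) (x : T) :
  (forall i, {for x, continuous (f i)}) ->
  {for x, continuous (fun y => \sum_(i <- r) f i y)}.
Proof.
move=> fc; elim: r => [|i r IH].
  rewrite (_ : (fun _ => _) = cst 0); first exact: cvg_cst.
  by apply/funext => y; rewrite big_nil.
rewrite (_ : (fun _ => _) = (f i + fun y => \sum_(i <- r) f i y)); first exact: continuousD.
by apply/funext => y; rewrite big_cons.
Qed.

Lemma rV_lin_continuous (R : realType) (n : nat) (c : 'I_n -> R) :
  continuous (fun h : 'rV[R]_n => \sum_a h 0 a * c a).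
Proof.
move=> h; apply: continuous_bigsum => i.
apply: (@continuousM _ _ (fun h : 'rV[R]_n => h 0 i) (cst (c i))); last exact: cst_continuous.
exact: (@coord_continuous R 1 n 0 i h).
Qed.

(** The estimate is the Fréchet condition for the linear form with coefficients [c]; uniqueness of
    the differential then gives all directional derivatives at once. *)
Lemma rV_differentiable (R : realType) (n : nat) (f : 'rV[R]_n -> R) (c : 'I_n -> R) (x : 'rV[R]_n) :
  (forall e, 0 < e -> \forall h \near (0 : 'rV[R]_n),
     `|f (h + x) - f x - \sum_a h 0 a * c a| <= e * `|h|) ->
  differentiable f x /\ forall v, 'D_v f x = \sum_a v 0 a * c a.
Proof.
move=> H.
pose d (h : 'rV[R]_n) := \sum_a h 0 a * c a.
have lin_d : linear d.
  move=> k u v; rewrite /d scaler_sumr -big_split/=; apply: eq_bigr => a _.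
  by rewrite !mxE mulrDl [_ *: _]mulrA.
pose dM := GRing.isLinear.Build _ _ _ _ _ lin_d.
pose dL : {linear _ -> _} := HB.pack d dM.
have dLc : continuous dL by exact: rV_lin_continuous.
have fo : f \o shift x = cst (f x) + dL +o_ (0 : 'rV[R]_n) id.
  apply/eqaddoP => e e0; near=> h; rewrite /= !fctE /=.
  by rewrite opprD addrA; near: h; exact: H.
have E := diff_unique dLc fo.
have df : differentiable f x by apply/diff_locallyP; rewrite E.
by split => // v; rewrite deriveE// E.
Unshelve. all: by end_near. Qed.

Lemma C1_differentiable (R : realType) (n : nat) (A : set 'rV[R]_n) (f : 'rV[R]_n -> R) (x : 'rV[R]_n) :
  open A -> A x -> (forall y i, A y -> derivable f y (delta_mx 0 i)) ->
  (forall i, {for x, continuous ('D_(delta_mx 0 i) f)}) ->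
  differentiable f x /\ forall v, 'D_v f x = \sum_a v 0 a * 'D_(delta_mx 0 a) f x.
Proof.
move=> oA Ax df cf; apply: rV_differentiable => e e0.
(* The increment is a sum of [n] errors of size [e' * |h|]; dividing by [n.+1] also covers dimension
   0. *)
pose e' := e / n.+1%:R.
have e'0 : 0 < e' by rewrite divr_gt0.
have near_x : \forall y \near x, A y /\ forall i, `|'D_(delta_mx 0 i) f x - 'D_(delta_mx 0 i) f y| <= e'.
  apply: filterI; first exact: open_nbhs_nbhs.
  apply: (@filter_forall _ _ _ _ (nbhs_filter x)) => i; exact: (cvgrPdist_le _ _).1 (cf i) _ e'0.
move/nbhs_normP : near_x => [d /= d0 Hd].
have d_near : \forall h \near (0 : 'rV[R]_n), `|h| < d.
  by apply/nbhs_normP; exists d => // y; rewrite /= sub0r normrN.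
near=> h.
have hd : `|h| < d by near: h.
(* A path from [x] to [h + x] that moves one coordinate at a time. In the sup norm it stays within
   [|h|] of [x], so the mean value theorem applies to each piece inside the ball of radius [d]. *)
pose p (k : nat) := x + \row_a (if (a < k)%N then h 0 a else 0).
have pS (k : 'I_n) : p k.+1 = p k + h 0 k *: delta_mx 0 k.
  rewrite /p -addrA; congr (_ + _); apply/rowP => a; rewrite !mxE eqxx/=.
  rewrite ltnS leq_eqVlt -val_eqE /=; case: eqP => [/ord_inj ->|_] /=.
    by rewrite ltnn add0r mulr1.
  by rewrite mulr0 addr0.
have pin (k : 'I_n) s : `|s| <= `|h 0 k| -> `|x - (p k + s *: delta_mx 0 k)| < d.
  move=> sh; apply: le_lt_trans hd; rewrite /p opprD opprD !addrA subrr add0r -opprD normrN.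
  apply: rV_norm_le => // a; rewrite !mxE eqxx /=.
  have [->|ak] := eqVneq a k; first by rewrite ltnn add0r mulr1 (le_trans sh)// rV_norm_coord.
  by rewrite mulr0 addr0; case: ifP => _; rewrite ?normr0// rV_norm_coord.
have E : f (h + x) - f x = \sum_(k < n) (f (p k.+1) - f (p k)).
  rewrite -(big_mkord xpredT (fun k => f (p k.+1) - f (p k))) telescope_sumr//.
  congr (f _ - f _).
    by rewrite addrC /p; congr (_ + _); apply/rowP => a; rewrite !mxE ltn_ord.
  by rewrite /p; apply/esym/eqP; rewrite addrC -subr_eq0 addrK; apply/eqP/rowP => a; rewrite !mxE.
rewrite E -sumrB (le_trans (ler_norm_sum _ _ _))//.
have : \sum_(k < n) `|f (p k.+1) - f (p k) - h 0 k * 'D_(delta_mx 0 k) f x| <= \sum_(k < n) (e' * `|h|).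
  apply: ler_sum => k _; rewrite pS.
  have [|s sh ->] := @mvt_line R _ f (p k) (delta_mx 0 k) (h 0 k).
    by move=> s sh; apply: df; have [] := Hd _ (pin _ _ sh).
  rewrite [h 0 k * _]mulrC -mulrBl normrM; apply: ler_pM => //; last exact: rV_norm_coord.
  by rewrite distrC; have [_] := Hd _ (pin _ _ sh); apply.
move=> /le_trans; apply; rewrite sumr_const card_ord -mulr_natr mulrAC ler_wpM2r//.
rewrite /e' -mulrA ler_piMr ?(ltW e0)// mulrC ler_pdivrMr// mul1r ler_nat; exact: leqnSn.
Unshelve. all: by end_near. Qed.

(** The inner map is only assumed derivable along [v]. Restricted to the line through [x] it is a
    curve, for which derivability is differentiability, so the chain rule for differentials
    applies. *)
Lemma chain_rule (R : realType) (V U W : normedModType R) (l : V -> U) (f : U -> W) (x v : V) :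
  derivable l x v -> differentiable f (l x) ->
  is_derive x v (f \o l) ('D_('D_v l x) f (l x)).
Proof.
move=> dl df.
pose c (h : R) := l (h *: v + x).
have c0 : c 0 = l x by rewrite /c scale0r add0r.
have dc : derivable c 0 1 := (derivable1P l x v).1 dl.
have dc' : differentiable c 0 by apply/derivable1_diffP.
have df' : differentiable f (c 0) by rewrite c0.
have dfc : derivable (f \o c) 0 1 by apply/derivable1_diffP; exact: differentiable_comp.
have E (W' : normedModType R) (g : V -> W') : 'D_v g x = 'D_1 (fun h : R => g (h *: v + x)) 0.
  rewrite /derive; set g1 := fun h => h^-1 *: _; set g2 := fun h => h^-1 *: _.
  suff -> : g1 = g2 by [].
  by apply/funext => h; rewrite /g1 /g2 /= addr0 scale0r add0r [h%:A]mulr1.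
split; first exact: (derivable1P (f \o l) x v).2 dfc.
rewrite E -[LHS]/('D_1 (f \o c) 0) deriveE; last exact: differentiable_comp.
by rewrite diff_comp//= -!deriveE// c0 -E.
Qed.

(* C^k by recursion on the innermost derivative, so that the induction hypothesis
   applies to the expressions given by the product and chain rules. *)
Fixpoint Ck (R : realType) (n : nat) (W : normedModType R) (k : nat)
    (A : set 'rV[R]_n) (f : 'rV[R]_n -> W) : Prop :=
  (forall x, A x -> {for x, continuous f}) /\
  if k is k'.+1 then
    (forall x i, A x -> derivable f x (delta_mx 0 i)) /\
    (forall i, Ck k' A ('D_(delta_mx 0 i) f))
  else True.

Section smooth_basics.
Context {R : realType} {n : nat}.
Implicit Types (A B : set 'rV[R]_n) (W : normedModType R).

Lemma smooth_continuous W A (f : 'rV[R]_n -> W) x :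
  smooth A f -> A x -> {for x, continuous f}.
Proof. by move=> /(_ [::]) /= H /H []. Qed.

Lemma smooth_derivable W A (f : 'rV[R]_n -> W) x i :
  smooth A f -> A x -> derivable f x (delta_mx 0 i).
Proof. by move=> /(_ [::]) /= H /H []. Qed.

Lemma smooth_partial W A (f : 'rV[R]_n -> W) i :
  smooth A f -> smooth A ('D_(delta_mx 0 i) f).
Proof. by move=> sf s; have := sf (rcons s i); rewrite /= foldr_rcons. Qed.

Lemma smoothP W A (f : 'rV[R]_n -> W) : smooth A f <-> forall k, Ck k A f.
Proof.
split=> [sf k|].
  elim: k f sf => [|k IH] f sf /=; first by split=> // x; exact: smooth_continuous.
  split; first by move=> x; exact: smooth_continuous.
  split=> [x i|i]; first exact: smooth_derivable.
  exact/IH/smooth_partial.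
(* [foldr] applies the last index of the list first, hence the induction from the right. *)
move=> Cf s; elim/last_ind: s f Cf => [|s i IH] f Cf /=.
  by move=> x Ax; have [/(_ x Ax) ? [df _]] := Cf 1%N; split => // i; exact: df.
rewrite foldr_rcons; apply: IH => k; by have [_ [_ +]] := Cf k.+1; apply.
Qed.

Lemma smooth_local W A (f : 'rV[R]_n -> W) :
  (forall x, A x -> exists2 U, U x & smooth U f) -> smooth A f.
Proof. by move=> H s /= x Ax; have [U Ux sf] := H x Ax; exact: sf. Qed.

Lemma smooth_sub W A B (f : 'rV[R]_n -> W) : A `<=` B -> smooth B f -> smooth A f.
Proof. by move=> AB sf s /= x /AB; exact: sf. Qed.

Lemma eq_Ck W k A (f g : 'rV[R]_n -> W) :
  open A -> (forall x, A x -> f x = g x) -> Ck k A f -> Ck k A g.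
Proof.
move=> oA; elim: k f g => [|k IH] f g fg /=.
  move=> [cf _]; split=> // x Ax; apply: eq_near_continuous (cf x Ax).
  exact: open_near oA Ax fg.
move=> [cf [df Df]]; split.
  by move=> x Ax; apply: eq_near_continuous (cf x Ax); exact: open_near oA Ax fg.
split=> [x i Ax|i].
  by apply: near_eq_derivable (df x i Ax); exact: open_near oA Ax fg.
apply: IH (Df i) => x Ax; apply: near_eq_derive; exact: open_near oA Ax fg.
Qed.

Lemma eq_smooth W A (f g : 'rV[R]_n -> W) :
  open A -> (forall x, A x -> f x = g x) -> smooth A f -> smooth A g.
Proof. by move=> oA fg /smoothP sf; apply/smoothP => k; exact: eq_Ck (sf k). Qed.

Lemma Ck_le W k A (f : 'rV[R]_n -> W) : Ck k.+1 A f -> Ck k A f.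
Proof.
elim: k f => [|k IH] f; first by move=> [].
by move=> [cf [df Df]]; split=> //; split=> // i; exact/IH/Df.
Qed.

Lemma Ck_derivable W k A (f : 'rV[R]_n -> W) x i :
  Ck k.+1 A f -> A x -> derivable f x (delta_mx 0 i).
Proof. by move=> [_ [df _]]; exact: df. Qed.

Lemma Ck_cst W k A (a : W) : Ck k A (cst a).
Proof.
elim: k a => [|k IH] a /=; first by split=> // x _; exact: cst_continuous.
split; first by move=> x _; exact: cst_continuous.
split=> [x i _|i]; first exact: derivable_cst.
rewrite (_ : 'D_(_) _ = cst 0) //; by apply/funext => x; rewrite derive_cst.
Qed.

Lemma CkD W k A (f g : 'rV[R]_n -> W) :
  open A -> Ck k A f -> Ck k A g -> Ck k A (fun x => f x + g x).
Proof.
move=> oA; elim: k f g => [|k IH] f g Cf Cg.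
  by case: Cf Cg => cf _ [cg _]; split=> // x Ax; apply: continuousD; [exact: cf|exact: cg].
split; first by case: Cf Cg => cf _ [cg _] x Ax; apply: continuousD; [exact: cf|exact: cg].
split=> [x i Ax|i]; first by apply: derivableD; [exact: Ck_derivable Cf Ax|exact: Ck_derivable Cg Ax].
case: (Cf) (Cg) => _ [_ Df] [_ [_ Dg]].
apply: (eq_Ck oA _ (IH _ _ (Df i) (Dg i))) => x Ax.
by rewrite -[RHS]/('D_(delta_mx 0 i) (f + g) x) deriveD//; [exact: Ck_derivable Cf Ax|exact: Ck_derivable Cg Ax].
Qed.

Lemma CkM k A (f g : 'rV[R]_n -> R) :
  open A -> Ck k A f -> Ck k A g -> Ck k A (fun x => f x * g x).
Proof.
move=> oA; elim: k f g => [|k IH] f g Cf Cg.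
  by case: Cf Cg => cf _ [cg _]; split=> // x Ax; apply: continuousM; [exact: cf|exact: cg].
split; first by case: Cf Cg => cf _ [cg _] x Ax; apply: continuousM; [exact: cf|exact: cg].
split=> [x i Ax|i]; first by apply: derivableM; [exact: Ck_derivable Cf Ax|exact: Ck_derivable Cg Ax].
case: (Cf) (Cg) => _ [_ Df] [_ [_ Dg]].
apply: (eq_Ck oA _ (CkD oA (IH _ _ (Ck_le Cf) (Dg i)) (IH _ _ (Ck_le Cg) (Df i)))) => x Ax.
by rewrite -[RHS]/('D_(delta_mx 0 i) (f * g) x) deriveM//; [exact: Ck_derivable Cf Ax|exact: Ck_derivable Cg Ax].
Qed.

Lemma CkV k A (f : 'rV[R]_n -> R) :
  open A -> (forall x, A x -> f x != 0) -> Ck k A f -> Ck k A (fun x => (f x)^-1).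
Proof.
move=> oA f0; elim: k f f0 => [|k IH] f f0 Cf.
  by case: Cf => cf _; split=> // x Ax; apply: continuousV; [exact: f0|exact: cf].
split; first by case: Cf => cf _ x Ax; apply: continuousV; [exact: f0|exact: cf].
split=> [x i Ax|i].
  by apply: derivableV; [exact: f0|exact: Ck_derivable Cf Ax].
case: (Cf) => _ [_ Df].
have Cf' := IH _ f0 (Ck_le Cf).
apply: (@eq_Ck _ k A (fun x => (f x)^-1 * (f x)^-1 * 'D_(delta_mx 0 i) f x * -1)) => //; last first.
  by apply: (CkM oA _ (Ck_cst _ _ _)); apply: (CkM oA _ (Df i)); exact: CkM.
move=> x Ax.
rewrite deriveV//; [|exact: f0|exact: Ck_derivable Cf Ax].
by rewrite /= mulrN1 expr2 invfM scaleNr.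
Qed.

Lemma Ck_bigsum W k A (I : Type) (r : seq I) (f : I -> 'rV[R]_n -> W) :
  open A -> (forall i, Ck k A (f i)) -> Ck k A (fun x => \sum_(i <- r) f i x).
Proof.
move=> oA Cf; elim: r => [|i r IH].
  by rewrite (_ : (fun _ => _) = cst 0); [exact: Ck_cst|apply/funext => y; rewrite big_nil].
rewrite (_ : (fun _ => _) = (fun y => f i y + \sum_(i <- r) f i y)); first exact: CkD.
by apply/funext => y; rewrite big_cons.
Qed.

End smooth_basics.

(** * Row-vector valued maps, composition and closure properties of smoothness *)

Lemma continuous_rV (R : realType) (T : topologicalType) (m : nat) (l : T -> 'rV[R]_m) (x : T) :
  (forall j, {for x, continuous (fun y => l y 0 j)}) -> {for x, continuous l}.
Proof.
move=> cl; apply/cvgrPdist_le => e e0.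
have : \forall y \near x, forall j, `|l x 0 j - l y 0 j| <= e.
  by apply: (@filter_forall _ _ _ _ (nbhs_filter x)) => j; exact: (cvgrPdist_le _ _).1 (cl j) _ e0.
apply: filterS => y H; apply: rV_norm_le; first exact: ltW.
by move=> j; rewrite !mxE; exact: H.
Qed.

Lemma derive_rV_coord (R : realType) (V : normedModType R) (m : nat) (l : V -> 'rV[R]_m) (x v : V) j :
  derivable l x v -> ('D_v l x) 0 j = 'D_v (fun y => l y 0 j) x.
Proof. by move=> dl; rewrite derive_mx// mxE. Qed.

Lemma derivable_rVP (R : realType) (V : normedModType R) (m : nat) (l : V -> 'rV[R]_m) (x v : V) :
  derivable l x v <-> forall j, derivable (fun y => l y 0 j) x v.
Proof.
rewrite derivable_mxP; split => [H j|H i j]; first exact: H.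
by rewrite (ord1 i).
Qed.

Lemma Ck_rV (R : realType) (n m k : nat) (A : set 'rV[R]_n) (l : 'rV[R]_n -> 'rV[R]_m) :
  open A -> Ck k A l <-> forall j, Ck k A (fun x => l x 0 j).
Proof.
move=> oA.
have cc f : (forall x, A x -> {for x, continuous f}) <->
     (forall j x, A x -> {for x, continuous (fun y => (f y : 'rV[R]_m) 0 j)}).
  split=> [cf j x Ax|cf x Ax]; last by apply: continuous_rV => j; exact: cf.
  apply: (@continuous_comp _ _ _ f (fun M : 'rV[R]_m => M 0 j)); first exact: cf.
  exact: coord_continuous.
elim: k l => [|k IH] l.
  split=> [[/cc cl _] j|H]; first by split => // x; exact: cl.
  by split => //; apply/cc => j; have [] := H j.
split=> [[/cc cl [dl Dl]] j|H].
  split; first by exact: cl.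
  have dlj x i : A x -> derivable (fun y => l y 0 j) x (delta_mx 0 i).
    by move=> /dl - /(_ i)/derivable_rVP.
  split=> // i; have /IH/(_ j) := Dl i; apply: eq_Ck => // x Ax.
  by rewrite derive_rV_coord //; exact: dl.
split; first by apply/cc => j; have [] := H j.
have dl x i : A x -> derivable l x (delta_mx 0 i).
  by move=> Ax; apply/derivable_rVP => j; exact: (Ck_derivable (H j) Ax).
split=> // i; apply/IH => j; have [_ [_ /(_ i)]] := H j; apply: eq_Ck => // x Ax.
by rewrite derive_rV_coord//; exact: dl.
Qed.

Lemma Ck1_derive (R : realType) (n : nat) (A : set 'rV[R]_n) (f : 'rV[R]_n -> R) (x : 'rV[R]_n) :
  open A -> A x -> Ck 1 A f ->
  differentiable f x /\ forall v, 'D_v f x = \sum_a v 0 a * 'D_(delta_mx 0 a) f x.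
Proof.
move=> oA Ax [cf [df Df]]; apply: (C1_differentiable oA Ax) => [y i /df //|i].
by have [H _] := Df i; exact: H.
Qed.

Lemma Ck_lew (R : realType) (n : nat) (W : normedModType R) k m (A : set 'rV[R]_n) (f : 'rV[R]_n -> W) :
  (m <= k)%N -> Ck k A f -> Ck m A f.
Proof. by move=> /subnK <-; elim: (k - m)%N => // i IH /Ck_le. Qed.

(** A partial of [f \o l] is a sum of products of partials of the coordinates of [l] and composites
    with [l] of partials of [f]. The composites have one order less, so the induction runs over all
    [f] with [l] fixed. *)
Lemma Ck_comp (R : realType) (n m k : nat) (A : set 'rV[R]_n) (B : set 'rV[R]_m)
    (l : 'rV[R]_n -> 'rV[R]_m) (f : 'rV[R]_m -> R) :
  open A -> open B -> (forall x, A x -> B (l x)) -> Ck k A l -> Ck k B f -> Ck k A (f \o l).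
Proof.
move=> oA oB AB; elim: k f => [|k IH] f Cl Cf.
  split=> // x Ax; apply: continuous_comp; first by case: Cl => + _; apply.
  by case: Cf => + _; apply; exact: AB.
split.
  move=> x Ax; apply: continuous_comp; first by case: Cl => + _; apply.
  by case: Cf => + _; apply; exact: AB.
have D x i : A x -> is_derive x (delta_mx 0 i) (f \o l)
    (\sum_a 'D_(delta_mx 0 i) (fun y => l y 0 a) x * 'D_(delta_mx 0 a) f (l x)).
  move=> Ax; have dl := Ck_derivable (i := i) Cl Ax.
  have [df Df] := Ck1_derive oB (AB _ Ax) (Ck_lew (ltn0Sn k) Cf).
  have := chain_rule dl df; rewrite Df; congr (is_derive _ _ _ _).
  by apply: eq_bigr => a _; rewrite derive_rV_coord.
split=> [x i /D - /(_ i) []//|i].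
apply: (@eq_Ck _ _ _ _ _ (fun x => \sum_a 'D_(delta_mx 0 i) (fun y => l y 0 a) x * 'D_(delta_mx 0 a) f (l x))) => //.
  by move=> x /D - /(_ i) [].
apply: Ck_bigsum => // a; apply: CkM => //.
  by have /(Ck_rV _ _ oA)/(_ a) [_ [_ /(_ i)]] := Cl.
by apply: (IH ('D_(delta_mx 0 a) f) (Ck_le Cl)); case: Cf => _ [_]; apply.
Qed.

Section smooth_closure.
Context {R : realType} {n : nat} {A : set 'rV[R]_n} (oA : open A).

Lemma smooth_cst (W : normedModType R) (a : W) : smooth A (fun=> a).
Proof. by apply/smoothP => k; exact: Ck_cst. Qed.

Lemma smoothD (W : normedModType R) (f g : 'rV[R]_n -> W) :
  smooth A f -> smooth A g -> smooth A (fun x => f x + g x).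
Proof. by move=> /smoothP sf /smoothP sg; apply/smoothP => k; exact: CkD. Qed.

Lemma smoothM (f g : 'rV[R]_n -> R) :
  smooth A f -> smooth A g -> smooth A (fun x => f x * g x).
Proof. by move=> /smoothP sf /smoothP sg; apply/smoothP => k; exact: CkM. Qed.

Lemma smoothV (f : 'rV[R]_n -> R) :
  (forall x, A x -> f x != 0) -> smooth A f -> smooth A (fun x => (f x)^-1).
Proof. by move=> f0 /smoothP sf; apply/smoothP => k; exact: CkV. Qed.

Lemma smooth_sum (W : normedModType R) (I : Type) (r : seq I) (f : I -> 'rV[R]_n -> W) :
  (forall i, smooth A (f i)) -> smooth A (fun x => \sum_(i <- r) f i x).
Proof.
by move=> sf; apply/smoothP => k; apply: Ck_bigsum => // i; have /smoothP := sf i.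
Qed.

Lemma smooth_prod (I : Type) (r : seq I) (f : I -> 'rV[R]_n -> R) :
  (forall i, smooth A (f i)) -> smooth A (fun x => \prod_(i <- r) f i x).
Proof.
move=> sf; elim: r => [|i r IH].
  have -> : (fun x => \prod_(i <- [::]) f i x) = fun=> 1 by apply/funext => y; rewrite big_nil.
  exact: smooth_cst.
have -> : (fun x => \prod_(j <- i :: r) f j x) = (fun y => f i y * \prod_(j <- r) f j y).
  by apply/funext => y; rewrite big_cons.
exact: smoothM (sf i) IH.
Qed.

Lemma smoothN (f : 'rV[R]_n -> R) : smooth A f -> smooth A (fun x => - f x).
Proof.
have -> : (fun x => - f x) = (fun x => -1 * f x) by apply/funext => x; rewrite mulN1r.
exact: smoothM (smooth_cst _).
Qed.

Lemma smoothB (f g : 'rV[R]_n -> R) :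
  smooth A f -> smooth A g -> smooth A (fun x => f x - g x).
Proof. move=> sf sg; exact: smoothD sf (smoothN sg). Qed.

Lemma smooth_rV (m : nat) (l : 'rV[R]_n -> 'rV[R]_m) :
  smooth A l <-> forall j, smooth A (fun x => l x 0 j).
Proof.
split=> [/smoothP sl j|sl].
  by apply/smoothP => k; have /(Ck_rV _ _ oA) := sl k.
by apply/smoothP => k; apply/Ck_rV => // j; have /smoothP := sl j.
Qed.

Lemma smooth_coord (m : nat) (l : 'rV[R]_n -> 'rV[R]_m) j :
  smooth A l -> smooth A (fun x => l x 0 j).
Proof. by move/smooth_rV; apply. Qed.

Lemma smooth_id : smooth A (fun x => x).
Proof.
apply/smoothP => k; have d (x v : 'rV[R]_n) : 'D_v (fun x => x) x = v by exact: derive_id.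
case: k => [|k] /=; first by split=> // x _; exact: cvg_id.
split=> [x _|]; first exact: cvg_id.
split=> [x i _|i]; first exact: derivable_id.
rewrite (_ : 'D_(_) _ = cst (delta_mx 0 i)); first exact: Ck_cst.
by apply/funext => x; rewrite d.
Qed.

Lemma smooth_comp (m : nat) (B : set 'rV[R]_m) (l : 'rV[R]_n -> 'rV[R]_m) (f : 'rV[R]_m -> R) :
  open B -> (forall x, A x -> B (l x)) -> smooth A l -> smooth B f -> smooth A (fun x => f (l x)).
Proof.
by move=> oB AB /smoothP sl /smoothP sf; apply/smoothP => k; apply: (Ck_comp oA oB AB (sl k) (sf k)).
Qed.

Lemma smooth_differentiable (f : 'rV[R]_n -> R) x : smooth A f -> A x -> differentiable f x.
Proof. by move=> /smoothP/(_ 1%N) sf Ax; have [] := Ck1_derive oA Ax sf. Qed.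

Lemma smooth_derivative (f : 'rV[R]_n -> R) x v :
  smooth A f -> A x -> 'D_v f x = \sum_a v 0 a * 'D_(delta_mx 0 a) f x.
Proof. by move=> /smoothP/(_ 1%N) sf Ax; have [_] := Ck1_derive oA Ax sf. Qed.

Lemma smooth_derivable_dir (f : 'rV[R]_n -> R) x v : smooth A f -> A x -> derivable f x v.
Proof. by move=> sf Ax; apply/diff_derivable/smooth_differentiable. Qed.

Lemma smooth_rV_derivable (m : nat) (l : 'rV[R]_n -> 'rV[R]_m) x v :
  smooth A l -> A x -> derivable l x v.
Proof.
move=> sl Ax; apply/derivable_rVP => j; exact: smooth_derivable_dir (smooth_coord j sl) Ax.
Qed.

Lemma smooth_directional (f : 'rV[R]_n -> R) (Y : 'rV[R]_n -> 'rV[R]_n) :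
  smooth A f -> smooth A Y -> smooth A (fun x => 'D_(Y x) f x).
Proof.
move=> sf sY; apply: (@eq_smooth _ _ _ _ (fun x => \sum_a Y x 0 a * 'D_(delta_mx 0 a) f x) _ oA).
  by move=> x Ax; rewrite (smooth_derivative _ sf Ax).
apply: smooth_sum => a; exact: smoothM (smooth_coord a sY) (smooth_partial a sf).
Qed.

Lemma smooth_rV_directional (m : nat) (l : 'rV[R]_n -> 'rV[R]_m) (Y : 'rV[R]_n -> 'rV[R]_n) :
  smooth A l -> smooth A Y -> smooth A (fun x => 'D_(Y x) l x).
Proof.
move=> sl sY; apply/smooth_rV => j.
apply: (@eq_smooth _ _ _ _ (fun x => 'D_(Y x) (fun y => l y 0 j) x) _ oA).
  by move=> x Ax; rewrite derive_rV_coord//; exact: smooth_rV_derivable sl Ax.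
exact: smooth_directional (smooth_coord j sl) sY.
Qed.

(** [phi] lists a function of one variable together with its successive derivatives, the form in
    which [exp(-1/t)] is supplied by [flat]. *)
Lemma smooth_comp1 (phi : nat -> R -> R) (f : 'rV[R]_n -> R) k :
  (forall k (x : R), is_derive x (1 : R) (phi k) (phi k.+1 x)) -> smooth A f ->
  smooth A (fun x => phi k (f x)).
Proof.
move=> dphi sf; apply/smoothP => p.
have cphi k' : continuous (phi k').
  by move=> y; apply/differentiable_continuous/derivable1_diffP; have [] := dphi k' y.
have D x i j : A x -> is_derive x (delta_mx 0 i) (phi j \o f) ('D_(delta_mx 0 i) f x * phi j.+1 (f x)).
  move=> Ax; have df := smooth_derivable (i := i) sf Ax.
  have dp : differentiable (phi j) (f x) by apply/derivable1_diffP; have [] := dphi j (f x).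
  have := chain_rule df dp; congr (is_derive _ _ _ _).
  rewrite deriveE// -[X in 'd _ _ X]mulr1 -[X in 'd _ _ X]/(_ *: 1) linearZ /= -deriveE//.
  by have [_ ->] := dphi j (f x).
elim: p k => [|p IH] k.
  by split=> // x Ax; apply: continuous_comp; [exact: smooth_continuous sf Ax|exact: cphi].
split; first by move=> x Ax; apply: continuous_comp; [exact: smooth_continuous sf Ax|exact: cphi].
split=> [x i Ax|i]; first by have [] := D x i k Ax.
apply: (@eq_Ck _ _ _ _ _ (fun x => 'D_(delta_mx 0 i) f x * phi k.+1 (f x)) _ oA).
  by move=> x Ax; have [_ ->] := D x i k Ax.
by apply: CkM (IH k.+1) => //; have /smoothP := smooth_partial i sf.
Qed.

End smooth_closure.

(** * Symmetry of second derivatives *)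

Lemma derive_translate (R : realType) (V W : normedModType R) (f : V -> W) (w y v : V) :
  (derivable f (y + w) v -> derivable (fun z => f (z + w)) y v) /\
  'D_v (fun z => f (z + w)) y = 'D_v f (y + w).
Proof.
have E : (fun h : R => h^-1 *: (((fun z => f (z + w)) \o shift y) (h *: v) - f (y + w))) =
  (fun h => h^-1 *: ((f \o shift (y + w)) (h *: v) - f (y + w))).
  by apply/funext => h /=; rewrite addrA.
by rewrite /derivable /derive E.
Qed.

Lemma dist_le_halves (R : realFieldType) (e a b c d : R) :
  b = d -> `|a - b| <= e / 2 -> `|c - d| <= e / 2 -> `|a - c| <= e.
Proof.
move=> -> ad cd; rewrite (splitr e) -(subrKA d); apply: (le_trans (ler_normD _ _)).
by apply: lerD => //; rewrite distrC.
Qed.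

Section schwarz.
Context {R : realType} {n : nat} {A : set 'rV[R]_n} (oA : open A).

(* The left-hand side is symmetric in (s, u) and (t, v), so both mixed derivatives
   are its limits. *)
Lemma second_difference (f : 'rV[R]_n -> R) (x u v : 'rV[R]_n) (s t : R) :
  (forall s' t', `|s'| <= `|s| -> `|t'| <= `|t| -> derivable f (x + s' *: u + t' *: v) u) ->
  (forall s' t', `|s'| <= `|s| -> `|t'| <= `|t| -> derivable ('D_u f) (x + s' *: u + t' *: v) v) ->
  exists s' t', [/\ `|s'| <= `|s|, `|t'| <= `|t| &
    f (x + s *: u + t *: v) - f (x + s *: u) - (f (x + t *: v) - f x)
      = 'D_v ('D_u f) (x + s' *: u + t' *: v) * t * s].
Proof.
move=> df ddf.
pose g y := f (y + t *: v) - f y.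
have dg s' : `|s'| <= `|s| -> derivable g (x + s' *: u) u /\
    'D_u g (x + s' *: u) = 'D_u f (x + s' *: u + t *: v) - 'D_u f (x + s' *: u).
  move=> ss; have d1 := df s' t ss (lexx _).
  have d2 : derivable f (x + s' *: u) u.
    by have := df s' 0 ss; rewrite scale0r addr0 normr0; apply.
  have [d3 d4] := @derive_translate _ _ _ f (t *: v) (x + s' *: u) u.
  by split; [exact: (derivableB (d3 d1) d2)|rewrite -d4 -(deriveB (d3 d1) d2)].
have [s0 /dg[]//|s' ss'] := @mvt_line _ _ g x u s.
have [_ ->] := dg s' ss'.
have [t0|t' tt' ->] := @mvt_line _ _ ('D_u f) (x + s' *: u) v t; first exact: ddf.
by move=> E; exists s', t'; split => //; rewrite -E.
Qed.

Lemma smooth_schwarz_basis (f : 'rV[R]_n -> R) (x : 'rV[R]_n) i j : smooth A f -> A x ->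
  'D_(delta_mx 0 i) ('D_(delta_mx 0 j) f) x = 'D_(delta_mx 0 j) ('D_(delta_mx 0 i) f) x.
Proof.
move=> sf Ax.
pose F := 'D_(delta_mx 0 i) ('D_(delta_mx 0 j) f).
pose G := 'D_(delta_mx 0 j) ('D_(delta_mx 0 i) f).
rewrite -[LHS]/(F x) -[RHS]/(G x).
have cF : {for x, continuous F} by exact: smooth_continuous (smooth_partial _ (smooth_partial _ sf)) Ax.
have cG : {for x, continuous G} by exact: smooth_continuous (smooth_partial _ (smooth_partial _ sf)) Ax.
apply/eqP; rewrite -subr_eq0 -normr_le0; apply/ler_addgt0Pr => e e0; rewrite add0r.
have e20 : 0 < e / 2 by rewrite divr_gt0.
have : \forall y \near x, [/\ A y, `|F x - F y| <= e / 2 & `|G x - G y| <= e / 2].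
  have N1 : \forall y \near x, `|F x - F y| <= e / 2 by exact: (cvgrPdist_le _ _).1 cF _ e20.
  have N2 : \forall y \near x, `|G x - G y| <= e / 2 by exact: (cvgrPdist_le _ _).1 cG _ e20.
  by apply: filterS3 (open_nbhs_nbhs (conj oA Ax)) N1 N2 => y.
move/nbhs_normP => [d /= d0 Hd].
(* Two moves of length at most [d / 3] along vectors of norm at most 1 remain in the ball of radius
   [d]. *)
pose s := d / 3.
have s0 : 0 < s by rewrite divr_gt0.
have nd k : `|delta_mx 0 k : 'rV[R]_n| <= 1.
  by apply: rV_norm_le => // a; rewrite mxE eqxx /=; case: eqP; rewrite ?normr1 ?normr0.
have Hs s' t' k m : `|s'| <= `|s| -> `|t'| <= `|s| ->
    ball_ Num.Def.normr x d (x + s' *: delta_mx 0 k + t' *: delta_mx 0 m).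
  move=> ss tt; rewrite /= -addrA opprD addrA subrr add0r normrN.
  apply: (le_lt_trans (ler_normD _ _)); rewrite !normrZ.
  have := ler_pM (normr_ge0 _) (normr_ge0 _) ss (nd k).
  have := ler_pM (normr_ge0 _) (normr_ge0 _) tt (nd m).
  rewrite !mulr1 [`|s|]gtr0_norm// /s => h1 h2.
  by apply: (le_lt_trans (lerD h2 h1)); lra.
have [||s1 [t1 [s1s t1s E1]]] := @second_difference f x (delta_mx 0 j) (delta_mx 0 i) s s.
- move=> s' t' ss tt; have [Ay _ _] := Hd _ (Hs s' t' j i ss tt).
  exact: smooth_derivable sf Ay.
- move=> s' t' ss tt; have [Ay _ _] := Hd _ (Hs s' t' j i ss tt).
  exact: (smooth_derivable (smooth_partial _ sf) Ay).
have [||s2 [t2 [s2s t2s E2]]] := @second_difference f x (delta_mx 0 i) (delta_mx 0 j) s s.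
- move=> s' t' ss tt; have [Ay _ _] := Hd _ (Hs s' t' i j ss tt).
  exact: smooth_derivable sf Ay.
- move=> s' t' ss tt; have [Ay _ _] := Hd _ (Hs s' t' i j ss tt).
  exact: (smooth_derivable (smooth_partial _ sf) Ay).
have FG : F (x + s1 *: delta_mx 0 j + t1 *: delta_mx 0 i) = G (x + s2 *: delta_mx 0 i + t2 *: delta_mx 0 j).
  have s_neq0 : s != 0 by rewrite gt_eqF.
  have cancel_ss (a b l1 l2 : R) : l1 = a * s * s -> l2 = b * s * s -> l1 = l2 -> a = b.
    by move=> -> -> /(mulIf s_neq0)/(mulIf s_neq0).
  have swap_mid (a b c b' : R) : a - b - (c - b') = a - c - (b - b') by ring.
  by apply: cancel_ss E1 E2 _; rewrite [x + s *: delta_mx 0 i + _]addrAC; exact: swap_mid.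
have [_ h1 _] := Hd _ (Hs _ _ j i s1s t1s).
have [_ _ h2] := Hd _ (Hs _ _ i j s2s t2s).
exact: dist_le_halves FG h1 h2.
Qed.

Lemma smooth_schwarz (f : 'rV[R]_n -> R) (x u v : 'rV[R]_n) : smooth A f -> A x ->
  'D_u ('D_v f) x = 'D_v ('D_u f) x.
Proof.
move=> sf Ax.
have E u' v' : 'D_u' ('D_v' f) x = \sum_a \sum_b u' 0 a * (v' 0 b * 'D_(delta_mx 0 a) ('D_(delta_mx 0 b) f) x).
  have sv : smooth A ('D_v' f) by exact: (@smooth_directional _ _ _ oA f (fun=> v') sf (smooth_cst _)).
  rewrite (smooth_derivative oA _ sv Ax); apply: eq_bigr => a _; rewrite -mulr_sumr; congr (_ * _).
  have s1 b : smooth A (fun y => v' 0 b * 'D_(delta_mx 0 b) f y).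
    exact: smoothM oA _ _ (smooth_cst _) (smooth_partial b sf).
  transitivity ('D_(delta_mx 0 a) (fun y => \sum_b v' 0 b * 'D_(delta_mx 0 b) f y) x).
    apply: near_eq_derive; apply: filterS (open_nbhs_nbhs (conj oA Ax)) => y Ay.
    exact: (smooth_derivative oA v' sf Ay).
  have db b : derivable ('D_(delta_mx 0 b) f) x (delta_mx 0 a).
    exact: smooth_derivable (smooth_partial _ sf) Ax.
  rewrite (_ : (fun _ => _) = \sum_b (v' 0 b \*: 'D_(delta_mx 0 b) f)).
    rewrite derive_sum; last by move=> b; apply: derivableZ.
    by apply: eq_bigr => b _; rewrite deriveZ.
  by apply/funext => y; rewrite fct_sumE.
rewrite !E exchange_big; apply: eq_bigr => a _; apply: eq_bigr => b _.
by rewrite (smooth_schwarz_basis a b sf Ax) mulrCA.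
Qed.

End schwarz.

(** * Bump functions *)

Section flat_functions.
Context {R : realType}.

(* The derivative of p(1/t) exp(-1/t) has the same form with t^2 (p - p') for p,
   which exhibits all the derivatives of exp(-1/t) at once. *)
Definition flat (p : {poly R}) (t : R) : R :=
  if 0 < t then p.[t^-1] * expR (- t^-1) else 0.

(** Raise [1 + z <= expR z], taken at [z = y / m.+1], to the power [m.+1]. *)
Lemma expR_ge_pow (m : nat) (y : R) : 0 <= y -> (y / m.+1%:R) ^+ m.+1 <= expR y.
Proof.
move=> y0; have m0 : (m.+1%:R : R) != 0 by rewrite pnatr_eq0.
have -> : expR y = expR (y / m.+1%:R) ^+ m.+1 by rewrite -expRM_natl mulrC divfK.
rewrite lerXn2r ?nnegrE ?expR_ge0 ?divr_ge0//.
by apply: le_trans (expR_ge1Dx _); rewrite lerDr.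
Qed.

Lemma horner_le (p : {poly R}) (y : R) : 1 <= y ->
  `|p.[y]| <= (\sum_(i < size p) `|p`_i|) * y ^+ size p.
Proof.
move=> y1; rewrite horner_coef mulr_suml (le_trans (ler_norm_sum _ _ _))//.
apply: ler_sum => i _; rewrite normrM ler_wpM2l// ger0_norm; last first.
  by rewrite exprn_ge0// (le_trans ler01).
by rewrite ler_weXn2l// ltnW.
Qed.

(** The quadratic bound makes the difference quotient of [flat p] at 0 tend to 0, which is the only
    delicate point in differentiating it. *)
Lemma flat_le (p : {poly R}) : exists C, forall t, `|t| < 1 -> `|flat p t| <= C * t ^+ 2.
Proof.
(* The exponential is compared with the power [d.+1 = size p + 2] of [1/t]: [size p] factors absorb
   the polynomial, and two powers of [t] are left. *)
pose d := (size p).+1; pose S := \sum_(i < size p) `|p`_i|.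
have S0 : 0 <= S by apply: sumr_ge0.
exists (S * (d.+1%:R) ^+ d.+1) => t t1; rewrite /flat; case: ifPn => t0; last first.
  rewrite normr0; apply: mulr_ge0; last exact: sqr_ge0.
  by apply: mulr_ge0 => //; exact: exprn_ge0.
rewrite gtr0_norm// in t1.
have y1 : 1 <= t^-1 by rewrite invf_ge1// ltW.
have y0 : 0 < t^-1 by rewrite invr_gt0.
rewrite normrM [`|expR _|]ger0_norm ?expR_ge0// expRN.
have h1 := horner_le p y1.
have h2 := expR_ge_pow d (ltW y0).
have h3 : 0 < (t^-1 / d.+1%:R) ^+ d.+1 by rewrite exprn_gt0// divr_gt0.
have h4 : (expR t^-1)^-1 <= ((t^-1 / d.+1%:R) ^+ d.+1)^-1 by rewrite lef_pV2 ?posrE ?expR_gt0.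
apply: (le_trans (ler_pM (normr_ge0 _) _ h1 h4)); first by rewrite invr_ge0 expR_ge0.
rewrite -/S -exprVn invfM !invrK exprMn_comm; last exact: mulrC.
have -> : t ^+ d.+1 = t ^+ size p * t ^+ 2 by rewrite -exprD /d addn2.
suff -> : S * t^-1 ^+ size p * (t ^+ size p * t ^+ 2 * d.+1%:R ^+ d.+1) = S * d.+1%:R ^+ d.+1 * t ^+ 2 by [].
have tp : t ^+ size p != 0 by rewrite expf_neq0// gt_eqF.
by rewrite exprVn; move: tp; set z := t ^+ size p => z0; field.
Qed.

Lemma flat_derive (p : {poly R}) (x : R) :
  is_derive x (1 : R) (flat p) (flat ('X^2 * (p - p^`())) x).
Proof.
have [x0|x0|->] := ltgtP x 0.
- rewrite {2}/flat ltNge (ltW x0) /=.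
  apply: (near_eq_is_derive _ (is_derive_cst 0 x 1)).
  near=> y; rewrite /flat /= ltNge ltW//; near: y; exact: lt_nbhsl.
- have E : {near x, (fun t : R => p.[t^-1] * expR (- t^-1)) =1 flat p}.
    by near=> y; rewrite /flat ifT//; near: y; exact: lt_nbhsr.
  apply: (near_eq_is_derive E).
  have x_neq0 : x != 0 by rewrite gt_eqF.
  have dV : is_derive x (1:R) (fun t : R => t^-1) (- x ^- 2).
    have := @is_deriveV R id x 1 1 x_neq0 (is_derive_id x 1).
    by congr (is_derive _ _ _ _); exact: mulr1.
  have dP : is_derive x (1:R) (fun t : R => p.[t^-1]) (- x ^- 2 * p^`().[x^-1]).
    have := @is_derive1_comp R (horner p) (fun t : R => t^-1) x _ _ (is_derive_poly p x^-1) dV.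
    by rewrite mulrC.
  have dE : is_derive x (1:R) (fun t : R => expR (- t^-1)) (x ^- 2 * expR (- x^-1)).
    have := @is_derive1_comp R expR (fun t : R => - t^-1) x _ _ (is_derive_expR (- x^-1)) (is_deriveN dV).
    by rewrite opprK mulrC.
  have := is_deriveM dP dE; congr (is_derive _ _ _ _).
  rewrite /flat x0 hornerM hornerXn hornerD hornerN /=.
  have Z (a b : R) : a *: b = a * b by [].
  rewrite -exprVn !Z; ring.
- have [C HC] := flat_le p.
  have f0 : flat p 0 = 0 by rewrite /flat ltxx.
  rewrite {2}/flat ltxx.
  have H : (h^-1 *: ((flat p \o shift 0) (h *: 1) - flat p 0)) @[h --> (0:R)^'] --> (0:R).
    apply/cvgrPdist_le => e e0.
    have C0 : 0 < `|C| + 1 by rewrite ltr_pwDr.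
    near=> h.
    have h0 : h != 0 by near: h; exact: nbhs_dnbhs_neq.
    have h1 : `|h| < 1 by near: h; exact: dnbhs0_lt.
    have h2 : `|h| < e / (`|C| + 1) by near: h; apply: dnbhs0_lt; rewrite divr_gt0.
    rewrite f0 subr0 sub0r normrN /= addr0 [h *: 1]mulr1 normrM normfV.
    rewrite ler_pdivrMl ?normr_gt0//.
    apply: (le_trans (HC _ h1)); rewrite -real_normK ?num_real// expr2 mulrCA ler_wpM2l//.
    move: h2; rewrite ltr_pdivlMr// => h2; apply: le_trans (ltW h2); rewrite [leRHS]mulrC.
    by rewrite ler_wpM2r// (le_trans (ler_norm _))// lerDl.
  by split; [apply/cvg_ex; exists 0|exact/cvg_lim].
Unshelve. all: by end_near. Qed.

Fixpoint flat_poly (k : nat) : {poly R} :=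
  if k is k'.+1 then 'X^2 * (flat_poly k' - (flat_poly k')^`()) else 1.

(** A product over the coordinates suits the sup norm: as [h] is nonzero exactly on positive
    arguments, the two factors of index [a] are both nonzero only when the [a]-th coordinate of
    [x - c] lies strictly between [-r] and [r]. *)
Lemma smooth_bump (n : nat) (c : 'rV[R]_n) (r : R) : 0 < r ->
  exists chi : 'rV[R]_n -> R, [/\ smooth setT chi, chi c = 1 &
    forall x, chi x != 0 -> `|c - x| <= r].
Proof.
move=> r0.
pose h := flat (flat_poly 0).
have h_neq0 t : (h t != 0) = (0 < t).
  rewrite /h /flat /=; case: ifPn => t0; last by rewrite eqxx.
  by rewrite hornerC mul1r gt_eqF// expR_gt0.
have sh f : smooth [set: 'rV[R]_n] f -> smooth [set: 'rV[R]_n] (fun x => h (f x)).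
  move=> sf; exact: (@smooth_comp1 _ _ _ openT (fun k => flat (flat_poly k)) f 0%N (fun k => flat_derive _) sf).
pose T := [set: 'rV[R]_n]; have oT : open T := openT.
pose b (x : 'rV[R]_n) := \prod_a (h (r - (x 0 a - c 0 a)) * h (r + (x 0 a - c 0 a))).
have bc : b c != 0.
  by apply/prodf_neq0 => a _; rewrite mulf_eq0 negb_or !h_neq0 !subrr subr0 addr0 r0.
exists (fun x => b x / b c); split.
- apply: (smoothM oT); last exact: smooth_cst.
  apply: (smooth_prod oT) => a.
  have s1 : smooth T (fun x : 'rV[R]_n => x 0 a - c 0 a).
    apply: (smoothB oT); last exact: smooth_cst.
    exact: (@smooth_coord _ _ T oT n (fun x => x) a (@smooth_id _ _ T)).
  apply: (smoothM oT); apply: sh.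
    by apply: (smoothB oT); [exact: smooth_cst|exact: s1].
  by apply: (smoothD oT); [exact: smooth_cst|exact: s1].
- exact: divff.
- move=> x; rewrite mulf_eq0 negb_or => /andP[/prodf_neq0 H _]; apply: rV_norm_le; first exact: ltW.
  move=> a; have := H a isT; rewrite mulf_eq0 negb_or !h_neq0 !mxE => /andP[h1 h2].
  by rewrite ler_norml; apply/andP; split; lra.
Qed.

End flat_functions.

(** * Sections and connections on a line bundle *)

Lemma derivefM (R : realType) (V : normedModType R) (f g : V -> R) x v :
  derivable f x v -> derivable g x v ->
  'D_v (fun y => f y * g y) x = 'D_v f x * g x + f x * 'D_v g x.
Proof. by move=> df dg; rewrite [LHS](deriveM df dg) addrC [_ *: 'D_v f x]mulrC. Qed.

Lemma derivef_sum (R : realType) (V W : normedModType R) (n : nat) (f : 'I_n -> V -> W) x v :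
  (forall i, derivable (f i) x v) ->
  'D_v (fun y => \sum_i f i y) x = \sum_i 'D_v (f i) x.
Proof.
by move=> df; rewrite -derive_sum//; congr ('D_v _ x); apply/funext => y; rewrite fct_sumE.
Qed.

Lemma derivablef_sum (R : realType) (V W : normedModType R) (n : nat) (f : 'I_n -> V -> W) x v :
  (forall i, derivable (f i) x v) -> derivable (fun y => \sum_i f i y) x v.
Proof.
move=> df; have -> : (fun y => \sum_i f i y) = \sum_i f i by apply/funext => y; rewrite fct_sumE.
exact: derivable_sum.
Qed.

Lemma cancel_common (V : zmodType) (p q r s : V) : q = s -> p + q - (r + s) = p - r.
Proof. by move=> ->; rewrite opprD addrACA subrr addr0. Qed.

Section directional.
Context {R : realType} {n : nat} {A : set 'rV[R]_n} (oA : open A).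

Lemma derive_directional (f : 'rV[R]_n -> R) (Z : 'rV[R]_n -> 'rV[R]_n) x u :
  smooth A f -> smooth A Z -> A x ->
  'D_u (fun y => 'D_(Z y) f y) x = 'D_('D_u Z x) f x + 'D_u ('D_(Z x) f) x.
Proof.
move=> sf sZ Ax.
have dfb b : derivable ('D_(delta_mx 0 b) f) x u.
  exact: (smooth_derivable_dir oA (smooth_partial b sf) Ax).
have dZ b : derivable (fun y => Z y 0 b) x u.
  exact: (smooth_derivable_dir oA (smooth_coord oA b sZ) Ax).
have E1 : 'D_u (fun y => 'D_(Z y) f y) x = 'D_u (fun y => \sum_b Z y 0 b * 'D_(delta_mx 0 b) f y) x.
  apply: near_eq_derive; apply: filterS (open_nbhs_nbhs (conj oA Ax)) => y Ay.
  exact: (smooth_derivative oA _ sf Ay).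
have E2 : 'D_u ('D_(Z x) f) x = 'D_u (fun y => \sum_b Z x 0 b * 'D_(delta_mx 0 b) f y) x.
  apply: near_eq_derive; apply: filterS (open_nbhs_nbhs (conj oA Ax)) => y Ay.
  exact: (smooth_derivative oA _ sf Ay).
rewrite E1 E2 !derivef_sum; last 2 first.
- by move=> b; apply: derivableM => //; exact: derivable_cst.
- by move=> b; exact: derivableM.
rewrite (smooth_derivative oA _ sf Ax) -big_split; apply: eq_bigr => b _ /=.
have -> : 'D_u (fun y => Z x 0 b * 'D_(delta_mx 0 b) f y) x = Z x 0 b * 'D_u ('D_(delta_mx 0 b) f) x.
  by apply: etrans (derivefM (derivable_cst _ x u) (dfb b)) _; rewrite derive_cst mul0r add0r.
rewrite (derivefM (dZ b) (dfb b)) derive_rV_coord//; exact: smooth_rV_derivable sZ Ax.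
Qed.

(** Each iterated derivative on the right splits into a first-order term, contributing to the
    bracket, and a second derivative of [f]; the two second derivatives cancel by symmetry. *)
Lemma derive_lie_bracket (f : 'rV[R]_n -> R) (Y Z : 'rV[R]_n -> 'rV[R]_n) x :
  smooth A f -> smooth A Y -> smooth A Z -> A x ->
  'D_(lie_bracket Y Z x) f x =
    'D_(Y x) (fun y => 'D_(Z y) f y) x - 'D_(Z x) (fun y => 'D_(Y y) f y) x.
Proof.
move=> sf sY sZ Ax; rewrite (derive_directional _ sf sZ Ax) (derive_directional _ sf sY Ax).
apply: etrans (esym (cancel_common _ _ (smooth_schwarz oA (Y x) (Z x) sf Ax))).
rewrite !(smooth_derivative oA _ sf Ax) -sumrB; apply: eq_bigr => a _.
by rewrite /lie_bracket !mxE mulrBl.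
Qed.

Lemma smooth_lie_bracket (Y Z : 'rV[R]_n -> 'rV[R]_n) :
  smooth A Y -> smooth A Z -> smooth A (lie_bracket Y Z).
Proof.
move=> sY sZ; apply/(smooth_rV oA) => j; rewrite /lie_bracket.
have s1 := smooth_coord oA j (smooth_rV_directional oA sZ sY).
have s2 := smooth_coord oA j (smooth_rV_directional oA sY sZ).
have := smoothB oA s1 s2.
by congr (smooth _ _); apply/funext => x; rewrite !mxE.
Qed.

End directional.

Section csmooth_closure.
Context {R : realType} {n : nat} {A : set 'rV[R]_n} (oA : open A).
Implicit Types f g : 'rV[R]_n -> R[i].

Lemma csmooth_cst (a : R[i]) : csmooth A (fun=> a).
Proof. by split; exact: smooth_cst. Qed.

Lemma csmooth_real (f : 'rV[R]_n -> R) : smooth A f -> csmooth A (fun x => (f x)%:C%C).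
Proof. by move=> sf; split; [exact: sf|exact: smooth_cst]. Qed.

Lemma csmoothD f g : csmooth A f -> csmooth A g -> csmooth A (fun x => f x + g x).
Proof.
move=> [f1 f2] [g1 g2]; split.
  have := smoothD oA f1 g1; congr (smooth _ _); apply/funext => x; by case: (f x) (g x) => [? ?] [].
have := smoothD oA f2 g2; congr (smooth _ _); apply/funext => x; by case: (f x) (g x) => [? ?] [].
Qed.

Lemma csmoothM f g : csmooth A f -> csmooth A g -> csmooth A (fun x => f x * g x).
Proof.
move=> [f1 f2] [g1 g2]; split.
  have := smoothB oA (smoothM oA f1 g1) (smoothM oA f2 g2).
  congr (smooth _ _); apply/funext => x; by case: (f x) (g x) => [? ?] [].
have := smoothD oA (smoothM oA f1 g2) (smoothM oA f2 g1).
congr (smooth _ _); apply/funext => x; by case: (f x) (g x) => [? ?] [].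
Qed.

Lemma csmoothV f : (forall x, A x -> f x != 0) -> csmooth A f -> csmooth A (fun x => (f x)^-1).
Proof.
move=> f0 [f1 f2].
have s1 : smooth A (fun x => (complex.Re (f x) ^+ 2 + complex.Im (f x) ^+ 2)^-1).
  apply: (smoothV oA) => [x Ax|]; last exact: (smoothD oA (smoothM oA f1 f1) (smoothM oA f2 f2)).
  have := f0 x Ax; case: (f x) => a b /=; rewrite eq_complex /= negb_and.
  by rewrite paddr_eq0 ?sqr_ge0// !sqrf_eq0 negb_and.
split.
  have := smoothM oA f1 s1; congr (smooth _ _); apply/funext => x; by case: (f x).
have := smoothN oA (smoothM oA f2 s1); congr (smooth _ _); apply/funext => x /=.
by case: (f x) => a b /=; rewrite ?mulNr.
Qed.

Lemma csmooth_sub (B : set 'rV[R]_n) f : B `<=` A -> csmooth A f -> csmooth B f.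
Proof. by move=> BA [f1 f2]; split; [exact: smooth_sub BA f1|exact: smooth_sub BA f2]. Qed.

Lemma eq_csmooth f g : (forall x, A x -> f x = g x) -> csmooth A f -> csmooth A g.
Proof.
move=> fg [f1 f2]; split.
  by apply: eq_smooth oA _ f1 => x Ax; rewrite fg.
by apply: eq_smooth oA _ f2 => x Ax; rewrite fg.
Qed.

Lemma csmooth_local f : (forall x, A x -> exists2 U, U x & csmooth U f) -> csmooth A f.
Proof.
by move=> H; split; apply: smooth_local => x /H[U Ux [f1 f2]]; exists U.
Qed.

Lemma csmooth_comp (m : nat) (B : set 'rV[R]_m) (l : 'rV[R]_n -> 'rV[R]_m) (f : 'rV[R]_m -> R[i]) :
  open B -> (forall x, A x -> B (l x)) -> smooth A l -> csmooth B f -> csmooth A (fun x => f (l x)).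
Proof.
move=> oB AB sl [f1 f2]; split.
  exact: (smooth_comp oA oB AB sl f1).
exact: (smooth_comp oA oB AB sl f2).
Qed.

Lemma cderive_real (f : 'rV[R]_n -> R) x u :
  cderive u (fun y => (f y)%:C%C) x = ('D_u f x)%:C%C.
Proof. by rewrite /cderive /=; congr Complex; exact: derive_cst. Qed.

Lemma cderive_cst (a : R[i]) (x u : 'rV[R]_n) : cderive u (fun=> a) x = 0.
Proof. by rewrite /cderive !derive_cst. Qed.

Lemma csmooth_directional f (Y : 'rV[R]_n -> 'rV[R]_n) :
  csmooth A f -> smooth A Y -> csmooth A (fun x => cderive (Y x) f x).
Proof.
by move=> [f1 f2] sY; split; [exact: smooth_directional oA _ _ f1 sY|exact: smooth_directional oA _ _ f2 sY].
Qed.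

Lemma cderive_lie_bracket f (Y Z : 'rV[R]_n -> 'rV[R]_n) x :
  csmooth A f -> smooth A Y -> smooth A Z -> A x ->
  cderive (lie_bracket Y Z x) f x =
    cderive (Y x) (fun y => cderive (Z y) f y) x - cderive (Z x) (fun y => cderive (Y y) f y) x.
Proof.
move=> [f1 f2] sY sZ Ax; rewrite /cderive /=.
by rewrite (derive_lie_bracket oA f1 sY sZ Ax) (derive_lie_bracket oA f2 sY sZ Ax).
Qed.

End csmooth_closure.

Section line_bundle.
Context {R : realType} {n : nat} {A : set 'rV[R]_n} (oA : open A).
Context {E : hermitian_line A}.
Implicit Types s t : forall x, fib E x.

Lemma frame_coef_inj (t : triv E) x (a b : R[i]) : tdom t x ->
  a *: frame t x = b *: frame t x -> a = b.
Proof.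
move=> tx /eqP; rewrite -subr_eq0 -scalerBl scaler_eq0 subr_eq0.
by have [/negPf -> _] := frame_basis tx; rewrite orbF => /eqP.
Qed.

(** One frame near each point suffices: the coefficients in any other frame exist pointwise, are
    unique, and are locally the given ones times a smooth transition function. *)
Lemma smooth_section_local s :
  (forall x, A x -> exists (tr : triv E) U c, [/\ open U, U x, tdom tr x, csmooth U c &
     forall y, U y -> tdom tr y -> s y = c y *: frame tr y]) ->
  smooth_section s.
Proof.
move=> H t'.
have ex y : exists a : R[i], tdom t' y -> s y = a *: frame t' y.
  case: (pselect (tdom t' y)) => [ty|nty]; last by exists 0.
  by have [_ /(_ (s y)) [a]] := frame_basis ty; exists a.
have [c' Hc'] := choice ex.
exists c' => //; apply: csmooth_local => x tx.
have [t [U [c [oU Ux tx' sc Hs]]]] := H x (tdom_sub tx).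
have [d sd Hd] := frame_smooth t' t.
have oN : open (U `&` (tdom t' `&` tdom t)).
  by apply: openI => //; apply: openI; exact: tdom_open.
exists (U `&` (tdom t' `&` tdom t)) => //.
apply: (eq_csmooth oN (f := fun y => c y * d y)) => [y [Uy [ty ty']]|].
  apply: (frame_coef_inj ty); rewrite -Hc'// Hs// Hd//.
  by rewrite scalerA.
apply: (csmoothM oN).
  by apply: csmooth_sub sc => y [].
by apply: csmooth_sub sd => y [].
Qed.

Lemma eq_smooth_section s t : (forall x, A x -> s x = t x) -> smooth_section s -> smooth_section t.
Proof.
move=> st ss tr; have [c sc Hc] := ss tr.
by exists c => // x tx; rewrite -st ?Hc//; exact: tdom_sub tx.
Qed.

Lemma smooth_sectionD s t : smooth_section s -> smooth_section t ->
  smooth_section (fun x => s x + t x).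
Proof.
move=> ss st tr; have [c sc Hc] := ss tr; have [d sd Hd] := st tr.
exists (fun x => c x + d x); first by refine (csmoothD (tdom_open (t := tr)) sc sd).
by move=> x tx; rewrite Hc// Hd// scalerDl.
Qed.

Lemma smooth_sectionZ (f : 'rV[R]_n -> R[i]) s : csmooth A f -> smooth_section s ->
  smooth_section (fun x => f x *: s x).
Proof.
move=> sf ss tr; have [c sc Hc] := ss tr.
exists (fun x => f x * c x).
  by refine (csmoothM (tdom_open (t := tr)) (csmooth_sub (tdom_sub (t := tr)) sf) sc).
by move=> x tx; rewrite Hc// scalerA.
Qed.

Lemma smooth_section0 : smooth_section (fun x => 0 : fib E x).
Proof. by move=> tr; exists (fun=> 0); [exact: csmooth_cst|move=> x _; rewrite scale0r]. Qed.

Lemma smooth_section_sum (I : Type) (r : seq I) (s : I -> forall x, fib E x) :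
  (forall i, smooth_section (s i)) -> smooth_section (fun x => \sum_(i <- r) s i x).
Proof.
move=> ss; elim: r => [|i r IH].
  by apply: eq_smooth_section smooth_section0 => x _; rewrite big_nil.
by apply: eq_smooth_section (smooth_sectionD (ss i) IH) => x _; rewrite big_cons.
Qed.

End line_bundle.

(** * Locality of connections and tensoriality of the curvature *)

Lemma sub_both_cancel (V : zmodType) (a b c d : V) : a + b - (c + d) - (a - c) = b - d.
Proof. by rewrite [- (c + d)]opprD addrACA [X in X - _]addrC addrK. Qed.

Lemma sub_all_cancel (V : zmodType) (a b c d p l : V) :
  a + b + p - (c + d + p) - (a - c + l) = b - d - l.
Proof.
rewrite [- (c + d + p)]opprD addrACA subrr addr0 [- (c + d)]opprD addrACA.
by move: (a - c) (b - d) => u v; rewrite opprD addrACA subrr add0r.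
Qed.

Section connection_theory.
Context {R : realType} {n : nat} {A : set 'rV[R]_n} (oA : open A).
Context {E : hermitian_line A} {D : connection E}.
Implicit Types (s t : forall x, fib E x) (Y Z : 'rV[R]_n -> 'rV[R]_n).

(* [nab] takes total fields and sections. Scaling by this function, smooth on A
   whatever its values outside, shows that only their values on A matter. *)
Definition off_support (x : 'rV[R]_n) : R := if `[<A x>] then 0 else 1.

Lemma smooth_off_support : smooth A off_support.
Proof.
apply: (eq_smooth oA _ (smooth_cst (0 : R))) => x Ax.
by rewrite /off_support; case: asboolP.
Qed.

Lemma off_support_in x : A x -> off_support x = 0.
Proof. by move=> Ax; rewrite /off_support; case: asboolP. Qed.

Lemma off_support_out x : ~ A x -> off_support x = 1.
Proof. by move=> Ax; rewrite /off_support; case: asboolP. Qed.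

Lemma nab_vf0 s x : smooth_section s -> A x -> D (fun=> 0) s x = 0.
Proof.
move=> ss Ax.
have := nab_vf_linear D (smooth_cst (1:R)) (smooth_cst 0) (smooth_cst 0) ss Ax.
rewrite (_ : (fun y => _) = (fun=> 0)); last by apply/funext => y; rewrite scale1r addr0.
by rewrite scale1r -[LHS]addr0 => /addrI.
Qed.

Lemma nab_vfD Y Z s x : smooth A Y -> smooth A Z -> smooth_section s -> A x ->
  D (fun y => Y y + Z y) s x = D Y s x + D Z s x.
Proof.
move=> sY sZ ss Ax.
have := nab_vf_linear D (smooth_cst (1:R)) sY sZ ss Ax.
by rewrite scale1r; congr (D _ s x = _); apply/funext => y; rewrite scale1r.
Qed.

Lemma nab_vfZ (f : 'rV[R]_n -> R) Y s x : smooth A f -> smooth A Y -> smooth_section s -> A x ->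
  D (fun y => f y *: Y y) s x = (f x)%:C%C *: D Y s x.
Proof.
move=> sf sY ss Ax.
have := nab_vf_linear D sf sY (smooth_cst 0) ss Ax.
rewrite (nab_vf0 ss Ax) addr0; congr (D _ s x = _); apply/funext => y; exact: addr0.
Qed.

Lemma eq_nab_vf Y Z s x : smooth A Y -> (forall x, A x -> Y x = Z x) -> smooth_section s -> A x ->
  D Y s x = D Z s x.
Proof.
move=> sY YZ ss Ax.
have sZ : smooth A Z by exact: eq_smooth oA YZ sY.
have sYZ : smooth A (fun y => Y y - Z y).
  by apply: (eq_smooth oA _ (smooth_cst (0 : 'rV[R]_n))) => y Ay; rewrite YZ// subrr.
(* The field [off_support *: (Y - Z) + Z] is [Y] everywhere: on [A] because [Y = Z] there, outside
   because the factor is 1. On [A] the factor vanishes, which leaves [D Z s]. *)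
have := nab_vf_linear D smooth_off_support sYZ sZ ss Ax.
rewrite off_support_in// scale0r add0r => <-; congr (D _ s x); apply/funext => y.
have [Ay|nAy] := pselect (A y); first by rewrite off_support_in// scale0r add0r YZ.
by rewrite off_support_out// scale1r subrK.
Qed.

Lemma eq_nab_section Y s t x : smooth A Y -> (forall x, A x -> s x = t x) -> smooth_section s -> A x ->
  D Y s x = D Y t x.
Proof.
move=> sY st ss Ax.
have s_t : smooth_section t by exact: eq_smooth_section st ss.
have sd : smooth_section (fun y => s y - t y).
  by apply: (eq_smooth_section _ (@smooth_section0 _ _ _ E)) => y Ay; rewrite st// subrr.
have soff := csmooth_real smooth_off_support.
have h : D Y (fun y => (off_support y)%:C%C *: (s y - t y)) x = 0.
  rewrite (nab_leibniz D soff sY sd Ax) off_support_in// scale0r addr0.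
  rewrite cderive_real (_ : 'D_(Y x) off_support x = 0) ?scale0r//.
  rewrite -[RHS](derive_cst (0 : R) x (Y x)); apply: near_eq_derive.
  by apply: filterS (open_nbhs_nbhs (conj oA Ax)) => y Ay; rewrite off_support_in.
have := nab_add D sY (smooth_sectionZ soff sd) s_t Ax; rewrite h add0r => <-.
congr (D Y _ x); apply/functional_extensionality_dep => y.
have [Ay|nAy] := pselect (A y); first by rewrite off_support_in// scale0r add0r st.
by rewrite off_support_out// scale1r subrK.
Qed.

Lemma nab_vf_sum (I : Type) (r : seq I) (Y : I -> 'rV[R]_n -> 'rV[R]_n) s x :
  (forall i, smooth A (Y i)) -> smooth_section s -> A x ->
  D (fun y => \sum_(i <- r) Y i y) s x = \sum_(i <- r) D (Y i) s x.
Proof.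
move=> sY ss Ax; elim: r => [|i r IH].
  rewrite big_nil -(nab_vf0 ss Ax); congr (D _ s x); by apply/funext => y; rewrite big_nil.
rewrite big_cons -IH -(nab_vfD (sY i) (smooth_sum oA _ sY) ss Ax).
by congr (D _ s x); apply/funext => y; rewrite big_cons.
Qed.

Lemma nab_section0 Y x : smooth A Y -> A x -> D Y (fun y => 0 : fib E y) x = 0.
Proof.
move=> sY Ax; have := nab_add D sY (@smooth_section0 _ _ _ E) (@smooth_section0 _ _ _ E) Ax.
rewrite (_ : (fun y => (0 : fib E y) + 0) = (fun y => 0)).
  by rewrite -[LHS]addr0 => /addrI.
by apply/functional_extensionality_dep => y; rewrite addr0.
Qed.

Lemma nab_section_sum (I : Type) (r : seq I) Y (s : I -> forall x, fib E x) x :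
  smooth A Y -> (forall i, smooth_section (s i)) -> A x ->
  D Y (fun y => \sum_(i <- r) s i y) x = \sum_(i <- r) D Y (s i) x.
Proof.
move=> sY ss Ax; elim: r => [|i r IH].
  rewrite big_nil -(nab_section0 sY Ax); congr (D Y _ x).
  by apply/functional_extensionality_dep => y; rewrite big_nil.
rewrite big_cons -IH -(nab_add D sY (ss i) (smooth_section_sum _ ss) Ax).
by congr (D Y _ x); apply/functional_extensionality_dep => y; rewrite big_cons.
Qed.

Lemma nab_sectionZ (a : R[i]) Y s x : smooth A Y -> smooth_section s -> A x ->
  D Y (fun y => a *: s y) x = a *: D Y s x.
Proof.
move=> sY ss Ax; rewrite (nab_leibniz D (csmooth_cst a) sY ss Ax).
by rewrite cderive_cst scale0r add0r.
Qed.

Lemma nab_coord Y s x : smooth A Y -> smooth_section s -> A x ->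
  D Y s x = \sum_a (Y x 0 a)%:C%C *: D (fun=> delta_mx 0 a) s x.
Proof.
move=> sY ss Ax.
have sYa a := smooth_coord oA a sY.
have sc a := @smooth_cst R n A _ (delta_mx 0 a : 'rV[R]_n).
have sY' a : smooth A (fun y => Y y 0 a *: delta_mx 0 a : 'rV[R]_n).
  apply/(smooth_rV oA) => j.
  have := smoothM oA (sYa a) (@smooth_cst R n A _ ((delta_mx 0 a : 'rV[R]_n) 0 j)).
  by congr (smooth _ _); apply/funext => y; rewrite !mxE.
transitivity (\sum_a D (fun y => Y y 0 a *: delta_mx 0 a) s x).
  rewrite -(nab_vf_sum _ sY' ss Ax); congr (D _ s x); apply/funext => y.
  exact: row_sum_delta.
by apply: eq_bigr => a _; rewrite (nab_vfZ (sYa a) (sc a) ss Ax).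
Qed.

Lemma nab_vfB Y Z s x : smooth A Y -> smooth A Z -> smooth_section s -> A x ->
  D (fun y => Y y - Z y) s x = D Y s x - D Z s x.
Proof.
move=> sY sZ ss Ax.
have sYZ : smooth A (fun y => Y y - Z y).
  apply/(smooth_rV oA) => j; have := smoothB oA (smooth_coord oA j sY) (smooth_coord oA j sZ).
  by congr (smooth _ _); apply/funext => y; rewrite !mxE.
rewrite (nab_coord sYZ ss Ax) (nab_coord sY ss Ax) (nab_coord sZ ss Ax) -sumrB.
by apply: eq_bigr => a _; rewrite !mxE rmorphB scalerBl.
Qed.

(** Expand [Y] and [Z] in constant fields. The terms in which a coefficient is differentiated add up
    to the derivative along the Lie bracket and are removed by it; what remains sees [Y] and [Z]
    only through their values at [x]. *)
Lemma curvature_coord Y Z s x : smooth A Y -> smooth A Z -> smooth_section s -> A x ->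
  curvature D Y Z s x = \sum_a \sum_b (Y x 0 a * Z x 0 b)%:C%C *:
    (D (fun=> delta_mx 0 a) (D (fun=> delta_mx 0 b) s) x
     - D (fun=> delta_mx 0 b) (D (fun=> delta_mx 0 a) s) x).
Proof.
move=> sY sZ ss Ax.
pose e a : 'rV[R]_n -> 'rV[R]_n := fun=> delta_mx 0 a.
have se a : smooth A (e a) by exact: smooth_cst.
have sse a : smooth_section (D (e a) s) by exact: (nab_smooth D (se a) ss).
have second (Y' Z' : 'rV[R]_n -> 'rV[R]_n) : smooth A Y' -> smooth A Z' -> D Y' (D Z' s) x =
   \sum_b (('D_(Y' x) Z' x) 0 b)%:C%C *: D (e b) s x +
   \sum_b (Z' x 0 b)%:C%C *: D Y' (D (e b) s) x.
  move=> sY' sZ'.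
  have sZb b := csmooth_real (smooth_coord oA b sZ').
  rewrite (eq_nab_section sY' (t := fun y => \sum_b (Z' y 0 b)%:C%C *: D (e b) s y) _ (nab_smooth D sZ' ss) Ax).
  - rewrite (nab_section_sum _ sY' (fun b => smooth_sectionZ (sZb b) (sse b)) Ax).
    rewrite -big_split /=; apply: eq_bigr => b _.
    rewrite (nab_leibniz D (sZb b) sY' (sse b) Ax) cderive_real derive_rV_coord//.
    exact: smooth_rV_derivable sZ' Ax.
  - by move=> y Ay; exact: (nab_coord sZ' ss Ay).
rewrite /curvature (second _ _ sY sZ) (second _ _ sZ sY) (nab_coord (smooth_lie_bracket oA sY sZ) ss Ax).
pose S1 := \sum_b (('D_(Y x) Z x) 0 b)%:C%C *: D (e b) s x.
pose S2 := \sum_b (Z x 0 b)%:C%C *: D Y (D (e b) s) x.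
pose S3 := \sum_b (('D_(Z x) Y x) 0 b)%:C%C *: D (e b) s x.
pose S4 := \sum_b (Y x 0 b)%:C%C *: D Z (D (e b) s) x.
transitivity (S1 + S2 - (S3 + S4) - (S1 - S3)).
  congr (_ - _); rewrite /S1 /S3 -sumrB; apply: eq_bigr => b _.
  by rewrite /lie_bracket !mxE rmorphB scalerBl.
rewrite sub_both_cancel.
rewrite /S2 /S4 exchange_big /=.
have -> : \sum_b (Y x 0 b)%:C%C *: D Z (D (e b) s) x =
    \sum_b \sum_a (Y x 0 a * Z x 0 b)%:C%C *: D (e b) (D (e a) s) x.
  rewrite exchange_big /=; apply: eq_bigr => a _; rewrite (nab_coord sZ (sse a) Ax) scaler_sumr.
  by apply: eq_bigr => b _; rewrite scalerA rmorphM.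
rewrite -sumrB; apply: eq_bigr => b _.
rewrite (nab_coord sY (sse b) Ax) scaler_sumr -sumrB; apply: eq_bigr => a _.
by rewrite scalerBr scalerA -rmorphM [Z x 0 b * _]mulrC.
Qed.

Lemma curvature_pointwise Y Z s x : smooth A Y -> smooth A Z -> smooth_section s -> A x ->
  curvature D Y Z s x = curvature D (fun=> Y x) (fun=> Z x) s x.
Proof.
by move=> sY sZ ss Ax; rewrite (curvature_coord sY sZ ss Ax) (curvature_coord (smooth_cst _) (smooth_cst _) ss Ax).
Qed.

(** The terms with one derivative on [f] and one on [s] are symmetric in [Y] and [Z] and cancel; the
    second derivatives of [f] are compensated by the Leibniz term of the bracket, by
    [cderive_lie_bracket]. *)
Lemma curvature_sectionZ (f : 'rV[R]_n -> R[i]) Y Z s x :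
  csmooth A f -> smooth A Y -> smooth A Z -> smooth_section s -> A x ->
  curvature D Y Z (fun y => f y *: s y) x = f x *: curvature D Y Z s x.
Proof.
move=> sf sY sZ ss Ax.
have second (Y' Z' : 'rV[R]_n -> 'rV[R]_n) : smooth A Y' -> smooth A Z' ->
   D Y' (D Z' (fun y => f y *: s y)) x =
   cderive (Y' x) (fun y => cderive (Z' y) f y) x *: s x + f x *: D Y' (D Z' s) x +
   (cderive (Z' x) f x *: D Y' s x + cderive (Y' x) f x *: D Z' s x).
  move=> sY' sZ'.
  have sZf := csmooth_directional oA sf sZ'.
  have sZs := nab_smooth D sZ' ss.
  rewrite (eq_nab_section sY' (t := fun y => cderive (Z' y) f y *: s y + f y *: D Z' s y) _ (nab_smooth D sZ' (smooth_sectionZ sf ss)) Ax).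
  - rewrite (nab_add D sY' (smooth_sectionZ sZf ss) (smooth_sectionZ sf sZs) Ax).
    rewrite (nab_leibniz D sZf sY' ss Ax) (nab_leibniz D sf sY' sZs Ax).
    by rewrite [_ *: D Z' s x + _]addrC addrACA.
  - by move=> y Ay; exact: (nab_leibniz D sf sZ' ss Ay).
rewrite /curvature (second _ _ sY sZ) (second _ _ sZ sY) (nab_leibniz D sf (smooth_lie_bracket oA sY sZ) ss Ax).
rewrite (cderive_lie_bracket oA sf sY sZ Ax) !scalerBr scalerBl.
rewrite [cderive (Y x) f x *: _ + _]addrC; exact: sub_all_cancel.
Qed.

End connection_theory.

(** * Hamiltonian vector fields and the local commutator *)

Lemma smooth_det (R : realType) (n m : nat) (A : set 'rV[R]_n) (M : 'rV[R]_n -> 'M[R]_m) :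
  open A -> (forall i j, smooth A (fun x => M x i j)) -> smooth A (fun x => \det (M x)).
Proof.
move=> oA sM; apply: (smooth_sum oA) => p; apply: (smoothM oA); first exact: smooth_cst.
by apply: (smooth_prod oA) => i; exact: sM.
Qed.

(** With the determinant, this is Cramer's rule for the inverse Gram matrix of the symplectic
    form. *)
Lemma smooth_adj (R : realType) (n m : nat) (A : set 'rV[R]_n) (M : 'rV[R]_n -> 'M[R]_m) i j :
  open A -> (forall i j, smooth A (fun x => M x i j)) -> smooth A (fun x => (\adj (M x)) i j).
Proof.
move=> oA sM.
have -> : (fun x => (\adj (M x)) i j) = (fun x => (-1) ^+ (j + i) * \det (row' j (col' i (M x)))).
  by apply/funext => x; rewrite mxE.
apply: (smoothM oA); first exact: smooth_cst.
apply: (smooth_det oA) => a b.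
have := sM (lift j a) (lift i b); congr (smooth _ _).
by apply/funext => x; rewrite !mxE.
Qed.

(** The linear bookkeeping of [form_lie_ham]: [p1] to [p5] are values of [w] on a derivative of a
    Hamiltonian field, [a1] to [a4] derivatives of [w] with frozen arguments, [b1] to [b4] second
    derivatives of the two functions. The last hypothesis is closedness. *)
Lemma lie_ham_arith (R : realFieldType) (p1 p2 p3 p4 p5 a1 a2 a3 a4 b1 b2 b3 b4 : R) :
  p1 = - b1 - a1 -> p2 = - b2 - a2 -> p3 = - b3 - a3 -> p4 = - p5 -> p5 = - b4 - a4 ->
  a4 = - a3 -> b3 = b1 -> b4 = b2 -> a1 - a2 + a4 = 0 -> p1 - p2 = a3 + p3 + p4.
Proof. lra. Qed.

Section symplectic_local.
Context {R : realType} {n : nat} {A : set 'rV[R]_n} (oA : open A).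
Variable w : 'rV[R]_n -> 'rV[R]_n -> 'rV[R]_n -> R.
Hypothesis w_lin : forall x, A x -> forall (a : R) u v t,
  w x (a *: u + v) t = a * w x u t + w x v t.
Hypothesis w_anti : forall x, A x -> forall u v, w x u v = - w x v u.
Hypothesis w_smooth : forall u v, smooth A (fun x => w x u v).
Hypothesis w_closed : forall x, A x -> forall u v t, ext_deriv w x u v t = 0.
Hypothesis w_nondeg : forall x, A x -> forall u, (forall v, w x u v = 0) -> u = 0.
Implicit Types (x u v : 'rV[R]_n) (Y Z : 'rV[R]_n -> 'rV[R]_n) (f g : 'rV[R]_n -> R).

(** Convertible to [hamiltonian_vf] on a single chart; the form and the function are plain maps
    here, which keeps the local theory independent of the orbifold. *)
Definition ham f x : 'rV[R]_n := xget 0 [set u | forall v, w x u v = - 'D_v f x].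

Definition gram x : 'M[R]_n := \matrix_(a, b) w x (delta_mx 0 a) (delta_mx 0 b).

Lemma form0l x t : A x -> w x 0 t = 0.
Proof. by move=> Ax; have := w_lin Ax 1 0 0 t; rewrite scale1r addr0 mul1r -[LHS]addr0 => /addrI <-. Qed.

Lemma form_suml x (c : 'I_n -> R) t : A x ->
  w x (\sum_a c a *: delta_mx 0 a) t = \sum_a c a * w x (delta_mx 0 a) t.
Proof.
move=> Ax; apply: (big_rec2 (fun u r => w x u t = r)) => [|a u r _ <-]; first exact: form0l.
by rewrite w_lin.
Qed.

Lemma form_coordl x u t : A x -> w x u t = \sum_a u 0 a * w x (delta_mx 0 a) t.
Proof. by move=> Ax; rewrite {1}[u]row_sum_delta form_suml. Qed.

Lemma form_coord x u v : A x ->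
  w x u v = \sum_a \sum_b u 0 a * v 0 b * w x (delta_mx 0 a) (delta_mx 0 b).
Proof.
move=> Ax; rewrite (form_coordl u v Ax); apply: eq_bigr => a _.
rewrite (w_anti Ax) (form_coordl v _ Ax) -sumrN mulr_sumr; apply: eq_bigr => b _.
by rewrite -mulrN -(w_anti Ax) mulrA.
Qed.

Lemma form_gram x u v : A x -> w x u v = (u *m gram x *m v^T) 0 0.
Proof.
move=> Ax; rewrite (form_coord u v Ax) exchange_big /= mxE; apply: eq_bigr => b _.
rewrite mxE mulr_suml; apply: eq_bigr => a _.
by rewrite !mxE mulrAC.
Qed.

Lemma form_subl x u v t : A x -> w x (u - v) t = w x u t - w x v t.
Proof. by move=> Ax; rewrite addrC -scaleN1r (w_lin Ax) mulN1r addrC. Qed.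

Lemma formNl x u t : A x -> w x (- u) t = - w x u t.
Proof. by move=> Ax; rewrite -sub0r (form_subl _ _ _ Ax) (form0l _ Ax) sub0r. Qed.

Lemma form_inj x u v : A x -> (forall t, w x u t = w x v t) -> u = v.
Proof.
move=> Ax E; apply/subr0_eq/(w_nondeg Ax) => t.
by rewrite (form_subl _ _ _ Ax) E subrr.
Qed.

Lemma gram_unit x : A x -> gram x \in unitmx.
Proof.
move=> Ax; rewrite -row_free_unit; apply/inj_row_free => u uW.
by apply: (w_nondeg Ax) => v; rewrite (form_gram _ _ Ax) uW mul0mx mxE.
Qed.

(** The equation for [u] is the linear system [u *m gram x = - df]. Its explicit solution shows that
    the set in [ham] is inhabited, so [xget] does not return its default, and nondegeneracy makes
    this solution the only one. *)
Lemma hamE f x : smooth A f -> A x ->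
  ham f x = (\row_b - 'D_(delta_mx 0 b) f x) *m invmx (gram x).
Proof.
move=> sf Ax; rewrite /ham; set u0 := RHS.
have u0P v : w x u0 v = - 'D_v f x.
  rewrite (form_gram _ _ Ax) /u0 mulmxKV ?gram_unit// mxE (smooth_derivative oA v sf Ax) -sumrN.
  by apply: eq_bigr => b _; rewrite !mxE mulNr mulrC.
case: xgetP => [u _ /= Hu|/(_ u0)//].
by apply: (form_inj Ax) => t; rewrite Hu u0P.
Qed.

Lemma hamP f x v : smooth A f -> A x -> w x (ham f x) v = - 'D_v f x.
Proof.
move=> sf Ax; rewrite (hamE sf Ax) (form_gram _ _ Ax) mulmxKV ?gram_unit// mxE.
rewrite (smooth_derivative oA v sf Ax) -sumrN.
by apply: eq_bigr => b _; rewrite !mxE mulNr mulrC.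
Qed.

Lemma smooth_ham f : smooth A f -> smooth A (ham f).
Proof.
move=> sf.
have sg a b : smooth A (fun x => gram x a b).
  have := w_smooth (delta_mx 0 a) (delta_mx 0 b); congr (smooth _ _).
  by apply/funext => x; rewrite mxE.
have sdet : smooth A (fun x => (\det (gram x))^-1).
  apply: (smoothV oA) => [x Ax|]; last exact: (smooth_det oA sg).
  by have := gram_unit Ax; rewrite unitmxE unitfE.
apply/(smooth_rV oA) => j.
apply: (eq_smooth oA (f := fun x => \sum_b (- 'D_(delta_mx 0 b) f x) * ((\det (gram x))^-1 * (\adj (gram x)) b j))).
  move=> x Ax; rewrite (hamE sf Ax) mxE; apply: eq_bigr => b _.
  by rewrite /invmx gram_unit// !mxE.
apply: (smooth_sum oA) => b; apply: (smoothM oA).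
  exact: (smoothN oA (smooth_partial b sf)).
exact: (smoothM oA sdet (smooth_adj b j oA sg)).
Qed.

Lemma smooth_form Y Z : smooth A Y -> smooth A Z -> smooth A (fun x => w x (Y x) (Z x)).
Proof.
move=> sY sZ.
apply: (eq_smooth oA (f := fun x => \sum_a \sum_b Y x 0 a * Z x 0 b * w x (delta_mx 0 a) (delta_mx 0 b))).
  by move=> x Ax; rewrite (form_coord _ _ Ax).
apply: (smooth_sum oA) => a; apply: (smooth_sum oA) => b.
exact: (smoothM oA (smoothM oA (smooth_coord oA a sY) (smooth_coord oA b sZ)) (w_smooth _ _)).
Qed.

Lemma derive_form Y Z x u : smooth A Y -> smooth A Z -> A x ->
  'D_u (fun y => w y (Y y) (Z y)) x =
    'D_u (fun y => w y (Y x) (Z x)) x + w x ('D_u Y x) (Z x) + w x (Y x) ('D_u Z x).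
Proof.
move=> sY sZ Ax.
pose e a : 'rV[R]_n := delta_mx 0 a.
have expand (Y' Z' : 'rV[R]_n -> 'rV[R]_n) :
   'D_u (fun y => w y (Y' y) (Z' y)) x = 'D_u (fun y => \sum_a \sum_b Y' y 0 a * Z' y 0 b * w y (e a) (e b)) x.
  apply: near_eq_derive; apply: filterS (open_nbhs_nbhs (conj oA Ax)) => y Ay.
  exact: form_coord.
have dY a : derivable (fun y => Y y 0 a) x u := smooth_derivable_dir oA (smooth_coord oA a sY) Ax.
have dZ a : derivable (fun y => Z y 0 a) x u := smooth_derivable_dir oA (smooth_coord oA a sZ) Ax.
have dw a b : derivable (fun y => w y (e a) (e b)) x u := smooth_derivable_dir oA (w_smooth _ _) Ax.
rewrite (expand Y Z) (expand (fun=> Y x) (fun=> Z x)) (form_coord _ (Z x) Ax) (form_coord (Y x) _ Ax).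
have split_sum (F : 'I_n -> 'I_n -> 'rV[R]_n -> R) : (forall a b, derivable (F a b) x u) ->
   'D_u (fun y => \sum_a \sum_b F a b y) x = \sum_a \sum_b 'D_u (F a b) x.
  move=> dF.
  have dsum a : derivable (fun y => \sum_b F a b y) x u.
    exact: derivablef_sum (dF a).
  by rewrite (derivef_sum dsum); apply: eq_bigr => a _; rewrite (derivef_sum (dF a)).
rewrite split_sum; last by move=> a b; apply: derivableM => //; exact: derivableM.
rewrite split_sum; last first.
  move=> a b; apply: derivableM; [|exact: dw].
  exact: (derivable_cst (Y x 0 a * Z x 0 b)).
rewrite -!big_split /=; apply: eq_bigr => a _; rewrite -!big_split /=; apply: eq_bigr => b _.
rewrite (derivefM (derivableM (dY a) (dZ b)) (dw a b)) (derivefM (dY a) (dZ b)).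
rewrite (derivefM (derivable_cst (Y x 0 a * Z x 0 b) x u) (dw a b)) derive_cst mul0r add0r.
rewrite -(derive_rV_coord _ (smooth_rV_derivable oA sY Ax)).
rewrite -(derive_rV_coord _ (smooth_rV_derivable oA sZ Ax)).
by rewrite mulrDl [LHS]addrC addrA; congr (_ + _ + _).
Qed.

(** Differentiate the defining identity [w (ham f) v = - 'D_v f] in the direction [u], with [v]
    constant. *)
Lemma form_derive_ham f x u v : smooth A f -> A x ->
  w x ('D_u (ham f) x) v = - 'D_u ('D_v f) x - 'D_u (fun y => w y (ham f x) v) x.
Proof.
move=> sf Ax.
have := derive_form (Z := fun=> v) u (smooth_ham sf) (smooth_cst v) Ax.
rewrite derive_cst (w_anti Ax _ 0) (form0l _ Ax) oppr0 addr0.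
have -> : 'D_u (fun y => w y (ham f y) v) x = - 'D_u ('D_v f) x.
  rewrite -deriveN; last exact: (smooth_derivable_dir oA (smooth_directional oA sf (smooth_cst v)) Ax).
  apply: near_eq_derive; apply: filterS (open_nbhs_nbhs (conj oA Ax)) => y Ay.
  exact: hamP.
by move=> ->; rewrite addrC addKr.
Qed.

(* The derivatives of w in the three directions cancel by closedness, and the
   second derivatives of f and g by symmetry. *)
Lemma form_lie_ham f g x v : smooth A f -> smooth A g -> A x ->
  w x (lie_bracket (ham f) (ham g) x) v = 'D_v (fun y => w y (ham g y) (ham f y)) x.
Proof.
move=> sf sg Ax.
rewrite /lie_bracket (form_subl _ _ _ Ax) (derive_form v (smooth_ham sg) (smooth_ham sf) Ax).
have P1 := form_derive_ham (ham f x) v sg Ax.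
have P2 := form_derive_ham (ham g x) v sf Ax.
have P3 := form_derive_ham v (ham f x) sg Ax.
have P4 := w_anti Ax (ham g x) ('D_v (ham f) x).
have P5 := form_derive_ham v (ham g x) sf Ax.
have P6 : 'D_v (fun y => w y (ham f x) (ham g x)) x = - 'D_v (fun y => w y (ham g x) (ham f x)) x.
  rewrite -deriveN; last exact: (smooth_derivable_dir oA (w_smooth _ _) Ax).
  apply: near_eq_derive; apply: filterS (open_nbhs_nbhs (conj oA Ax)) => y Ay.
  exact: w_anti.
have S1 := smooth_schwarz oA v (ham f x) sg Ax.
have S2 := smooth_schwarz oA v (ham g x) sf Ax.
exact: (lie_ham_arith P1 P2 P3 P4 P5 P6 S1 S2 (w_closed Ax (ham f x) (ham g x) v)).
Qed.

Lemma ham_poisson f g x : smooth A f -> smooth A g -> A x ->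
  ham (fun y => w y (ham g y) (ham f y)) x = - lie_bracket (ham f) (ham g) x.
Proof.
move=> sf sg Ax.
have sp : smooth A (fun y => w y (ham g y) (ham f y)) by exact: (smooth_form (smooth_ham sg) (smooth_ham sf)).
apply: (form_inj Ax) => t; rewrite (hamP t sp Ax) -(form_lie_ham t sf sg Ax).
by rewrite (formNl _ _ Ax).
Qed.

End symplectic_local.

(** Here [c] stands for w(X_f, X_g), which is the derivative of [g] along X_f and the opposite of
    that of [f] along X_g. These two derivatives contribute [- 2 k c s] on the left: one half is [k]
    times the multiplication part of Q{f,g}, and the other is [k ^+ 2 * h * c * s], because
    [k * h = -1]. *)
Lemma commutator_arith (K : fieldType) (k h c f g a1 a2 l d1 d2 s : K) : k * h = -1 ->
  - k * (- k * a1 + (c * s + g * d1)) + f * (- k * d2 + g * s)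
  - (- k * (- k * a2 + (- c * s + f * d2)) + g * (- k * d1 + f * s))
  = k * (- k * - l + - c * s) + k ^+ 2 * (a1 - a2 - l + - (- h * c) * s).
Proof.
move=> kh.
have -> : k ^+ 2 * (a1 - a2 - l + - (- h * c) * s) = k ^+ 2 * (a1 - a2 - l) + k * (k * h) * c * s by ring.
rewrite kh; ring.
Qed.

(* In a line bundle all the vectors are multiples of the frame, which reduces the
   identity to one between scalars. *)
Lemma commutator_module (K : fieldType) (V : lmodType K) (e v1 v2 vl w1 w2 s : V) (k h c f g : K) :
  (forall v : V, exists a, v = a *: e) -> k * h = -1 ->
  (- k) *: ((- k) *: v1 + (c *: s + g *: w1)) + f *: ((- k) *: w2 + g *: s)
  - ((- k) *: ((- k) *: v2 + ((- c) *: s + f *: w2)) + g *: ((- k) *: w1 + f *: s))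
  = k *: ((- k) *: - vl + (- c) *: s) + k ^+ 2 *: (v1 - v2 - vl - (- h * c) *: s).
Proof.
move=> fr kh.
have [a1 ->] := fr v1; have [a2 ->] := fr v2; have [l ->] := fr vl.
have [d1 ->] := fr w1; have [d2 ->] := fr w2; have [t ->] := fr s.
rewrite !(scalerA, =^~ scaleNr, =^~ scalerDl); congr (_ *: _).
exact: (commutator_arith c f g a1 a2 l d1 d2 t kh).
Qed.

Section prequantum_local.
Context {R : realType} {n : nat} {A : set 'rV[R]_n} (oA : open A).
Context {E : hermitian_line A} {D : connection E}.
Variable w : 'rV[R]_n -> 'rV[R]_n -> 'rV[R]_n -> R.
Hypothesis w_lin : forall x, A x -> forall (a : R) u v t,
  w x (a *: u + v) t = a * w x u t + w x v t.
Hypothesis w_anti : forall x, A x -> forall u v, w x u v = - w x v u.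
Hypothesis w_smooth : forall u v, smooth A (fun x => w x u v).
Hypothesis w_closed : forall x, A x -> forall u v t, ext_deriv w x u v t = 0.
Hypothesis w_nondeg : forall x, A x -> forall u, (forall v, w x u v = 0) -> u = 0.
Variables (k h : R[i]).
Hypothesis kh : k * h = -1.

Definition preq (f : 'rV[R]_n -> R) (s : forall x, fib E x) x : fib E x :=
  (- k) *: D (ham w f) s x + (f x)%:C%C *: s x.

Lemma preq_commutator f g s x : smooth A f -> smooth A g -> smooth_section s -> A x ->
  preq f (preq g s) x - preq g (preq f s) x
  = k *: preq (fun y => w y (ham w g y) (ham w f y)) s x
    + k ^+ 2 *: (curvature D (ham w f) (ham w g) s x
                 - (- h * (w x (ham w f x) (ham w g x))%:C%C) *: s x).
Proof.
move=> sf sg ss Ax.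
have sX := smooth_ham oA w_lin w_anti w_smooth w_nondeg sf.
have sY := smooth_ham oA w_lin w_anti w_smooth w_nondeg sg.
(* The derivative of [g'] along [ham w f'] enters as a parameter [r], so that w(X_f, X_g) and its
   opposite can be put in for the two orders. *)
have expand f' g' r : smooth A f' -> smooth A g' -> smooth A (ham w f') -> smooth A (ham w g') ->
  'D_(ham w f' x) g' x = r ->
  preq f' (preq g' s) x =
    (- k) *: ((- k) *: D (ham w f') (D (ham w g') s) x
              + (r%:C%C *: s x + (g' x)%:C%C *: D (ham w f') s x))
    + (f' x)%:C%C *: ((- k) *: D (ham w g') s x + (g' x)%:C%C *: s x).
  move=> sf' sg' sX' sY' <-; rewrite {1}/preq; congr (_ *: _ + _).
  have scg := csmooth_real sg'.
  have sD := nab_smooth D sY' ss.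
  rewrite /preq (nab_add D sX' (smooth_sectionZ (csmooth_cst (- k)) sD) (smooth_sectionZ scg ss) Ax).
  by rewrite (nab_sectionZ _ sX' sD Ax) (nab_leibniz D scg sX' ss Ax) cderive_real.
have Dg : 'D_(ham w f x) g x = w x (ham w f x) (ham w g x).
  by rewrite (w_anti Ax) (hamP oA w_lin w_anti w_nondeg _ sg Ax) opprK.
have Df : 'D_(ham w g x) f x = - w x (ham w f x) (ham w g x).
  by rewrite (hamP oA w_lin w_anti w_nondeg _ sf Ax) opprK.
have sL := smooth_lie_bracket oA sX sY.
have sp := smooth_form oA w_lin w_anti w_smooth sY sX.
have sP := smooth_ham oA w_lin w_anti w_smooth w_nondeg sp.
have DP : D (ham w (fun y => w y (ham w g y) (ham w f y))) s x = - D (lie_bracket (ham w f) (ham w g)) s x.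
  rewrite (eq_nab_vf oA sP (Z := fun y => (fun=> 0) y - lie_bracket (ham w f) (ham w g) y) _ ss Ax).
    by rewrite (nab_vfB oA (smooth_cst 0) sL ss Ax) (nab_vf0 ss Ax) sub0r.
  move=> y Ay; rewrite sub0r; exact: (ham_poisson oA w_lin w_anti w_smooth w_closed w_nondeg sf sg Ay).
have pE : preq (fun y => w y (ham w g y) (ham w f y)) s x
    = (- k) *: - D (lie_bracket (ham w f) (ham w g)) s x
      + (- w x (ham w f x) (ham w g x))%:C%C *: s x.
  rewrite /preq; congr (_ *: _ + _%:C%C *: _); [exact: DP|exact: w_anti].
rewrite (expand f g _ sf sg sX sY Dg) (expand g f _ sg sf sY sX Df) pE.
have [t tx] := tdom_cover E Ax.
have [_ fr] := frame_basis tx.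
rewrite rmorphN; exact: commutator_module fr kh.
Qed.

End prequantum_local.

(** * Rigidity of chart embeddings *)

Section normed_closure.
Context {R : realType} {n : nat}.

Lemma closure_eq_limit (W : normedModType R) (T : set 'rV[R]_n) (F G : 'rV[R]_n -> W) (y : 'rV[R]_n) :
  closure T y -> {for y, continuous F} -> {for y, continuous G} ->
  (forall u, T u -> F u = G u) -> F y = G y.
Proof.
move=> cTy cF cG FG; apply/eqP; rewrite -subr_eq0 -normr_le0; apply/ler_addgt0Pr => e e0; rewrite add0r.
have e20 : 0 < e / 2 by rewrite divr_gt0.
have N1 : \forall u \near y, `|F y - F u| <= e / 2 by exact: (cvgrPdist_le _ _).1 cF _ e20.
have N2 : \forall u \near y, `|G y - G u| <= e / 2 by exact: (cvgrPdist_le _ _).1 cG _ e20.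
have [u [Tu [h1 h2]]] := cTy _ (filterI N1 N2).
rewrite (splitr e) -(subrKA (F u)) {2}(FG _ Tu); apply: (le_trans (ler_normD _ _)).
by apply: lerD => //; rewrite distrC.
Qed.

Lemma open_smooth_preimage (m : nat) (A : set 'rV[R]_n) (B : set 'rV[R]_m) (l : 'rV[R]_n -> 'rV[R]_m) :
  open A -> smooth A l -> open B -> open (A `&` l @^-1` B).
Proof.
move=> oA sl oB; rewrite openE => x [Ax Blx]; apply: filterI.
  exact: (open_nbhs_nbhs (conj oA Ax)).
exact: (smooth_continuous sl Ax (open_nbhs_nbhs (conj oB Blx))).
Qed.

Lemma derive_comp_rV (m p : nat) (A : set 'rV[R]_n) (B : set 'rV[R]_m)
    (l : 'rV[R]_n -> 'rV[R]_m) (f : 'rV[R]_m -> 'rV[R]_p) x v :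
  open A -> open B -> smooth A l -> smooth B f -> A x -> B (l x) ->
  'D_v (f \o l) x = 'D_('D_v l x) f (l x).
Proof.
move=> oA oB sl sf Ax Blx; apply/rowP => j.
have dl : derivable l x v := smooth_rV_derivable oA sl Ax.
have dfj := smooth_differentiable oB (smooth_coord oB j sf) Blx.
have [d1 d2] := chain_rule dl dfj.
rewrite (derive_rV_coord _ (smooth_rV_derivable oB sf Blx)) -d2.
rewrite derive_rV_coord//; apply/derivable_rVP => k.
by have [] := chain_rule dl (smooth_differentiable oB (smooth_coord oB k sf) Blx).
Qed.

Lemma smooth_comp_rV (m p : nat) (A : set 'rV[R]_n) (B : set 'rV[R]_m)
    (l : 'rV[R]_n -> 'rV[R]_m) (f : 'rV[R]_m -> 'rV[R]_p) :
  open A -> open B -> (forall x, A x -> B (l x)) -> smooth A l -> smooth B f -> smooth A (f \o l).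
Proof.
move=> oA oB AB sl sf; apply/(smooth_rV oA) => j.
exact: (smooth_comp oA oB AB sl (smooth_coord oB j sf)).
Qed.

Lemma near_derive_id (l : 'rV[R]_n -> 'rV[R]_n) (y v : 'rV[R]_n) :
  (\forall u \near y, l u = u) -> 'D_v l y = v.
Proof. by move=> lid; rewrite (near_eq_derive _ lid) -[RHS](derive_id y v). Qed.

(** The difference [psi] between [phi] and [N] times the identity has zero differential at [y],
    hence Lipschitz constant [N / 2] nearby. If [phi u = phi v], then [N * |u - v|] is at most half
    of itself. *)
Lemma local_injective (A : set 'rV[R]_n) (phi : 'rV[R]_n -> 'rV[R]_n) (y : 'rV[R]_n) (N : R) :
  open A -> smooth A phi -> A y -> 0 < N -> (forall v, 'D_v phi y = N *: v) ->
  exists2 d, 0 < d & forall u v, `|y - u| < d -> `|y - v| < d -> phi u = phi v -> u = v.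
Proof.
move=> oA sphi Ay N0 Dphi.
pose psi j (x : 'rV[R]_n) := phi x 0 j - N * x 0 j.
have spsi j : smooth A (psi j).
  apply: (smoothB oA (smooth_coord oA j sphi)).
  by apply: (smoothM oA); [exact: smooth_cst|exact: (smooth_coord oA j smooth_id)].
have Dpsi j v : 'D_v (psi j) y = 0.
  have d1 : derivable (fun x : 'rV[R]_n => phi x 0 j) y v.
    exact: (smooth_derivable_dir oA (smooth_coord oA j sphi) Ay).
  have d2 : derivable (fun x : 'rV[R]_n => x 0 j) y v.
    exact: (smooth_derivable_dir oA (smooth_coord oA j smooth_id) Ay).
  have d3 : derivable (fun x : 'rV[R]_n => N * x 0 j) y v.
    exact: (derivableM (derivable_cst N y v) d2).
  rewrite [LHS](deriveB d1 d3) (derivefM (derivable_cst N y v) d2) derive_cst mul0r add0r.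
  rewrite -(derive_rV_coord _ (smooth_rV_derivable oA sphi Ay)) Dphi mxE.
  have d4 : derivable (fun x : 'rV[R]_n => x) y v by exact: derivable_id.
  have D4 : 'D_v (fun x : 'rV[R]_n => x) y = v by exact: derive_id.
  by rewrite -(derive_rV_coord _ d4) D4 subrr.
(* The [n] partial derivatives of each coordinate of [psi], bounded by [e], add up to at most
   [N / 2]. *)
pose e := N / 2 / n.+1%:R.
have e0 : 0 < e by rewrite !divr_gt0.
have : \forall u \near y, A u /\ forall j a, `|'D_(delta_mx 0 a) (psi j) u| <= e.
  apply: filterI; first exact: open_nbhs_nbhs.
  apply: (@filter_forall _ _ _ _ (nbhs_filter y)) => j.
  apply: (@filter_forall _ _ _ _ (nbhs_filter y)) => a.
  have c := smooth_continuous (smooth_partial a (spsi j)) Ay.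
  have : \forall u \near y, `|'D_(delta_mx 0 a) (psi j) y - 'D_(delta_mx 0 a) (psi j) u| <= e.
    exact: (cvgrPdist_le _ _).1 c _ e0.
  by apply: filterS => u; rewrite Dpsi sub0r normrN.
move/nbhs_normP => [d /= d0 Hd].
(* The point [v + s *: (u - v)] given by [mvt_line] has [s] between -1 and 1, so its distance to [y]
   is less than [d / 3] plus [2 * d / 3]. *)
exists (d / 3); first by rewrite divr_gt0.
move=> u v yu yv E; apply/eqP; rewrite -subr_eq0 -normr_le0.
have bound j : `|psi j (v + 1 *: (u - v)) - psi j v| <= N / 2 * `|u - v|.
  have seg s : `|s| <= `|1 : R| -> `|y - (v + s *: (u - v))| < d.
    rewrite normr1 => s1; rewrite opprD addrA.
    apply: (le_lt_trans (ler_normB _ _)); rewrite normrZ.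
    have h1 : `|u - v| < d / 3 + d / 3.
      by rewrite -(subrKA y); apply: (le_lt_trans (ler_normD _ _)); rewrite [`|u - y|]distrC; exact: ltrD.
    have h2 : `|s| * `|u - v| <= `|u - v| by rewrite ler_piMl.
    lra.
  have [s1|s s1 ->] := @mvt_line _ _ (psi j) v (u - v) 1.
    by move=> /seg/Hd[Az _]; exact: (smooth_derivable_dir oA (spsi j) Az).
  have [Az Hz] := Hd _ (seg s s1).
  rewrite mulr1 (smooth_derivative oA _ (spsi j) Az).
  apply: (le_trans (ler_norm_sum _ _ _)).
  apply: (@le_trans _ _ (\sum_(a < n) `|u - v| * e)).
    by apply: ler_sum => a _; rewrite normrM; apply: ler_pM => //; exact: rV_norm_coord.
  have en : e * n%:R <= N / 2.
    rewrite /e -mulrA ler_piMr//; first by rewrite divr_ge0// ltW.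
    by rewrite mulrC ler_pdivrMr// mul1r ler_nat.
  rewrite sumr_const card_ord -[leLHS]mulr_natr -mulrA [leRHS]mulrC.
  by apply: ler_wpM2l en; exact: normr_ge0.
have key : N * `|u - v| <= N / 2 * `|u - v|.
  rewrite -{1}(gtr0_norm N0) -normrZ; apply: rV_norm_le.
    by rewrite mulr_ge0// divr_ge0// ltW.
  move=> j; have Ej : psi j u - psi j v = - (N *: (u - v)) 0 j by rewrite /psi E !mxE; ring.
  by have := bound j; rewrite (_ : v + 1 *: (u - v) = u) ?Ej ?normrN// scale1r addrC subrK.
have := normr_ge0 (u - v); nra.
Qed.

End normed_closure.

(* Baire's theorem for a finite cover by relatively closed sets. *)
Lemma finite_cover_open (T : topologicalType) (I : eqType) (s : seq I) (C : I -> set T) (D N : set T) :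
  (forall i M, open M -> M `<=` D -> open (M `\` C i)) ->
  open N -> N !=set0 -> N `<=` D -> (forall x, N x -> exists2 i, i \in s & C i x) ->
  exists i O, [/\ open O, O !=set0, O `<=` N & O `<=` C i].
Proof.
move=> cC; elim: s N => [|i s IH] N oN [x Nx] ND cov; first by have [] := cov x Nx.
have [NC|/existsNP[y /not_implyP[Ny nCy]]] := pselect (forall y, N y -> C i y).
  by exists i, N; split => //; exists x.
have [| | |z [Nz nCz] |j [V [oV V0 NV CV] ] ] := IH (N `\` C i).
- exact: cC.
- by exists y.
- by move=> z [Nz _]; exact: ND.
- by have [j] := cov z Nz; rewrite in_cons => /orP[/eqP->|js] Cj; [|exists j].
- by exists j, V; split => // z /NV[].
Qed.

Arguments dom_open {R X} u.
Arguments dom_connected {R X} u.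

Section charts.
Context {R : realType} {X : topologicalType}.
Implicit Types c d e : uniformizing_chart R X.

Lemma actK c (g : grp c) x : dom c x -> act g^-1%g (act g x) = x.
Proof. by move=> dx; rewrite -actM// mulVg act1. Qed.

Lemma actKV c (g : grp c) x : dom c x -> act g (act g^-1%g x) = x.
Proof. by move=> dx; rewrite -actM// mulgV act1. Qed.

Lemma proj_act c (g : grp c) x : dom c x -> Defs.proj c (act g x) = Defs.proj c x.
Proof. by move=> dx; apply/esym/proj_fiber => //; [exact: act_dom|exists g]. Qed.

Lemma proj_orbit c x y : dom c x -> dom c y -> Defs.proj c x = Defs.proj c y -> exists g, y = act (u := c) g x.
Proof. by move=> dx dy /proj_fiber; apply. Qed.

Lemma act_image c (g : grp c) : act g @` dom c = dom c.
Proof.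
apply/seteqP; split => [_ [x dx <-]|x dx]; first exact: act_dom.
by exists (act g^-1%g x); [exact: act_dom|exact: actKV].
Qed.

(** Equivariance is with respect to conjugation by [g]. These embeddings serve to move the image of
    a point within its orbit. *)
Lemma act_embedding c (g : grp c) : chart_embedding (c := c) (d := c) (act g).
Proof.
split.
- split; first exact: act_smooth.
    by rewrite act_image; exact: dom_open.
  by exists (act g^-1%g); [rewrite act_image; exact: act_smooth|exact: actK].
- by move=> x; exact: act_dom.
- exists (fun h => g * h * g^-1)%g; split.
  + by move=> h1 h2 /mulIg /mulgI.
  + by move=> h1 h2; rewrite !mulgA mulgKV.
  + by move=> h x dx; rewrite -!actM ?mulgKV//; exact: act_dom.
- by move=> x; exact: proj_act.
Qed.

Lemma emb_comp c d e (l : 'rV[R]_(Defs.dim c) -> 'rV[R]_(Defs.dim d)) (m : 'rV[R]_(Defs.dim d) -> 'rV[R]_(Defs.dim e)) :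
  chart_embedding l -> chart_embedding m -> chart_embedding (c := c) (d := e) (m \o l).
Proof.
move=> [[sl ol [kl skl klK]] dl [tl [tli tlm tla]] pl] [[sm om [km skm kmK]] dm [tm [tmi tmm tma]] pm].
(* The image of the composite is a preimage under the smooth inverse [km], which gives its openness
   by continuity alone. *)
have img : (m \o l) @` dom c = (m @` dom d) `&` km @^-1` (l @` dom c).
  apply/seteqP; split => [_ [x dx <-] /=|y [[z dz <-]] [x dx]].
    by split; [exists (l x) => //; exact: dl|exists x => //; rewrite kmK//; exact: dl].
  by rewrite kmK// => <-; exists x.
have oi : open ((m \o l) @` dom c) by rewrite img; exact: open_smooth_preimage.
split.
- split => //; first exact: (smooth_comp_rV (dom_open c) (dom_open d) dl sl sm).
  exists (kl \o km).
    apply: (smooth_comp_rV oi ol _ _ skl).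
      by move=> _ [x dx <-] /=; rewrite kmK; [exists x|exact: dl].
    by apply: smooth_sub skm => _ [x dx <-]; exists (l x) => //; exact: dl.
  by move=> x dx /=; rewrite kmK ?klK//; exact: dl.
- by move=> x dx; exact/dm/dl.
- exists (tm \o tl); split.
  + by move=> g h /tmi/tli.
  + by move=> g h /=; rewrite tlm tmm.
  + by move=> g x dx /=; rewrite tla// tma//; exact: dl.
- by move=> x dx /=; rewrite pm ?pl//; exact: dl.
Qed.

(* The sum phi of the powers of act k satisfies phi (k x) = phi x, and is locally
   injective because its differential at y is the order of k times the
   identity. *)
Lemma act_near_id c (k : grp c) (y : 'rV[R]_(Defs.dim c)) :
  dom c y -> act k y = y -> (forall v, 'D_v (act k) y = v) -> \forall u \near y, act k u = u.
Proof.
move=> dy ky Dk.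
pose N := #[k]%g.
pose phi x := \sum_(j < N) act (k ^+ j)%g x : 'rV[R]_(Defs.dim c).
have oA := dom_open c.
have sphi : smooth (dom c) phi by apply: (smooth_sum oA) => j; exact: act_smooth.
have powE j x : dom c x -> act (k ^+ j.+1)%g x = act (k ^+ j)%g (act k x).
  by move=> dx; rewrite expgSr actM.
have Dpow j v : 'D_v (act (k ^+ j)%g) y = v.
  elim: j v => [|j IH] v.
    apply: near_derive_id; apply: filterS (open_nbhs_nbhs (conj oA dy)) => u du.
    by rewrite expg0 act1.
  transitivity ('D_v (act (k ^+ j)%g \o act k) y).
    by apply: near_eq_derive; apply: filterS (open_nbhs_nbhs (conj oA dy)) => u du; exact: powE.
  rewrite (derive_comp_rV _ oA oA (act_smooth k) (act_smooth (k ^+ j)%g) dy) ?ky ?Dk//.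
have Dphi v : 'D_v phi y = N%:R *: v.
  have d j : derivable (act (k ^+ j)%g) y v := smooth_rV_derivable oA (act_smooth (k ^+ j)%g) dy.
  rewrite (derivef_sum (fun j : 'I_N => d j)) (eq_bigr (fun=> v)) => [|j _]; last exact: Dpow.
  by rewrite sumr_const card_ord scaler_nat.
have phik x : dom c x -> phi (act k x) = phi x.
  move=> dx; rewrite /phi.
  under eq_bigr do rewrite -powE//.
  have N0 : (0 < N)%N by rewrite order_gt0.
  rewrite -(big_mkord xpredT (fun j => act (k ^+ j.+1)%g x)) -(big_mkord xpredT (fun j => act (k ^+ j)%g x)).
  apply/eqP; rewrite -subr_eq0 -sumrB telescope_sumr// expg_order expg0 subrr.
  exact/eqP.
have [|e e0 inj] := local_injective oA sphi dy _ Dphi; first by rewrite ltr0n order_gt0.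
have N1 : \forall u \near y, `|y - u| < e by apply/nbhs_normP; exists e.
have N2 : \forall u \near y, `|act k y - act k u| < e.
  have ck := smooth_continuous (act_smooth k) dy.
  by exact: (cvgrPdist_lt _ _).1 ck _ e0.
have N3 := open_nbhs_nbhs (conj oA dy).
near=> u; apply: inj.
- by rewrite -{1}ky; near: u.
- by near: u.
- by apply: phik; near: u.
Unshelve. all: by end_near. Qed.

(** The set [T] where [act k] agrees with the identity to first order is open by [act_near_id],
    relatively closed by continuity and nonempty. The chart being connected, [T] is all of it, and
    effectiveness concludes. *)
Lemma act_rigid c (k : grp c) (y : 'rV[R]_(Defs.dim c)) :
  dom c y -> act k y = y -> (forall v, 'D_v (act k) y = v) -> k = 1%g.
Proof.
move=> dy ky Dk; apply: act_effective.
pose T := [set y | dom c y /\ (act k y = y /\ forall v, 'D_v (act k) y = v)].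
suff TE : T = dom c by move=> x; rewrite -TE => -[_ []].
have oA := dom_open c.
apply: (dom_connected c).
- by exists y.
- exists T; last by apply/seteqP; split => [x Tx|x []//]; split => //; case: Tx.
  rewrite openE => x [dx [kx Dx]].
  have N1 := act_near_id dx kx Dx.
  have N2 : \forall u \near x, dom c u /\ \forall z \near u, act k z = z.
    by apply: filterI; [exact: (open_nbhs_nbhs (conj oA dx))|exact: near_join N1].
  apply: filterS N2 => u [du Nu]; split => //; split; first exact: (nbhs_singleton Nu).
  by move=> v; exact: near_derive_id.
- exists (closure T); first exact: closed_closure.
  apply/seteqP; split => [x Tx|x [dx cTx]].
    by split; [case: Tx|exact: subset_closure].
  split => //; split.
    apply: (closure_eq_limit cTx (F := act k) (G := id)).
    - exact: (smooth_continuous (act_smooth k) dx).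
    - exact: cvg_id.
    - by move=> u [_ []].
  move=> v; apply: (closure_eq_limit cTx (F := 'D_v (act k)) (G := cst v)).
  - exact: (smooth_continuous (smooth_rV_directional oA (act_smooth k) (smooth_cst v)) dx).
  - exact: cst_continuous.
  - by move=> u [_ [_]]; apply.
Qed.

Lemma act_rigid_near c (k : grp c) (y : 'rV[R]_(Defs.dim c)) :
  dom c y -> (\forall u \near y, act k u = u) -> k = 1%g.
Proof.
move=> dy kid; apply: (act_rigid dy); first exact: (nbhs_singleton kid).
by move=> v; exact: near_derive_id.
Qed.

(** * Points with trivial isotropy *)

Definition free_point c (x : 'rV[R]_(Defs.dim c)) := forall g, act (u := c) g x = x -> g = 1%g.

Definition displaced c (U : set 'rV[R]_(Defs.dim c)) :=
  [/\ open U, U `<=` dom c & forall g x, U x -> U (act (u := c) g x) -> g = 1%g].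

Lemma displaced_free c (U : set 'rV[R]_(Defs.dim c)) x : displaced U -> U x -> free_point x.
Proof. by move=> [_ _ H] Ux g gx; apply: (H g x) => //; rewrite gx. Qed.

Lemma displaced_inj c (U : set 'rV[R]_(Defs.dim c)) x y : displaced U -> U x -> U y ->
  Defs.proj c x = Defs.proj c y -> x = y.
Proof.
move=> [_ UD H] Ux Uy /(proj_orbit (UD _ Ux) (UD _ Uy)) [g yg].
have g1 : g = 1%g by apply: (H g x) => //; rewrite -yg.
by rewrite yg g1 act1//; exact: UD.
Qed.

(** For each [g] other than 1 take half the distance from [x] to [act g x]; finiteness of the group
    gives a common ball. If [y] and [act g y] were both in it, then [act g y] would be closer than
    that half to both [x] and [act g x]. *)
Lemma free_displaced c x : dom c x -> free_point x -> exists2 U : set 'rV[R]_(Defs.dim c), displaced U & U x.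
Proof.
move=> dx fx.
have oA := dom_open c.
have : \forall y \near x, forall g : grp c, g != 1%g -> `|x - y| < `|act g x - x| / 2 /\
    `|act g x - act g y| < `|act g x - x| / 2.
  apply: (@filter_forall _ _ _ _ (nbhs_filter x)) => g.
  have [->|g1] := eqVneq g 1%g; first by near=> y => /eqP.
  have e0 : 0 < `|act g x - x| / 2.
    rewrite divr_gt0// normr_gt0 subr_eq0; apply: contra g1 => /eqP/fx ->; exact: eqxx.
  have N1 : \forall y \near x, `|x - y| < `|act g x - x| / 2 by apply/nbhs_normP; eexists; first exact: e0.
  have N2 : \forall y \near x, `|act g x - act g y| < `|act g x - x| / 2.
    have ck := smooth_continuous (act_smooth g) dx.
    by exact: (cvgrPdist_lt _ _).1 ck _ e0.
  by apply: filterS2 N1 N2 => y h1 h2 _.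
move/nbhs_normP => [r /= r0 Hr].
exists (dom c `&` [set y | `|x - y| < r]); last by split => //=; rewrite subrr normr0.
split.
- apply: openI => //; rewrite (_ : [set _ | _] = ball x r); first exact: ball_open.
  by rewrite -ball_normE.
- by move=> y [].
- move=> g y [dy yr] [_ gyr]; apply/eqP/negPn/negP => g1.
  have [_ h2] := Hr _ yr g g1.
  have [h1 _] := Hr _ gyr g g1.
  have := ler_normD (act g x - act g y) (act g y - x).
  rewrite subrKA => h3; rewrite distrC in h1; lra.
Unshelve. all: by end_near. Qed.

End charts.

(** * Density of free points and uniqueness of embeddings up to the group *)

Section embeddings.
Context {R : realType} {X : topologicalType}.
Implicit Types c d e : uniformizing_chart R X.

(** Otherwise [N] is covered by the fixed-point sets of the elements other than 1. By Baire one of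
    these contains a nonempty open set, on which that element is the identity, against rigidity. *)
Lemma free_dense c (N : set 'rV[R]_(Defs.dim c)) :
  open N -> N !=set0 -> N `<=` dom c -> exists2 y, N y & free_point y.
Proof.
move=> oN N0 ND; apply: contrapT => H.
have [|||||g [V [oV [y Vy] VN VC]]] := @finite_cover_open _ (grp c) (enum (grp c))
   (fun g => [set x | dom c x /\ (g != 1%g /\ act g x = x)]) (dom c) N.
- move=> g M oM MD; rewrite openE => x [Mx nCx].
  have NM : \forall y \near x, M y := open_nbhs_nbhs (conj oM Mx).
  have dx := MD _ Mx.
  have [g1|g1] := eqVneq g 1%g.
    by apply: filterS NM => y My; split => // -[_ [/eqP]].
  have gx : 0 < `|act g x - x|.
    by rewrite normr_gt0 subr_eq0; apply/eqP => gx; apply: nCx.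
  have c1 := smooth_continuous (act_smooth g) dx.
  have e0 : 0 < `|act g x - x| / 2 by rewrite divr_gt0.
  have N1 : \forall y \near x, `|act g x - act g y| < `|act g x - x| / 2.
    by exact: (cvgrPdist_lt _ _).1 c1 _ e0.
  have N2 : \forall y \near x, `|x - y| < `|act g x - x| / 2.
    by apply/nbhs_normP; eexists; first exact: e0.
  apply: filterS3 NM N1 N2 => y My h1 h2; split => // -[_ [_ gy]].
  have := ler_normD (act g x - y) (y - x); rewrite subrKA; rewrite gy in h1.
  rewrite distrC in h2; lra.
- exact: oN.
- exact: N0.
- exact: ND.
- move=> x Nx; apply: contrapT => Hx; apply: H; exists x => // g gx.
  apply: contrapT => /eqP g1; apply: Hx; exists g; last by split => //; exact: ND.
  by rewrite mem_enum.
- have [dy [/eqP g1 _]] := VC y Vy.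
  apply: g1; apply: (act_rigid_near dy).
  by apply: filterS (open_nbhs_nbhs (conj oV Vy)) => u /VC[_ []].
Qed.

Lemma free_emb_inv c d (l : 'rV[R]_(Defs.dim c) -> 'rV[R]_(Defs.dim d)) w :
  chart_embedding l -> dom c w -> free_point (l w) -> free_point w.
Proof.
move=> [_ _ [th [thi _ tha]] _] dw fw g gw.
have th1 : th g = 1%g by apply: fw; rewrite -tha// gw.
have thone : th 1%g = 1%g by apply: fw; rewrite -tha// act1.
by apply: thi; rewrite thone.
Qed.

(* An element h fixing l w maps a neighbourhood of l w to the image of l, where it
   preserves the fibres of the projection; these meet l U once, so h is locally
   the identity. *)
Lemma free_emb c d (l : 'rV[R]_(Defs.dim c) -> 'rV[R]_(Defs.dim d)) w :
  chart_embedding l -> dom c w -> free_point w -> free_point (l w).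
Proof.
move=> emb dw fw h hlw; have := emb.
move=> [[sl ol [k sk kK]] dl [th [thi thm tha]] pl].
have [U [oU UD Uinj] Uw] := free_displaced dw fw.
have ilw : (l @` dom c) (l w) by exists w.
have dlw : dom d (l w) := dl _ dw.
have lk y : (l @` dom c) y -> l (k y) = y by move=> [x dx <-]; rewrite kK.
have dk y : (l @` dom c) y -> dom c (k y) by move=> [x dx <-]; rewrite kK.
apply: (act_rigid_near dlw).
have ch := smooth_continuous (act_smooth h) dlw.
have oV : open ((l @` dom c) `&` k @^-1` U) by exact: open_smooth_preimage.
have Vlw : ((l @` dom c) `&` k @^-1` U) (l w) by split => //=; rewrite kK.
have N1 : \forall y \near l w, ((l @` dom c) `&` k @^-1` U) (act h y).
  by apply: ch; rewrite hlw; exact: (open_nbhs_nbhs (conj oV Vlw)).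
apply: filterS2 N1 (open_nbhs_nbhs (conj oV Vlw)) => y [ihy Ukhy] [iy Uky].
have dy : dom d y by have [x dx <-] := iy; exact: dl.
have [g gE] : exists g, k (act h y) = act g (k y).
  apply: proj_orbit; [exact: dk|exact: dk|].
  by rewrite -!pl ?lk ?proj_act//; exact: dk.
have g1 : g = 1%g by apply: (Uinj g (k y)) => //; rewrite -gE.
by rewrite -[LHS]lk// gE g1 act1 ?lk//; exact: dk.
Qed.

(** The element [g^-1 * h] fixes [l x], and its differential composed with that of [l] is that of
    [l]. The latter is onto, so the differential of [g^-1 * h] is the identity and [act_rigid]
    applies. *)
Lemma emb_agree c d (l m : 'rV[R]_(Defs.dim c) -> 'rV[R]_(Defs.dim d)) (g h : grp d) x :
  chart_embedding l -> smooth (dom c) m -> dom c x ->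
  m x = act g (l x) -> (forall v, 'D_v m x = 'D_v (act g \o l) x) ->
  m x = act h (l x) -> (forall v, 'D_v m x = 'D_v (act h \o l) x) ->
  g = h.
Proof.
move=> [[sl ol [k sk kK]] dl _ _] sm dx mg Dg mh Dh.
have oc := dom_open c; have od := dom_open d.
have dlx := dl _ dx.
have sgl (g' : grp d) : smooth (dom c) (act g' \o l) := smooth_comp_rV oc od dl sl (act_smooth g').
have glx (g' : grp d) : dom d (act g' (l x)) by exact: act_dom.
have comp_inv (p q : grp d) v : 'D_v (act (p * q)%g \o l) x = 'D_('D_v (act q \o l) x) (act p) (act q (l x)).
  rewrite -(derive_comp_rV v oc od (sgl q) (act_smooth p) dx (glx q)).
  apply: near_eq_derive; apply: filterS (open_nbhs_nbhs (conj oc dx)) => y dy /=.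
  by rewrite actM//; exact: dl.
suff : (g^-1 * h = 1)%g by move=> gh; rewrite -[RHS](mulKVg g) gh mulg1.
apply: (act_rigid dlx); first by rewrite actM// -mh mg actK.
have Dk v : 'D_v (act (g^-1 * h)%g \o l) x = 'D_v l x.
  rewrite comp_inv -Dh Dg -mh mg -comp_inv.
  apply: near_eq_derive; apply: filterS (open_nbhs_nbhs (conj oc dx)) => y dy /=.
  by rewrite mulVg act1//; exact: dl.
have ilx : (l @` dom c) (l x) by exists x.
move=> v.
(* Surjectivity of the differential of [l], from its smooth inverse [k] on the open image. *)
have vE : v = 'D_('D_v k (l x)) l x.
  have kdom y : (l @` dom c) y -> dom c (k y) by move=> [z dz <-]; rewrite kK.
  have := derive_comp_rV v ol oc sk sl ilx (kdom _ ilx); rewrite kK// => <-.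
  apply/esym/near_derive_id; apply: filterS (open_nbhs_nbhs (conj ol ilx)) => y [z dz <-] /=.
  by rewrite kK.
rewrite {1}vE -(derive_comp_rV _ oc od sl (act_smooth _) dx dlx) Dk.
by rewrite -vE.
Qed.

(* Points of the chart are covered by the relatively closed sets where m = act g l
   to first order; they are pairwise disjoint by rigidity, so each is also open
   and the connected chart is one of them. *)
Lemma emb_unique c d (l m : 'rV[R]_(Defs.dim c) -> 'rV[R]_(Defs.dim d)) w :
  chart_embedding l -> chart_embedding m -> dom c w ->
  exists h, forall x, dom c x -> m x = act h (l x).
Proof.
move=> el em dw.
have [[sl _ _] dl _ pl] := el; have [[sm _ _] dm _ pm] := em.
have oc := dom_open c; have od := dom_open d.
have sgl (g : grp d) : smooth (dom c) (act g \o l) := smooth_comp_rV oc od dl sl (act_smooth g).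
pose C (g : grp d) := [set x | dom c x /\ m x = act g (l x)].
pose T (g : grp d) := [set x | dom c x /\ (m x = act g (l x) /\ forall v, 'D_v m x = 'D_v (act g \o l) x)].
have closureT (g : grp d) (S : set 'rV[R]_(Defs.dim c)) x : S `<=` T g -> dom c x -> closure S x -> T g x.
  move=> ST dx cS; split => //; split.
    apply: (closure_eq_limit cS (F := m) (G := act g \o l)).
    - exact: smooth_continuous sm dx.
    - exact: smooth_continuous (sgl g) dx.
    - by move=> u /ST[_ []].
  move=> v; apply: (closure_eq_limit cS (F := 'D_v m) (G := 'D_v (act g \o l))).
  - exact: (smooth_continuous (smooth_rV_directional oc sm (smooth_cst v)) dx).
  - exact: (smooth_continuous (smooth_rV_directional oc (sgl g) (smooth_cst v)) dx).
  - by move=> u /ST[_ []].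
have openC (g : grp d) M : open M -> M `<=` dom c -> open (M `\` C g).
  move=> oM MD; rewrite openE => x [Mx nCx].
  have NM : \forall y \near x, M y := open_nbhs_nbhs (conj oM Mx).
  have dx := MD _ Mx.
  have e0 : 0 < `|m x - act g (l x)| / 2.
    by rewrite divr_gt0// normr_gt0 subr_eq0; apply/eqP => E; apply: nCx.
  have c1 := smooth_continuous sm dx; have c2 := smooth_continuous (sgl g) dx.
  have N1 : \forall y \near x, `|m x - m y| < `|m x - act g (l x)| / 2.
    by exact: (cvgrPdist_lt _ _).1 c1 _ e0.
  have N2 : \forall y \near x, `|(act g \o l) x - (act g \o l) y| < `|m x - act g (l x)| / 2.
    by exact: (cvgrPdist_lt _ _).1 c2 _ e0.
  apply: filterS3 NM N1 N2 => y My h1 h2; split => // -[_ E].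
  have := ler_normD (m x - m y) (m y - act g (l x)); rewrite subrKA.
  rewrite {2}E [`|act g (l y) - _|]distrC; move: h2; rewrite /=; lra.
(* The sets [C g] of agreement at order zero cover the chart, since both embeddings have the same
   projection. By Baire, interior points of the [C g] accumulate at [x], and by finiteness those of
   a single [C g] do. There the agreement is of first order, and it passes to the limit. *)
have coverT x : dom c x -> exists g, T g x.
  move=> dx; apply: contrapT => H.
  have Hg (g : grp d) : \forall y \near x, ~ (exists O, [/\ open O, O y & O `<=` C g]).
    apply: contrapT => nH; apply: H; exists g.
    apply: (closureT g [set y | exists O, [/\ open O, O y & O `<=` C g]]) => //.
      move=> y [V [oV Vy VC]]; have [dy my] := VC _ Vy.
      split => //; split => // v; apply: near_eq_derive.
      by apply: filterS (open_nbhs_nbhs (conj oV Vy)) => u /VC[].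
    move=> B NB; apply: contrapT => BH; apply: nH.
    by apply: filterS NB => y By Oy; apply: BH; exists y.
  have /nbhs_interior := @filter_forall _ _ _ _ (nbhs_filter x) Hg.
  set N := interior _ => NN.
  have Nx : N x := nbhs_singleton NN.
  have oN : open (N `&` dom c) by apply: openI => //; exact: open_interior.
  have [||z [Nz dz]|g [V [oV [y Vy] VN VC]]] :=
      @finite_cover_open _ (grp d) (enum (grp d)) C (dom c) (N `&` dom c) openC oN.
  - by exists x.
  - by move=> z [].
  - have [g E] := proj_orbit (dl _ dz) (dm _ dz) (etrans (pl _ dz) (esym (pm _ dz))).
    by exists g => //; rewrite mem_enum.
  - have [Ny _] := VN _ Vy.
    by apply: (interior_subset Ny g); exists V.
have [h Thw] := coverT w dw.
exists h; suff TE : T h = dom c by move=> x; rewrite -TE => -[_ []].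
apply: (dom_connected c).
- by exists w.
- exists (T h); last by apply/seteqP; split => [x Tx|x []//]; split => //; case: Tx.
  rewrite openE => x Tx.
  have dx : dom c x by case: Tx.
  have Hg (g : grp d) : \forall y \near x, T g y -> g = h.
    have [->|gh] := eqVneq g h; first by near=> y.
    apply: contrapT => nH; move/eqP: gh; apply.
    have [_ [mg Dg]] : T g x.
      apply: (closureT g (T g)) => // B NB; apply: contrapT => BH; apply: nH.
      by apply: filterS NB => y By Ty; exfalso; apply: BH; exists y.
    have [_ [mh Dh]] := Tx.
    exact: emb_agree el sm dx mg Dg mh Dh.
  have N1 := @filter_forall _ _ _ _ (nbhs_filter x) Hg.
  apply: filterS2 N1 (open_nbhs_nbhs (conj oc dx)) => y Hy dy.
  by have [g Tg] := coverT y dy; rewrite -(Hy g Tg).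
- exists (closure (T h)); first exact: closed_closure.
  apply/seteqP; split => [x Tx|x [dx cTx]].
    by split; [case: Tx|exact: subset_closure].
  exact: (closureT h (T h)).
Unshelve. all: by end_near. Qed.

Lemma chart_proj_continuous c x : dom c x -> {for x, continuous (Defs.proj c)}.
Proof.
move=> dx W /nbhs_interior NW.
have oP : open (interior W `&` Defs.proj c @` dom c).
  by apply: openI; [exact: open_interior|exact: Defs.proj_open].
have sub : interior W `&` Defs.proj c @` dom c `<=` Defs.proj c @` dom c by move=> s [].
have oV := (proj_homeo (u := c) sub).1 oP.
have : nbhs x (dom c `&` Defs.proj c @^-1` (interior W `&` Defs.proj c @` dom c)).
  by apply: open_nbhs_nbhs; split => //; split => //; split; [exact: nbhs_singleton|exists x].
by apply: filterS => y [_ [/interior_subset]].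
Qed.

End embeddings.

(** [chart_overlap] only provides images in the orbits of [x] and [y]; composing the embeddings with
    group elements makes them hit [x] and [y] exactly. *)
Lemma common_refinement (R : realType) (O : orbifold R) (i j : atlas O) x y :
  Dom O i x -> Dom O j y -> Defs.proj (chart i) x = Defs.proj (chart j) y ->
  exists k a b w, [/\ Emb O k i a, Emb O k j b, Dom O k w, a w = x & b w = y].
Proof.
move=> dx dy xy.
have [||k [[w dw wp] [[a ea] [b eb]]]] := @chart_overlap _ O i j (Defs.proj (chart i) x).
- by exists x.
- by exists y.
have [_ da _ pa] := ea; have [_ db _ pb] := eb.
have [g gE] := proj_orbit (da _ dw) dx (etrans (pa _ dw) wp).
have [h hE] := proj_orbit (db _ dw) dy (etrans (pb _ dw) (etrans wp xy)).
exists k, (act g \o a), (act h \o b), w; split => //.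
- exact: (emb_comp ea (act_embedding g)).
- exact: (emb_comp eb (act_embedding h)).
Qed.

(** * Extension of functions and sections from a chart *)

Section orbifold_extension.
Context {R : realType} {O : orbifold R} {i : atlas O}.
Variables (U K : set 'rV[R]_(Defs.dim (@chart R O i))).
Hypothesis dU : displaced U.
Hypothesis KU : K `<=` U.
Hypothesis cK : compact K.

(** The Hausdorff property enters here. The complement of the projected support is open, and on it
    the extensions below are zero, hence smooth. *)
Lemma closed_proj_compact : closed (Defs.proj (chart i) @` K).
Proof.
apply: compact_closed; first exact: space_hausdorff.
apply: continuous_compact => //; apply: continuous_in_subspaceT => x /set_mem Kx.
by apply: chart_proj_continuous; have [_ UD _] := dU; exact/UD/KU.
Qed.

Lemma open_away_compact j : open (Dom O j `&` Defs.proj (chart j) @^-1` (~` (Defs.proj (chart i) @` K))).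
Proof.
have oW : open (~` (Defs.proj (chart i) @` K)) by apply: closed_openC; exact: closed_proj_compact.
rewrite openE => y [dy Wy]; apply: filterI; first exact: (open_nbhs_nbhs (conj (dom_open _) dy)).
exact: (chart_proj_continuous dy (open_nbhs_nbhs (conj oW Wy))).
Qed.

(* The junk value of [xget] makes this 0 at the points of X outside the image of U. *)
Definition extend (f0 : 'rV[R]_(Defs.dim (chart i)) -> R) j (y : 'rV[R]_(Defs.dim (@chart R O j))) : R :=
  xget 0 [set r | exists x, [/\ U x, Defs.proj (chart i) x = Defs.proj (chart j) y & r = f0 x]].

Lemma extendE f0 j x (y : 'rV[R]_(Defs.dim (@chart R O j))) : U x ->
  Defs.proj (chart i) x = Defs.proj (chart j) y -> extend f0 y = f0 x.
Proof.
move=> Ux xy; rewrite /extend; case: xgetP => [r _ [x' [Ux' xy' ->]]|/(_ (f0 x)) []].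
  by congr f0; apply: (displaced_inj dU) => //; rewrite xy xy'.
by exists x.
Qed.

Lemma extend0 f0 j (y : 'rV[R]_(Defs.dim (@chart R O j))) :
  (forall x, U x -> f0 x != 0 -> K x) -> ~ (Defs.proj (chart i) @` K) (Defs.proj (chart j) y) ->
  extend f0 y = 0.
Proof.
move=> fK nK; rewrite /extend; case: xgetP => // r _ [x [Ux xy ->]].
apply/eqP/negPn/negP => /(fK _ Ux) Kx; apply: nK; by exists x.
Qed.

(** Invariance and compatibility are immediate, as [extend] sees a point only through its
    projection. For smoothness, over [U] the extension is locally [f0 \o a \o kb], for embeddings
    [a], [b] of a common chart and the inverse [kb] of [b]; elsewhere it is locally zero. *)
Lemma extend_orbi f0 : smooth U f0 -> (forall x, U x -> f0 x != 0 -> K x) ->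
  orbi_function (fun j => @extend f0 j).
Proof.
have [oU UD _] := dU => sf fK; split.
- move=> j; apply: smooth_local => y dy.
  have [[x Ux xy]|nU] := pselect (exists2 x, U x & Defs.proj (chart i) x = Defs.proj (chart j) y).
    have [k [a [b [w [ea eb dw aw bw]]]]] := common_refinement (UD _ Ux) dy xy.
    have [[sa oa _] da _ pa] := ea; have [[sb ob [kb skb kbK]] db _ pb] := eb.
    have okU : open (Dom O k `&` a @^-1` U) := open_smooth_preimage (dom_open _) sa oU.
    have oV := open_smooth_preimage ob skb okU.
    exists (b @` Dom O k `&` kb @^-1` (Dom O k `&` a @^-1` U)).
      split; first by exists w.
      by rewrite -bw /= kbK//; split => //=; rewrite aw.
    have skb' := smooth_sub (@subIsetl _ _ (kb @^-1` (Dom O k `&` a @^-1` U))) skb.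
    have sakb : smooth (b @` Dom O k `&` kb @^-1` (Dom O k `&` a @^-1` U)) (a \o kb).
      by apply: (smooth_comp_rV oV (dom_open _) _ skb' sa) => z [_ []].
    have := smooth_comp oV oU _ sakb sf => H.
    apply: (eq_smooth oV _ (H _)) => [z [[v dv <-]] [_]|z [_ []] //].
    rewrite /= kbK// => Uav; apply/esym; apply: extendE => //.
    by rewrite pa ?pb.
  exists (Dom O j `&` Defs.proj (chart j) @^-1` (~` (Defs.proj (chart i) @` K))).
    by split => //= -[x /KU Ux xy]; apply: nU; exists x.
  apply: (eq_smooth (@open_away_compact j) _ (smooth_cst (0:R))) => z [_ nz].
  by rewrite (extend0 fK nz).
- by move=> j g x dx; rewrite /extend proj_act.
- by move=> j k l [_ _ _ pl] x dx; rewrite /extend pl.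
Qed.

End orbifold_extension.

(** * Comparison of fibres over different charts *)

Section transport.
Context {R : realType} {O : orbifold R} {L : orbi_line O}.

Lemma glue0 i j l x : Emb O i j l -> Dom O i x -> @Defs.glue R O L i j l x (l x) 0 = 0.
Proof.
move=> el dx; have [lin _ _ _] := glue_iso L el.
have := lin x dx 1 0 0; rewrite !scale1r addr0 -[LHS]addr0 => /addrI H.
by rewrite -H.
Qed.

Lemma glueZ i j l x (a : R[i]) v : Emb O i j l -> Dom O i x ->
  @Defs.glue R O L i j l x (l x) (a *: v) = a *: Defs.glue l (l x) v.
Proof.
move=> el dx; have [lin _ _ _] := glue_iso L el.
by have := lin x dx a v 0; rewrite (glue0 el dx) !addr0.
Qed.

Lemma glue_inj i j l x : Emb O i j l -> Dom O i x -> injective (@Defs.glue R O L i j l x (l x)).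
Proof. by move=> el dx; have [_ bij _ _] := glue_iso L el; exact: bij_inj (bij x dx). Qed.

Lemma glue_surj i j l x v : Emb O i j l -> Dom O i x -> exists u, @Defs.glue R O L i j l x (l x) u = v.
Proof.
by move=> el dx; have [_ bij _ _] := glue_iso L el; have [g _ gK] := bij x dx; exists (g v); exact: gK.
Qed.

Lemma glue_inj_at i j l x y : Emb O i j l -> Dom O i x -> y = l x ->
  injective (@Defs.glue R O L i j l x y).
Proof. by move=> el dx ->; exact: glue_inj. Qed.

(** Fibres over provably equal points are distinct types. Variables for the base points, tied by
    equations, allow these equations to be eliminated when needed and avoid explicit casts. *)
Lemma glue_cocycle_at i j k l m p x y z (v : fib (lb L i) x) : Emb O i j l -> Emb O j k m ->
  (forall x, Dom O i x -> p x = m (l x)) -> Dom O i x -> y = l x -> z = m y ->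
  @Defs.glue R O L i k p x z v = @Defs.glue R O L j k m y z (@Defs.glue R O L i j l x y v).
Proof. by move=> el em pE dx yE ->; case: _ / (esym yE); exact: glue_cocycle. Qed.

Lemma glue_act1 i x y (u : fib (lb L i) x) : Dom O i x -> y = x ->
  forall v : fib (lb L i) y, @Defs.glue R O L i i (act 1%g) y x v = @Defs.gact R O L i 1%g y x v.
Proof.
move=> dx -> v; have := @glue_act R O L i 1%g x dx v.
by case: _ / (esym (act1 dx)).
Qed.

(* u and v correspond to one another through some common chart k. *)
Definition transport i j x (u : fib (lb L i) x) y (v : fib (lb L j) y) : Prop :=
  exists k l m z (t : fib (lb L k) z),
    [/\ Emb O k i l, Emb O k j m, [/\ Dom O k z, x = l z & y = m z],
        u = @Defs.glue R O L k i l z x t & v = @Defs.glue R O L k j m z y t].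

Lemma transport_proj i j x (u : fib (lb L i) x) y (v : fib (lb L j) y) : transport u v ->
  Defs.proj (chart i) x = Defs.proj (chart j) y.
Proof.
move=> [k [l [m [z [t [[_ _ _ pl] [_ _ _ pm] [dz xz yz] _ _] ]]]]].
by rewrite xz yz pl ?pm.
Qed.

Lemma transport_exists i j x (u : fib (lb L i) x) y : Dom O i x -> Dom O j y ->
  Defs.proj (chart i) x = Defs.proj (chart j) y -> exists v : fib (lb L j) y, transport u v.
Proof.
move=> dx dy xy.
have [k [a [b [w [ea eb dw aw bw] ]]]] := common_refinement dx dy xy.
case: _ / aw u => u; case: _ / bw.
have [t tE] := glue_surj u ea dw.
by exists (Defs.glue b (b w) t), k, a, b, w, t.
Qed.

Lemma emb_agree_free i k (p q : 'rV[R]_(Defs.dim (@chart R O k)) -> 'rV[R]_(Defs.dim (@chart R O i))) w :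
  Emb O k i p -> Emb O k i q -> Dom O k w -> free_point (p w) -> q w = p w ->
  forall x, Dom O k x -> p x = q x.
Proof.
move=> ep eq dw fw qp.
have [h hE] := emb_unique ep eq dw.
have h1 : h = 1%g by apply: fw; rewrite -hE.
by move=> x dx; rewrite hE// h1 act1//; have [_ dp _ _] := ep; exact: dp.
Qed.

(** Refine the two intermediate charts by a third. At a free point, embeddings of that chart that
    agree at one point agree throughout, so the composites into each of [i] and [j] coincide, and
    the cocycle condition identifies first the two preimages of [u], then [v] and [v']. With
    isotropy the results could differ by its action on the fibre. *)
Lemma transport_unique i j x (u : fib (lb L i) x) y (v v' : fib (lb L j) y) :
  free_point x -> transport u v -> transport u v' -> v = v'.
Proof.
move=> fx [k [l [m [z [t [el em [dz xz yz] uE vE] ]]]]] [k' [l' [m' [z' [t' [el' em' [dz' xz' yz'] uE' vE'] ]]]]].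
have zz' : Defs.proj (chart k) z = Defs.proj (chart k') z'.
  have [_ _ _ pl] := el; have [_ _ _ pl'] := el'.
  by rewrite -pl// -pl'// -xz -xz'.
have [k'' [a [b [w [ea eb dw aw bw] ]]]] := common_refinement dz dz' zz'.
have fz : free_point z by apply: (free_emb_inv el dz); rewrite -xz.
have fy : free_point y by rewrite yz; exact: free_emb.
case: _ / aw t xz yz uE vE fz dz zz' => t xz yz uE vE fz dz zz'.
case: _ / bw t' xz' yz' uE' vE' dz' zz' => t' xz' yz' uE' vE' dz' _.
have [tau tauE] := glue_surj t ea dw; have [tau' tauE'] := glue_surj t' eb dw.
have ela := emb_comp ea el; have ema := emb_comp ea em.
have elb := emb_comp eb el'; have emb := emb_comp eb em'.
have lab : forall x, Dom O k'' x -> (l \o a) x = l' (b x).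
  apply: (emb_agree_free ela elb dw); first by rewrite /= -xz.
  by rewrite /= -xz -xz'.
have mab : forall x, Dom O k'' x -> (m \o a) x = m' (b x).
  apply: (emb_agree_free ema emb dw); first by rewrite /= -yz.
  by rewrite /= -yz -yz'.
have tt : tau = tau'.
  apply: (glue_inj_at ela dw xz).
  rewrite (glue_cocycle_at tau ea el (fun x dx => erefl ((l \o a) x)) dw erefl xz) tauE -uE uE'.
  by rewrite (glue_cocycle_at tau' eb el' lab dw erefl xz') tauE'.
rewrite vE vE' -tauE -tauE' -tt.
rewrite -(glue_cocycle_at tau ea em (fun x dx => erefl ((m \o a) x)) dw erefl yz).
by rewrite -(glue_cocycle_at tau eb em' mab dw erefl yz').
Qed.

Lemma transport_comp i j j' x (u : fib (lb L i) x) y (v : fib (lb L j) y) n :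
  transport u v -> Emb O j j' n -> transport u (@Defs.glue R O L j j' n y (n y) v).
Proof.
move=> [k [l [m [z [t [el em [dz xz yz] uE vE] ]]]]] en.
exists k, l, (n \o m), z, t; split => //.
- exact: (emb_comp em en).
- by split => //=; rewrite yz.
- by rewrite vE (glue_cocycle_at t em en (fun x dx => erefl ((n \o m) x)) dz yz erefl).
Qed.

(** The identity is taken as [act 1], whose gluing map is known through [glue_act] and [gact1]. *)
Lemma transport_refl i x (u : fib (lb L i) x) : Dom O i x -> transport u u.
Proof.
move=> dx.
exists i, (act 1%g), (act 1%g), x, u.
have gu : u = @Defs.glue R O L i i (act 1%g) x x u.
  by rewrite (glue_act1 u dx erefl) gact1.
split => //; try exact: act_embedding.
by rewrite act1.
Qed.

End transport.

(** * Extension of a local section by zero *)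

Section section_extension.
Context {R : realType} {O : orbifold R} {L : orbi_line O} {i : atlas O}.
Variables (U K : set 'rV[R]_(Defs.dim (@chart R O i))).
Hypothesis dU : displaced U.
Hypothesis KU : K `<=` U.
Hypothesis cK : compact K.
Variables (t0 : triv (lb L i)) (chi : 'rV[R]_(Defs.dim (@chart R O i)) -> R).
Hypothesis Ut0 : U `<=` tdom t0.
Hypothesis schi : smooth U chi.
Hypothesis chiK : forall x, U x -> chi x != 0 -> K x.

Definition local_section x : fib (lb L i) x := (chi x)%:C%C *: frame t0 x.

Definition extend_section j (y : 'rV[R]_(Defs.dim (@chart R O j))) : fib (lb L j) y :=
  xget 0 [set v | exists x, U x /\ transport (local_section x) v].

Lemma extend_sectionE j x y (v : fib (lb L j) y) : U x ->
  transport (local_section x) v -> extend_section y = v.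
Proof.
move=> Ux tv; rewrite /extend_section; case: xgetP => [v' _ [x' [Ux' tv']]|/(_ v) []]; last by exists x.
have E : x' = x by apply: (displaced_inj dU) => //; rewrite (transport_proj tv) (transport_proj tv').
case: _ / (esym E) tv' Ux' => tv' _.
exact: transport_unique (displaced_free dU Ux) tv' tv.
Qed.

Lemma extend_section0 j y :
  ~ (Defs.proj (chart i) @` K) (Defs.proj (chart j) y) -> extend_section y = 0.
Proof.
move=> nK; rewrite /extend_section; case: xgetP => // v _ [x [Ux tv]].
have chi0 : chi x = 0.
  apply/eqP/negPn/negP => /(chiK Ux) Kx; apply: nK; exists x => //; exact: transport_proj tv.
move: tv => [k [l [m [z [t [el em [dz xz yz] uE vE] ]]]]].
have t_0 : t = 0.
  apply: (glue_inj el dz); rewrite (glue0 el dz).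
  by case: _ / xz uE => <-; rewrite /local_section chi0 scale0r.
by rewrite vE t_0; case: _ / (esym yz); exact: glue0.
Qed.

Lemma extend_section_glue j j' l y : Emb O j j' l -> Dom O j y ->
  extend_section (l y) = Defs.glue l (l y) (extend_section y).
Proof.
move=> el dy; have [_ UD _] := dU; have [_ dl _ pl] := el.
have [[x Ux xy]|nU] := pselect (exists2 x, U x & Defs.proj (chart i) x = Defs.proj (chart j) y).
  have [v tv] := transport_exists (local_section x) (UD _ Ux) dy xy.
  rewrite (extend_sectionE Ux tv); apply: (extend_sectionE Ux).
  exact: transport_comp.
have nK : ~ (Defs.proj (chart i) @` K) (Defs.proj (chart j) y).
  by move=> [x /KU Ux xy]; apply: nU; exists x.
by rewrite (extend_section0 nK) extend_section0 ?pl// (glue0 el dy).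
Qed.

Lemma extend_section_smooth j : smooth_section (fun y => @extend_section j y).
Proof.
have [oU UD _] := dU.
apply: smooth_section_local => y dy.
have [tj tjy] := tdom_cover (lb L j) dy.
have [[x Ux xy]|nU] := pselect (exists2 x, U x & Defs.proj (chart i) x = Defs.proj (chart j) y); last first.
  exists tj, (Dom O j `&` Defs.proj (chart j) @^-1` (~` (Defs.proj (chart i) @` K))), (fun=> 0).
  split => //.
  - exact: (open_away_compact dU KU cK).
  - by split => //= -[x /KU Ux xy]; apply: nU; exists x.
  - exact: csmooth_cst.
  - by move=> z [_ nz] _; rewrite scale0r extend_section0.
have [k [a [b [w [ea eb dw aw bw] ]]]] := common_refinement (UD _ Ux) dy xy.
have [[sa oa _] da _ pa] := ea; have [[sb ob [kb skb kbK]] db _ pb] := eb.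
have [tk tkw] := tdom_cover (lb L k) dw.
have [_ _ _ /(_ tk t0) [ca sca Hca]] := glue_iso L ea.
have [_ _ _ /(_ tk tj) [cb scb Hcb]] := glue_iso L eb.
pose N := (Dom O k `&` a @^-1` U) `&` ((Dom O k `&` b @^-1` (tdom tj)) `&` tdom tk).
have oN : open N.
  apply: openI; first exact: (open_smooth_preimage (dom_open _) sa oU).
  apply: openI; last exact: tdom_open.
  exact: (open_smooth_preimage (dom_open _) sb (tdom_open (t := tj))).
have oV := open_smooth_preimage ob skb oN.
have ca0 z : N z -> ca z != 0.
  move=> [[dz Uz] [_ tz]]; apply/eqP => c0.
  have [/eqP fr0 _] := frame_basis tz; apply: fr0; apply: (glue_inj ea dz).
  by rewrite (glue0 ea dz) Hca ?c0 ?scale0r//; exact: Ut0.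
(* On the common chart, gluing along [a] sends the frame [tk] to [ca] times [t0] and gluing along
   [b] sends it to [cb] times [tj]. Hence [chi] times the frame [t0] is carried to [chi / ca * cb]
   times the frame [tj]. *)
have sN : csmooth N (fun z => (chi (a z))%:C%C / ca z * cb z).
  apply: (csmoothM oN).
    apply: (csmoothM oN).
      apply: csmooth_real; apply: (smooth_comp oN oU _ _ schi); first by move=> z [[]].
      by apply: smooth_sub sa => z [[]].
    apply: (csmoothV oN ca0); apply: csmooth_sub sca => z [[dz Uz] [_ tz]].
    by split => //; exact: Ut0.
  by apply: csmooth_sub scb => z [_ [[_ tz] tkz]].
exists tj, (b @` Dom O k `&` kb @^-1` N), (fun y => (chi (a (kb y)))%:C%C / ca (kb y) * cb (kb y)).
split => //.
- split; first by exists w.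
  by rewrite -bw /= kbK//; split; [split => //=; rewrite aw|split => //; split => //=; rewrite bw].
- apply: (csmooth_comp oV oN _ _ sN); first by move=> z [].
  by apply: smooth_sub skb => z [].
- move=> _ [[z dz <-]] []; rewrite /= kbK// => -[dz' Uz] -[btj tkz] tz.
  have Nz : N z by [].
  apply: (extend_sectionE Uz).
  exists k, a, b, z, (((chi (a z))%:C%C / ca z) *: frame tk z); split => //.
    rewrite (glueZ _ _ ea dz) Hca//; last exact: Ut0.
    by rewrite scalerA divfK// ca0.
  by rewrite (glueZ _ _ eb dz) Hcb// scalerA.
Qed.

(** Equivariance is a case of compatibility with embeddings, namely with [act g], whose gluing map
    is the action by [glue_act]. *)
Lemma extend_section_orbi : orbi_section (fun j y => @extend_section j y).
Proof.
split.
- exact: extend_section_smooth.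
- move=> j g y dy.
  by rewrite (extend_section_glue (act_embedding g) dy) glue_act.
- by move=> j j' l el y dy; exact: extend_section_glue.
Qed.

Lemma extend_section_local x : U x -> extend_section x = local_section x.
Proof.
by move=> Ux; apply: (extend_sectionE Ux); apply: transport_refl; have [_ UD _] := dU; exact: UD.
Qed.

End section_extension.

(** * The curvature condition *)

Section curvature_sections.
Context {R : realType} {n : nat} {A : set 'rV[R]_n} (oA : open A).
Context {E : hermitian_line A} {D : connection E}.

Lemma smooth_sectionB (s t : forall x, fib E x) : smooth_section s -> smooth_section t ->
  smooth_section (fun x => s x - t x).
Proof.
move=> ss st; apply: eq_smooth_section (smooth_sectionD ss (smooth_sectionZ (csmooth_cst (-1)) st)) => x _.
by rewrite scaleN1r.
Qed.

Lemma smooth_section_curvature Y Z (s : forall x, fib E x) : smooth A Y -> smooth A Z ->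
  smooth_section s -> smooth_section (curvature D Y Z s).
Proof.
move=> sY sZ ss.
have h1 := nab_smooth D sY (nab_smooth D sZ ss).
have h2 := nab_smooth D sZ (nab_smooth D sY ss).
have h3 := nab_smooth D (smooth_lie_bracket oA sY sZ) ss.
exact: (smooth_sectionB (smooth_sectionB h1 h2) h3).
Qed.

Lemma eq_curvature_section Y Z (s t : forall x, fib E x) x : smooth A Y -> smooth A Z ->
  smooth_section s -> (forall x, A x -> s x = t x) -> A x ->
  curvature D Y Z s x = curvature D Y Z t x.
Proof.
move=> sY sZ ss st Ax.
have eqD Y' : smooth A Y' -> forall y, A y -> D Y' s y = D Y' t y.
  by move=> sY' y Ay; exact: eq_nab_section.
rewrite /curvature (eqD _ (smooth_lie_bracket oA sY sZ) x Ax).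
rewrite (eq_nab_section oA sY (eqD _ sZ) (nab_smooth D sZ ss) Ax).
by rewrite (eq_nab_section oA sZ (eqD _ sY) (nab_smooth D sY ss) Ax).
Qed.

End curvature_sections.

(** The function vanishes at [y] so that multiplying it by a cutoff equal to 1 at [y] leaves its
    differential there unchanged. *)
Lemma directional_functional (R : realType) (n : nat) (y : 'rV[R]_n) (c : 'I_n -> R) :
  exists l : 'rV[R]_n -> R, [/\ smooth setT l, l y = 0 & forall v, 'D_v l y = \sum_b c b * v 0 b].
Proof.
have oT : open [set: 'rV[R]_n] := openT.
have sc b : smooth [set: 'rV[R]_n] (fun z : 'rV[R]_n => z 0 b - y 0 b).
  by apply: (smoothB oT); [exact: (smooth_coord oT b smooth_id)|exact: smooth_cst].
exists (fun z => \sum_b c b * (z 0 b - y 0 b)); split.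
- by apply: (smooth_sum oT) => b; apply: (smoothM oT); [exact: smooth_cst|exact: sc].
- by rewrite big1// => b _; rewrite subrr mulr0.
- move=> v.
  have db b : derivable (fun z : 'rV[R]_n => z 0 b - y 0 b) y v := smooth_derivable_dir oT (sc b) I.
  rewrite derivef_sum; last by move=> b; exact: (derivableM (derivable_cst (c b) y v) (db b)).
  apply: eq_bigr => b _.
  rewrite (derivefM (derivable_cst (c b) y v) (db b)) derive_cst mul0r add0r; congr (_ * _).
  have d1 : derivable (fun z : 'rV[R]_n => z 0 b) y v := smooth_derivable_dir oT (smooth_coord oT b smooth_id) I.
  rewrite [LHS](deriveB d1 (derivable_cst (y 0 b) y v)) derive_cst subr0.
  have d4 : derivable (fun x : 'rV[R]_n => x) y v by exact: derivable_id.
  have D4 : 'D_v (fun x : 'rV[R]_n => x) y = v by exact: derive_id.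
  by rewrite -(derive_rV_coord _ d4) D4.
Qed.

Lemma compact_box (R : realType) (n : nat) (y : 'rV[R]_n) (r : R) : compact [set z | `|y - z| <= r].
Proof.
have [r0|r0] := ltP r 0.
  have -> : [set z | `|y - z| <= r] = set0; last exact: compact0.
  by apply/seteqP; split => // z /= h; have := normr_ge0 (y - z); lra.
have -> : [set z | `|y - z| <= r] = [set z | forall j, `[y 0 j - r, y 0 j + r]%classic (z 0 j)]; last first.
  by apply: (@rV_compact _ _ (fun j => `[y 0 j - r, y 0 j + r]%classic)) => j; exact: segment_compact.
apply/seteqP; split => z /=.
  move=> h j; rewrite in_itv /=; have := le_trans (rV_norm_coord (y - z) j) h.
  by rewrite !mxE ler_norml => /andP[? ?]; apply/andP; split; lra.
move=> h; apply: rV_norm_le => // j; have := h j; rewrite in_itv /= => /andP[? ?].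
by rewrite !mxE ler_norml; apply/andP; split; lra.
Qed.

Lemma displacedI (R : realType) (X : topologicalType) (c : uniformizing_chart R X) (U V : set 'rV[R]_(Defs.dim c)) :
  displaced U -> open V -> displaced (U `&` V).
Proof.
move=> [oU UD H] oV; split; first exact: openI.
  by move=> x [/UD].
by move=> g x [Ux _] [Ugx _]; exact: (H g x).
Qed.

(** * From the commutation relation to the curvature *)

Section prequantization.
Context {R : realType} {X : orbifold R} (w : symplectic_form X).
Context {hbar : R} (hbar_gt0 : 0 < hbar) {L : orbi_line X} (D : orbi_connection L).

Let k : R[i] := ('i%C * hbar%:C%C).
Let h : R[i] := ('i%C / hbar%:C%C).

Lemma hbar_neq0 : hbar%:C%C != 0 :> R[i].
Proof. by rewrite eq_complex /= eqxx andbT gt_eqF. Qed.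

Lemma planck_inverse : k * h = -1.
Proof.
have ii : ('i%C : R[i]) * 'i%C = -1.
  by apply/eqP; rewrite eq_complex /= !mulr0 !mul0r mul1r sub0r addr0 oppr0 !eqxx.
by rewrite /k /h mulrACA divff ?mulr1// hbar_neq0.
Qed.

Lemma omega_lin i x : Dom X i x -> forall (a : R) u v t,
  w i x (a *: u + v) t = a * w i x u t + w i x v t.
Proof. by have [H _ _ _ _] := omega_2form w; exact: H. Qed.

Lemma omega_anti i x : Dom X i x -> forall u v, w i x u v = - w i x v u.
Proof. by have [_ H _ _ _] := omega_2form w; exact: H. Qed.

Lemma omega_smooth i u v : smooth (Dom X i) (fun x => w i x u v).
Proof. by have [_ _ H _ _] := omega_2form w; exact: H. Qed.

Lemma commutator_formula f g s i x : orbi_function f -> orbi_function g -> orbi_section s -> Dom X i x ->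
  let Q := prequantum w D hbar in
  Q f (Q g s) i x - Q g (Q f s) i x = k *: Q (poisson w f g) s i x
    + k ^+ 2 *: (curvature (D i) (hamiltonian_vf w f (i := i)) (hamiltonian_vf w g (i := i)) (s i) x
                 - (- h * (w i x (hamiltonian_vf w f x) (hamiltonian_vf w g x))%:C%C) *: s i x).
Proof.
move=> [sf _ _] [sg _ _] [ss _ _] dx Q.
exact: (preq_commutator (dom_open _) (@omega_lin i) (@omega_anti i) (@omega_smooth i)
  (@omega_closed _ _ w i) (@omega_nondegenerate _ _ w i) planck_inverse (sf i) (sg i) (ss i) dx).
Qed.

(** Since [w (X_f) v = - 'D_v f], the differential of [f] at [y] has to be [- w u]. A function with
    this differential is cut off by [chi] and extended to the orbifold. *)
Lemma exists_hamiltonian i (U K : set 'rV[R]_(Defs.dim (@chart R X i)))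
    (y u : 'rV[R]_(Defs.dim (@chart R X i))) (chi : 'rV[R]_(Defs.dim (@chart R X i)) -> R) :
  displaced U -> K `<=` U -> compact K -> U y -> smooth setT chi -> chi y = 1 ->
  (forall z, chi z != 0 -> K z) ->
  exists2 f, orbi_function f & hamiltonian_vf w f y = u.
Proof.
move=> dU KU cK Uy schi chiy chiK; have [oU UD _] := dU; have dy := UD _ Uy.
have [l [sl ly Dl]] := directional_functional y (fun b => - w i y u (delta_mx 0 b)).
have sf0 : smooth setT (fun z => chi z * l z) := smoothM openT schi sl.
have of0 : orbi_function (fun j => @extend _ _ i U (fun z => chi z * l z) j).
  apply: (extend_orbi dU KU cK); first exact: smooth_sub sf0.
  by move=> z _; rewrite mulf_eq0 negb_or => /andP[/chiK].
exists (fun j => @extend _ _ i U (fun z => chi z * l z) j) => //.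
have [sf _ _] := of0.
apply: (form_inj (@omega_lin i) (@omega_nondegenerate _ _ w i) dy) => v.
rewrite [LHS](hamP (dom_open _) (@omega_lin i) (@omega_anti i) (@omega_nondegenerate _ _ w i) v (sf i) dy).
have -> : 'D_v (@extend _ _ i U (fun z => chi z * l z) i) y = 'D_v (fun z => chi z * l z) y.
  apply: near_eq_derive; apply: filterS (open_nbhs_nbhs (conj oU Uy)) => z Uz.
  exact: (extendE dU).
have d1 : derivable chi y v := smooth_derivable_dir openT schi I.
have d2 : derivable l y v := smooth_derivable_dir openT sl I.
rewrite (derivefM d1 d2) ly mulr0 add0r chiy mul1r Dl -sumrN.
rewrite (omega_anti dy) (form_coordl (@omega_lin i) v u dy) -sumrN; apply: eq_bigr => b _.
by rewrite mulNr opprK mulrC (omega_anti dy) mulrN.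
Qed.

Hypothesis commutator : let Q := prequantum w D hbar in
  forall f g, orbi_function f -> orbi_function g ->
     forall s, orbi_section s -> forall i x, Dom X i x ->
       Q f (Q g s) i x - Q g (Q f s) i x = k *: Q (poisson w f g) s i x.

(* The global section extending chi times a frame is not the given s, but
   chi^2 s = (chi c) (chi frame) near y, where s = c frame. *)
Lemma curvature_at_free i Y Z s y : smooth (Dom X i) Y -> smooth (Dom X i) Z -> smooth_section s ->
  Dom X i y -> free_point y ->
  curvature (D i) Y Z s y = (- h * (w i y (Y y) (Z y))%:C%C) *: s y.
Proof.
move=> sY sZ ss dy fy.
have od := dom_open (chart i).
have [t ty] := tdom_cover (lb L i) dy.
have [U0 dU0 U0y] := free_displaced dy fy.
have dU := displacedI dU0 (tdom_open (t := t)).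
set U := U0 `&` tdom t in dU.
have Uy : U y by [].
have [oU UD _] := dU.
have /nbhs_normP[r0 /= r00 Hr0] := open_nbhs_nbhs (conj oU Uy).
(* Halving leaves the closed box [K] inside the open ball of radius [r0], hence inside [U]. *)
pose r := r0 / 2.
have r_gt0 : 0 < r by rewrite divr_gt0.
pose K := [set z | `|y - z| <= r].
have KU : K `<=` U.
  by move=> z /= Kz; apply: Hr0 => /=; apply: (le_lt_trans Kz); rewrite /r; lra.
have cK : compact K by exact: compact_box.
have clK : closed K by apply: compact_closed => //; exact: norm_hausdorff.
have [chi [schi chiy chiK]] := smooth_bump y r_gt0.
have [f of_ fE] := exists_hamiltonian (Y y) dU KU cK Uy schi chiy chiK.
have [g og gE] := exists_hamiltonian (Z y) dU KU cK Uy schi chiy chiK.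
have schiU : smooth U chi := smooth_sub (@subsetT _ _) schi.
have Ut : U `<=` tdom t by move=> z [].
have chiK' z : U z -> chi z != 0 -> K z by move=> _; exact: chiK.
have os := extend_section_orbi dU KU cK Ut schiU chiK'.
have s1E z : U z -> extend_section U t chi z = local_section t chi z.
  exact: extend_section_local.
set s1 := (fun j z => extend_section U t chi z) in os.
have [ss1 _ _] := os.
have curv1 : curvature (D i) (fun=> Y y) (fun=> Z y) (s1 i) y = (- h * (w i y (Y y) (Z y))%:C%C) *: s1 i y.
  (* Against the assumed relation, only [k ^+ 2] times the curvature defect on [s1] survives, and
     [k] is nonzero. *)
  have := commutator_formula of_ og os dy; rewrite /= (commutator of_ og os dy) => /eqP.
  rewrite -subr_eq0 opprD addrA subrr sub0r oppr_eq0 scaler_eq0 expf_eq0 /=.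
  have /negPf -> : k != 0 by rewrite mulf_eq0 negb_or hbar_neq0 andbT eq_complex /= negb_and oner_eq0 orbT.
  rewrite subr_eq0 fE gE => /eqP <-.
  have [sf _ _] := of_; have [sg _ _] := og.
  have sX f' : smooth (Dom X i) (f' i) -> smooth (Dom X i) (hamiltonian_vf w f' (i := i)).
    exact: (smooth_ham od (@omega_lin i) (@omega_anti i) (@omega_smooth i) (@omega_nondegenerate _ _ w i)).
  have E := curvature_pointwise od (sX f (sf i)) (sX g (sg i)) (ss1 i) dy (D := D i).
  by rewrite fE gE in E; exact: esym E.
have [c sc Hc] := ss t.
(* The coefficient [c] is controlled only on [tdom t], so [chi] times [c] is set to 0 outside [U].
   It is smooth on [U] and on the complement of the closed set [K], and these two cover the
   chart. *)
pose p z : R[i] := if `[<U z>] then (chi z)%:C%C * c z else 0.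
have pin z : U z -> p z = (chi z)%:C%C * c z by rewrite /p => Uz; case: asboolP.
have pout z : ~ K z -> p z = 0.
  rewrite /p => nK; case: asboolP => // Uz.
  have -> : chi z = 0 by apply/eqP/negPn/negP => /chiK.
  by rewrite mul0r.
have sp : csmooth (Dom X i) p.
  apply: csmooth_local => z dz; have [Uz|nUz] := pselect (U z).
    exists U; first exact: Uz.
    apply: (eq_csmooth oU (f := fun z => (chi z)%:C%C * c z)) => [z' Uz'|]; first exact: esym (pin z' Uz').
    exact: (csmoothM oU (csmooth_real schiU) (csmooth_sub Ut sc)).
  exists (~` K); first by move=> /KU.
  apply: (eq_csmooth (closed_openC clK) (f := fun=> 0)) => [z' nK|]; first exact: esym (pout z' nK).
  exact: csmooth_cst.
have sq : csmooth (Dom X i) (fun z => (chi z)%:C%C * (chi z)%:C%C).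
  have schiD := csmooth_real (smooth_sub (@subsetT _ (Dom X i)) schi).
  exact: (csmoothM od schiD schiD).
have E z : Dom X i z -> ((chi z)%:C%C * (chi z)%:C%C) *: s z = p z *: s1 i z.
  move=> dz; have [Uz|nUz] := pselect (U z).
    by rewrite /s1 s1E// /local_section Hc ?pin//; [rewrite !scalerA mulrAC|exact: Ut].
  rewrite pout; last by move=> /KU.
  have -> : chi z = 0 by apply/eqP/negPn/negP => /chiK/KU.
  by rewrite mul0r !scale0r.
have scst (v : 'rV[R]_(Defs.dim (chart i))) : smooth (Dom X i) (fun=> v) by exact: smooth_cst.
(* The curvature is applied to both sides of [E] and the scalar factors are pulled out. As
   [chi y = 1], the identity [E] at [y] reads [s y = p y *: s1 i y], which turns the result for [s1]
   into the one for [s]. *)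
have := eq_curvature_section od (scst (Y y)) (scst (Z y)) (smooth_sectionZ sq ss) E dy (D := D i).
rewrite (curvature_sectionZ od sq (scst _) (scst _) ss dy).
rewrite (curvature_sectionZ od sp (scst _) (scst _) (ss1 i) dy) curv1.
rewrite -(curvature_pointwise od sY sZ ss dy) chiy mulr1 scale1r => ->.
have := E y dy; rewrite chiy mulr1 scale1r => ->.
rewrite !scalerA; congr (_ *: _); exact: mulrC.
Qed.

Lemma curvature_everywhere i Y Z s x : smooth (Dom X i) Y -> smooth (Dom X i) Z -> smooth_section s ->
  Dom X i x -> curvature (D i) Y Z s x = (- h * (w i x (Y x) (Z x))%:C%C) *: s x.
Proof.
move=> sY sZ ss dx.
have od := dom_open (chart i).
have sw := smooth_form od (@omega_lin i) (@omega_anti i) (@omega_smooth i) sY sZ.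
have sc : csmooth (Dom X i) (fun y => - h * (w i y (Y y) (Z y))%:C%C).
  exact: (csmoothM od (csmooth_cst _) (csmooth_real sw)).
(* The fibres at different points are not comparable, so continuity is used on the coefficient [c],
   in a local frame, of the difference of the two sides. *)
have sS := smooth_sectionB (smooth_section_curvature od sY sZ ss (D := D i)) (smooth_sectionZ sc ss).
have [t tx] := tdom_cover (lb L i) dx.
have [c [sc1 sc2] Hc] := sS t.
have ot : open (tdom t) := tdom_open (t := t).
pose T := [set y | tdom t y /\ free_point y].
have cT : closure T x.
  move=> B /nbhs_interior NB.
  have oN : open (interior B `&` tdom t) by apply: openI => //; exact: open_interior.
  have [|y [By ty] fy] := free_dense oN _ (fun z Hz => tdom_sub (proj2 Hz)).
    by exists x; split => //; exact: nbhs_singleton.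
  by exists y; split => //; exact: interior_subset.
have c0 y : T y -> c y = 0.
  move=> [ty fy]; have dy := tdom_sub ty.
  apply: (frame_coef_inj ty); rewrite scale0r -Hc//.
  by rewrite (curvature_at_free sY sZ ss dy fy) subrr.
have cx : c x = 0.
  apply/eqP; rewrite eq_complex /=; apply/andP; split; apply/eqP.
    apply: (closure_eq_limit cT (F := fun y => complex.Re (c y)) (G := cst 0)).
    - exact: (smooth_continuous sc1 tx).
    - exact: cst_continuous.
    - by move=> y /c0 ->.
  apply: (closure_eq_limit cT (F := fun y => complex.Im (c y)) (G := cst 0)).
  - exact: (smooth_continuous sc2 tx).
  - exact: cst_continuous.
  - by move=> y /c0 ->.
by apply/eqP; rewrite -subr_eq0 Hc// cx scale0r.
Qed.

End prequantization.

Theorem lemma5p4 (R : realType) (X : orbifold R) (w : symplectic_form X)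
    (hbar : R) (hbar_gt0 : 0 < hbar) (L : orbi_line X)
    (D : orbi_connection L) (D_unitary : forall i, unitary_connection (D i)) :
  let Q := prequantum w D hbar in
  (forall f g, orbi_function f -> orbi_function g ->
     forall s, orbi_section s -> forall i x, Dom X i x ->
       Q f (Q g s) i x - Q g (Q f s) i x
         = ('i%C * hbar%:C%C) *: Q (poisson w f g) s i x)
  <->
  (forall i Y Z s,
     smooth (Dom X i) Y -> smooth (Dom X i) Z -> smooth_section s ->
     forall x, Dom X i x ->
       curvature (D i) Y Z s x
         = (- ('i%C / hbar%:C%C) * (w i x (Y x) (Z x))%:C%C) *: s x).
Proof.
move=> Q; split=> [comm i Y Z s sY sZ ss x dx|curv f g of_ og s os i x dx].
  exact: (curvature_everywhere hbar_gt0 comm sY sZ ss dx).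
have [sf _ _] := of_; have [sg _ _] := og; have [ss _ _] := os.
have sX := smooth_ham (dom_open _) (@omega_lin _ _ w i) (@omega_anti _ _ w i) (@omega_smooth _ _ w i)
   (@omega_nondegenerate _ _ w i) (sf i).
have sY := smooth_ham (dom_open _) (@omega_lin _ _ w i) (@omega_anti _ _ w i) (@omega_smooth _ _ w i)
   (@omega_nondegenerate _ _ w i) (sg i).
apply: etrans (commutator_formula w hbar_gt0 D of_ og os dx) _.
have -> := curv i _ _ _ sX sY (ss i) x dx.
by rewrite subrr scaler0 addr0.
Qed.
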